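(* Let $M$ be a smooth and connected one-dimensional manifold (possibly with boundary) equipped with a smooth Riemannian metric $g$ and complete as a metric space for the Riemannian distance. In $L^2(M;\mathbb{C})$, consider the Schrödinger operator $H_0=-\Delta_g+V$, with $V\in L^{\infty}_{\rm loc}(M;\mathbb{R})$ bounded from below and with a Dirichlet or a Neumann boundary condition at each boundary point if $M$ has boundary, and assume that $H_0$ is self-adjoint with compact resolvent. If $H_0$ admits two $\mathbb{C}$-linearly independent eigenfunctions $\phi_k$ and $\phi_\ell$ sharing the same modulus, then necessarily $M$ is a closed curve (i.e. isometric to $\mathbb{R}/L\mathbb{Z}$ for some $L>0$) and $\phi_k$, $\phi_\ell$ are nowhere vanishing on $M$. If, moreover, $\phi_k$ and $\phi_\ell$ correspond to distinct eigenvalues, then $V$ is constant.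
   Context: $\Delta_g$ is the Laplace--Beltrami operator of $(M,g)$. The domain of $H_0$ is the set of $\psi\in H^2(M;\mathbb{C})$ such that $-\Delta_g\psi+V\psi\in L^2(M;\mathbb{C})$ and such that, at each boundary point of $M$, the prescribed condition ($\psi=0$ for Dirichlet, $\partial_\nu\psi=0$ for Neumann, with $\nu$ the outer unit normal) holds. Two $\mathbb{C}$-linearly independent (complex-valued) eigenfunctions $\phi_k,\phi_\ell$ of $H_0$, associated with eigenvalues $\lambda_k,\lambda_\ell$ (possibly equal), are said to share the same modulus if $|\phi_k(x)|=|\phi_\ell(x)|$ for every $x\in M$. Since $V\in L^\infty_{\rm loc}$, ''constant'' means almost everywhere equal to a constant. *)

(* Defs.v *)
From HB Require Import structures.
From mathcomp Require Import all_boot all_order all_algebra.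
From mathcomp Require Import all_classical all_reals all_analysis.
From mathcomp Require Import complex.
Set Implicit Arguments.
Unset Strict Implicit.
Unset Printing Implicit Defensive.
Import Order.TTheory GRing.Theory Num.Theory.
Import numFieldNormedType.Exports.
Local Open Scope classical_set_scope.
Local Open Scope complex_scope.
Local Open Scope ring_scope.

(** Calculus on relatively open subsets of the half-line [0, +oo[, the local
    model of one-dimensional manifolds with boundary. *)

Section Calculus.
Context {R : realType}.
Implicit Types (A O : set R) (f u v : R -> R).

Definition smooth_fun f : Prop := forall n t, derivable (derive1n n f) t 1.

Definition smooth_on A f : Prop :=
  forall t, A t -> exists2 F : R -> R,
    smooth_fun F & \forall s \near t, A s -> F s = f s.

(* For a smooth f on a relatively open subset of [0, +oo[, the points on the
   right of t are in the domain of f, so the right derivative is the derivative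
   of f at t, including at the boundary point t = 0. *)
Definition half_deriv f (t : R) : R :=
  lim ((fun h : R => h^-1 * (f (t + h) - f t)) @ 0^'+).

Definition test_fun O f : Prop :=
  smooth_fun f /\
  exists K, [/\ compact K, K `<=` O & forall t, ~ K t -> f t = 0].

Definition weak_deriv O u v : Prop :=
  [/\ locally_integrable O u, locally_integrable O v &
   forall eta, test_fun O eta ->
     (\int[lebesgue_measure]_(t in O) (u t * derive1 eta t) =
      - \int[lebesgue_measure]_(t in O) (v t * eta t))%R].

Definition weak_derivC O (u v : R -> R[i]) : Prop :=
  weak_deriv O (fun t => complex.Re (u t)) (fun t => complex.Re (v t)) /\
  weak_deriv O (fun t => complex.Im (u t)) (fun t => complex.Im (v t)).

Definition continuousC (T : topologicalType) (f : T -> R[i]) : Prop :=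
  continuous (fun x => complex.Re (f x)) /\
  continuous (fun x => complex.Im (f x)).

Definition continuousC_within A (f : R -> R[i]) : Prop :=
  {within A, continuous (fun t => complex.Re (f t))} /\
  {within A, continuous (fun t => complex.Im (f t))}.

End Calculus.

(** Smooth one-dimensional manifolds with boundary. *)

Record chart (R : realType) (M : topologicalType) := Chart {
  cdom : set M;
  cmap : M -> R;
  cinv : R -> M;
  cdom_open : open cdom;
  cimg_open : exists2 O : set R, open O & cmap @` cdom = O `&` [set t | 0 <= t];
  cmapK : forall p, cdom p -> cinv (cmap p) = p;
  cmap_continuous : {within cdom, continuous cmap};
  cinv_continuous : {within cmap @` cdom, continuous cinv} }.

(* A smooth structure is given by an atlas from which one chart around each
   point has been singled out. The preferred chart at p identifies the tangent
   line T_p M with R, so that vector fields, covector fields, and bilinear forms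
   are functions on M. *)
Record atlas (R : realType) (M : topologicalType) := Atlas {
  chart_at : M -> chart R M;
  chart_at_dom : forall p, cdom (chart_at p) p;
  transition_smooth : forall p q,
    smooth_on (cmap (chart_at p) @` (cdom (chart_at p) `&` cdom (chart_at q)))
      (cmap (chart_at q) \o cinv (chart_at p)) }.

Section Manifold.
Context {R : realType} {M : topologicalType} (A : atlas R M).
Implicit Types (p q x : M) (t : R).

Definition cimg x : set R := cmap (chart_at A x) @` cdom (chart_at A x).

Definition cint x : set R := cimg x `&` [set t | 0 < t].

Definition boundary_point p : Prop := cmap (chart_at A p) p = 0.

(* The derivative at p of the transition map from the chart at x to the
   preferred chart at p. *)
Definition jac x p : R :=
  half_deriv (cmap (chart_at A p) \o cinv (chart_at A x))
    (cmap (chart_at A x) p).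

(* Coordinate expressions in the chart at x of a complex function, a complex
   covector field, and a real bilinear form. *)
Definition fun_loc (psi : M -> R[i]) x t : R[i] := psi (cinv (chart_at A x) t).

Definition covector_loc (a : M -> R[i]) x t : R[i] :=
  let p := cinv (chart_at A x) t in a p * (jac x p)%:C.

Definition bilinear_loc (g : M -> R) x t : R :=
  let p := cinv (chart_at A x) t in g p * jac x p ^+ 2.

Definition smooth_curve (gamma : R -> M) : Prop :=
  continuous gamma /\
  forall x, smooth_on [set t | cdom (chart_at A x) (gamma t)]
              (cmap (chart_at A x) \o gamma).

End Manifold.

Record riemannian_metric (R : realType) (M : topologicalType) (A : atlas R M) :=
  RiemannianMetric {
    metric :> M -> R;
    metric_gt0 : forall p, 0 < metric p;
    metric_smooth : forall x, smooth_on (cimg A x) (bilinear_loc A metric x) }.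

Section Riemannian.
Context {R : realType} {M : topologicalType} {A : atlas R M}.
Variable g : riemannian_metric A.
Implicit Types (gamma : R -> M) (p q : M).

Definition speed gamma (t : R) : R :=
  Num.sqrt (g (gamma t)) * `|derive1 (cmap (chart_at A (gamma t)) \o gamma) t|.

Definition C1_at gamma (t : R) : Prop :=
  forall x, cdom (chart_at A x) (gamma t) ->
    let u := cmap (chart_at A x) \o gamma in
    (\forall s \near t, derivable u s 1) /\ {for t, continuous (derive1 u)}.

(* Continuous on [0, 1] and C^1 on ]0, 1[ outside a finite set. *)
Definition piecewise_C1 gamma : Prop :=
  {within `[0, 1], continuous gamma} /\
  exists s : seq R, forall t, 0 < t < 1 -> t \notin s -> C1_at gamma t.

Definition curve_length gamma : \bar R :=
  (\int[lebesgue_measure]_(t in `[0%R, 1%R]) (speed gamma t)%:E)%E.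

Definition riemannian_dist p q : \bar R :=
  ereal_inf [set l | exists gamma, [/\ piecewise_C1 gamma, gamma 0 = p,
                                      gamma 1 = q & l = curve_length gamma]].

Definition riemannian_complete : Prop :=
  forall u : nat -> M,
    (forall e : R, 0 < e -> exists N : nat, forall m n : nat,
       (N <= m)%N -> (N <= n)%N -> (riemannian_dist (u m) (u n) < e%:E)%E) ->
    exists p, (fun n => riemannian_dist (u n) p) @ \oo --> 0%E.

End Riemannian.

(** The circle R / LZ. *)

Section Circle.
Context {R : realType}.
Variable L : R.

Definition period_rel (s t : R) : bool :=
  `[< exists n : int, s = t + n%:~R * L >].

Lemma period_rel_refl : reflexive period_rel.
Proof. by move=> s; apply/asboolP; exists 0; rewrite mul0r addr0. Qed.

Lemma period_rel_sym : symmetric period_rel.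
Proof.
have sub s t : period_rel s t -> period_rel t s.
  by move=> /asboolP[n ->]; apply/asboolP; exists (- n);
    rewrite mulrNz mulNr addrK.
by move=> s t; apply/idP/idP; apply: sub.
Qed.

Lemma period_rel_trans : transitive period_rel.
Proof.
move=> t s u /asboolP[n ->] /asboolP[m ->]; apply/asboolP; exists (m + n).
by rewrite mulrzDr mulrDl addrA.
Qed.

Canonical period_equiv :=
  EquivRel period_rel period_rel_refl period_rel_sym period_rel_trans.

Definition circle : Type := {eq_quot period_equiv}%qT.

Definition to_circle (t : R) : circle := (\pi_({eq_quot period_equiv}) t)%qT.

End Circle.

(* A Riemannian isometry from R / LZ onto M: the smooth and metric structures of
   R / LZ are those for which the projection R -> R / LZ is a local isometry, so
   such a map is a bijection F whose lift to R is smooth with unit speed (the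
   inverse of F is then smooth). *)
Definition isometric_to_circle (R : realType) (M : topologicalType)
    (A : atlas R M) (g : riemannian_metric A) (L : R) : Prop :=
  exists F : circle L -> M,
    [/\ bijective F, smooth_curve A (F \o to_circle L) &
        forall t, speed g (F \o to_circle L) t = 1].

Notation borel M := (g_sigma_algebraType (@open M)).

(** Square-integrable complex functions and unbounded operators. Operators are
    given by their graphs, as relations between representatives. *)

Section Operators.
Context d (T : measurableType d) {R : realType}.
Variable mu : {measure set T -> \bar R}.
Implicit Types (u v w f psi : T -> R[i]) (H : (T -> R[i]) -> (T -> R[i]) -> Prop).

Definition measurableC f : Prop :=
  measurable_fun [set: T] (fun p => complex.Re (f p)) /\
  measurable_fun [set: T] (fun p => complex.Im (f p)).

Definition L2_normsq f : \bar R :=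
  (\int[mu]_p (complex.Re (f p) ^+ 2 + complex.Im (f p) ^+ 2)%:E)%E.

Definition L2 f : Prop := measurableC f /\ (L2_normsq f < +oo)%E.

Definition inner u v : R[i] :=
  (\int[mu]_p complex.Re (conjc (u p) * v p))%R +i*
  (\int[mu]_p complex.Im (conjc (u p) * v p))%R.

Definition ae_equal u v : Prop := {ae mu, forall p, u p = v p}.

Definition densely_defined H : Prop :=
  forall f, L2 f -> forall e : R, 0 < e ->
    exists psi w, H psi w /\ (L2_normsq (fun p => (f p - psi p)%R) < e%:E)%E.

Definition adjoint H u w : Prop :=
  [/\ L2 u, L2 w & forall psi f, H psi f -> inner u f = inner w psi].

(* The right-hand side says that the classes of u and w are in the graph of H. *)
Definition self_adjoint H : Prop :=
  densely_defined H /\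
  forall u w, adjoint H u w <->
    L2 u /\ exists2 psi, ae_equal u psi & H psi w.

(* At some z, H - z is one-to-one and onto, and (H - z)^-1 maps bounded
   sequences to sequences with a convergent subsequence. *)
Definition compact_resolvent H : Prop :=
  exists z : R[i],
  let Hz psi f := H psi (fun p => f p + z * psi p) in
  [/\ forall f, L2 f -> exists psi, Hz psi f,
      forall psi, Hz psi (fun=> 0) -> ae_equal psi (fun=> 0) &
      forall (f psi : nat -> T -> R[i]) (C : R),
        (forall n, [/\ L2 (f n), (L2_normsq (f n) <= C%:E)%E &
                       Hz (psi n) (f n)]) ->
        exists (k : nat -> nat) (chi : T -> R[i]),
          [/\ {homo k : m n / (m < n)%N}, L2 chi &
              (fun n => L2_normsq (fun p => psi (k n) p - chi p)) @ \oo --> 0%E]].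

Definition eigenfunction H (lam : R[i]) psi : Prop :=
  H psi (fun p => lam * psi p) /\ ~ ae_equal psi (fun=> 0).

End Operators.

Variant boundary_condition := Dirichlet | Neumann.

Section Schrodinger.
Context {R : realType} {M : ptopologicalType} {A : atlas R M}.
Variable g : riemannian_metric A.
Variable mu : {measure set (borel M) -> \bar R}.

Definition riemannian_volume : Prop :=
  forall x (B : set (borel M)), measurable B -> B `<=` cdom (chart_at A x) ->
    mu B = (\int[lebesgue_measure]_(t in cmap (chart_at A x) @` B)
              (Num.sqrt (bilinear_loc A g x t))%:E)%E.

Definition Linfty_loc (V : M -> R) : Prop :=
  measurable_fun [set: borel M] V /\
  forall K : set M, compact K ->
    exists C : R, {ae mu, forall p : borel M, K p -> `|V p| <= C}.

Definition ess_bounded_below (V : M -> R) : Prop :=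
  exists C : R, {ae mu, forall p : borel M, C <= V p}.

Definition weak_gradient (psi dpsi : M -> R[i]) : Prop :=
  forall x, weak_derivC (cint A x) (fun_loc A psi x) (covector_loc A dpsi x).

(* lap = g^(-1/2) (g^(1/2) g^(-1) psi')' in each chart. *)
Definition weak_laplacian (dpsi lap : M -> R[i]) : Prop :=
  forall x, weak_derivC (cint A x)
    (fun t => (Num.sqrt (bilinear_loc A g x t))^-1%:C * covector_loc A dpsi x t)
    (fun t => (Num.sqrt (bilinear_loc A g x t))%:C * fun_loc A lap x t).

(* Pointwise Riemannian norm of a covector field. *)
Definition covector_norm (a : M -> R[i]) (p : M) : R[i] :=
  `|a p| * (Num.sqrt (g p))^-1%:C.

(* psi is in H^2(M; C) with gradient dpsi and Laplacian lap. As M has dimension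
   one, the Hessian of psi is lap * g, so that its norm is |lap|. An element of
   H^2(M; C) has a unique representative of class C^1, and psi and dpsi are
   required to be that representative and its differential; this gives their
   values at boundary points. *)
Definition H2 (psi dpsi lap : M -> R[i]) : Prop :=
  [/\ continuousC psi /\
        (forall x, continuousC_within (cimg A x) (covector_loc A dpsi x)),
      weak_gradient psi dpsi, weak_laplacian dpsi lap &
      [/\ @L2 _ (borel M) R mu psi, @L2 _ (borel M) R mu (covector_norm dpsi) &
          @L2 _ (borel M) R mu lap]].

(* The preferred chart maps a boundary point p to 0 and its image is in
   [0, +oo[, so the outer unit normal at p has coordinate -g(p)^(-1/2). *)
Definition normal_deriv (dpsi : M -> R[i]) (p : M) : R[i] :=
  - (Num.sqrt (g p))^-1%:C * dpsi p.

Definition satisfies_bc (bc : M -> boundary_condition) (psi dpsi : M -> R[i]) :=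
  forall p, boundary_point A p ->
    match bc p with
    | Dirichlet => psi p = 0
    | Neumann => normal_deriv dpsi p = 0
    end.

(* The graph of H_0: psi is in the domain and w represents H_0 psi. *)
Definition schrodinger (V : M -> R) (bc : M -> boundary_condition)
    (psi w : borel M -> R[i]) : Prop :=
  exists dpsi lap : M -> R[i],
    [/\ H2 psi dpsi lap,
        @L2 _ (borel M) R mu (fun p => - lap p + (V p)%:C * psi p),
        satisfies_bc bc psi dpsi, L2 mu w &
        ae_equal mu w (fun p => - lap p + (V p)%:C * psi p)].

End Schrodinger.

Definition lin_independent2 (R : realType) (T : Type) (f h : T -> R[i]) : Prop :=
  forall a b : R[i], (forall x, a * f x + b * h x = 0) -> a = 0 /\ b = 0.

Definition share_modulus (R : realType) (T : Type) (f h : T -> R[i]) : Prop :=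
  forall x, `|f x| = `|h x|.

(* Main.v *)
Require Import Defs.
From HB Require Import structures.
From mathcomp Require Import all_boot all_order all_algebra.
From mathcomp Require Import all_classical all_reals all_analysis.
From mathcomp Require Import measurable_realfun complex ring lra.
Set Implicit Arguments.
Unset Strict Implicit.
Unset Printing Implicit Defensive.
Import Order.TTheory GRing.Theory Num.Theory.
Import numFieldNormedType.Exports.
Local Open Scope classical_set_scope.
Local Open Scope complex_scope.
Local Open Scope ring_scope.

(** Write u' for the derivative of phi divided by the square root of the metric.
    The flux w = Im(conj(phi) u') of an eigenfunction is locally constant up to
    the choice of orientation, hence |w| is constant on M. A common modulus gives
    (lambda_k - lambda_l) |phi|^4 = w_k^2 - w_l^2. If both fluxes vanish, then the
    eigenvalues are equal, some combination of phi_k and phi_l vanishes to first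
    order at a point, and unique continuation makes them proportional.

    So one flux is nonzero. Its eigenfunction does not vanish anywhere, and M has
    no boundary because a Dirichlet or Neumann condition kills the flux. Moreover
    omega = Im(conj(phi) dphi) / |w| is a one-form with omega^2 = g, which orients
    M and whose unit speed curves define a local flow. If an orbit returns to
    its starting point, it is periodic and parametrizes M isometrically by a
    circle. If it does not, there is a function chi that increases from 0 to a
    constant along a short arc and is locally constant elsewhere; then chi phi is in
    the domain of the operator, and its symmetry forces the integral of the
    derivative of chi along the flow to vanish, a contradiction.

    For distinct eigenvalues the identity above makes the modulus r of phi constant,
    so phi rotates at constant rate and V = lambda - w^2 / r^4. *)

(** * Derivatives and smooth functions on the line *)

(** The potential is only locally bounded, so the derivative of a solution with respect to arc
    length has merely a weak derivative, and second order computations cannot be made pointwise on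
    one function at a time. They are made on combinations in which [V] multiplies a continuous
    function vanishing at the point considered: this product tends to 0 off null sets, so the
    combination is differentiable there. The constancy of the flux and the second derivative of the
    common squared modulus are both of this kind.

    To first order, equal moduli give equal values of Re(conj(phi) u'); to second order, the
    difference of the |u'|^2 is (lambda_k - lambda_l) |phi|^2. Lagrange's identity |phi|^2 |u'|^2 =
    Re(conj(phi) u')^2 + w^2 then produces the relation between the fluxes.

    The cutoff chi may lack compact support: it suffices that chi and its first two derivatives
    along the flow are bounded. Since omega is parallel, Im(conj(phi) [Delta, chi] phi) is 2 |w|
    times the derivative of chi along the flow, which has a constant sign. *)

Section Derivatives.
Context {R : realType}.
Implicit Types (f g : R -> R) (t l : R).

(* An alias of [is_derive] that is not a class, so that no instance search is
   triggered. *)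
Definition has_derive f t l : Prop := is_derive t (1 : R) f l.

Lemma has_deriveP f t l :
  has_derive f t l <->
  forall e : R, 0 < e ->
    \forall y \near t, `|f y - f t - l * (y - t)| <= e * `|y - t|.
Proof.
split=> [/is_derive1_caratheodory[h [fE hC hE]] e e0|H].
  move/cvgrPdist_le : hC => /(_ _ e0).
  apply: filterS => y; rewrite hE => hy.
  by rewrite fE -mulrBl normrM ler_wpM2r// distrC.
apply/is_derive1_caratheodory.
exists (fun z => if z == t then l else (f z - f t) / (z - t)); split.
- move=> z; case: eqP => [->|/eqP]; first by rewrite !subrr mulr0.
  by rewrite -subr_eq0 => /divfK.
- apply/cvgrPdist_le => e e0; rewrite eqxx.
  have := H _ e0; apply: filterS => y.
  have [->|] := eqVneq y t; first by move=> _; rewrite subrr normr0; exact: ltW.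
  rewrite -subr_eq0 => yt H'.
  have yt' : 0 < `|y - t| by rewrite normr_gt0.
  by rewrite -(ler_pM2r yt') -normrM mulrBl divfK// distrC.
- by rewrite eqxx.
Qed.

Lemma has_derive_continuous f t l : has_derive f t l -> {for t, continuous f}.
Proof. by case=> df _; apply/differentiable_continuous/derivable1_diffP. Qed.

Lemma has_derive_unique f t l l' :
  has_derive f t l -> has_derive f t l' -> l = l'.
Proof. by move=> [_ <-] [_ <-]. Qed.

Lemma has_derive_derivable f t l : has_derive f t l -> derivable f t 1.
Proof. by case. Qed.

Lemma derivable_has_derive f t : derivable f t 1 -> has_derive f t (derive1 f t).
Proof. by move=> /derivableP; rewrite derive1E. Qed.

Lemma has_derive_derive1 f t l : has_derive f t l -> derive1 f t = l.
Proof. by rewrite derive1E => -[_ ->]. Qed.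

Lemma has_derive_eq f t l l' : has_derive f t l -> l = l' -> has_derive f t l'.
Proof. by move=> + <-. Qed.

Lemma near_has_derive f g t l : (\forall s \near t, f s = g s) ->
  has_derive f t l -> has_derive g t l.
Proof. exact: near_eq_is_derive. Qed.

Lemma has_derive_cst (c t : R) : has_derive (fun=> c) t 0.
Proof. exact: is_derive_cst. Qed.

Lemma has_derive_id t : has_derive id t 1.
Proof. exact: is_derive_id. Qed.

Lemma has_deriveM f g t l l' : has_derive f t l -> has_derive g t l' ->
  has_derive (fun x => f x * g x) t (l * g t + f t * l').
Proof.
move=> df dg; have : is_derive t 1 (f * g) (f t *: l' + g t *: l) by exact: is_deriveM.
by rewrite /GRing.scale/= addrC (mulrC (g t)).
Qed.

Lemma has_deriveD f g t l l' : has_derive f t l -> has_derive g t l' ->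
  has_derive (fun x => f x + g x) t (l + l').
Proof. exact: is_deriveD. Qed.

Lemma has_deriveN f t l : has_derive f t l -> has_derive (fun x => - f x) t (- l).
Proof. exact: is_deriveN. Qed.

Lemma has_deriveB f g t l l' : has_derive f t l -> has_derive g t l' ->
  has_derive (fun x => f x - g x) t (l - l').
Proof. exact: is_deriveB. Qed.

Lemma has_deriveMl (c : R) f t l :
  has_derive f t l -> has_derive (fun x => c * f x) t (c * l).
Proof.
move=> df; apply: has_derive_eq (has_deriveM (has_derive_cst c t) df) _.
by rewrite mul0r add0r.
Qed.

Lemma has_deriveV f t l : f t != 0 -> has_derive f t l ->
  has_derive (fun x => (f x)^-1) t (- l / f t ^+ 2).
Proof.
move=> f0 df; have : is_derive t 1 (fun y => (f y)^-1) (- (f t) ^- 2 *: l).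
  exact: is_deriveV.
by rewrite /GRing.scale/= mulNr mulrC -mulNr.
Qed.

Lemma has_derive_comp f g t l l' :
  has_derive f (g t) l -> has_derive g t l' ->
  has_derive (fun x => f (g x)) t (l * l').
Proof. exact: is_derive1_comp. Qed.

(** At a zero of [f] only the Carathéodory slope of [f] matters, so continuity of [g] is enough. The
    factor [g] will be a momentum, which need not be differentiable. *)
Lemma has_derive_mul_vanishing f g t l : f t = 0 -> has_derive f t l ->
  {for t, continuous g} -> has_derive (fun x => f x * g x) t (l * g t).
Proof.
move=> f0 /is_derive1_caratheodory[h [fE hC hE]] gC.
apply/is_derive1_caratheodory; exists (fun z => h z * g z); split.
- move=> z; rewrite f0 mul0r subr0; have := fE z; rewrite f0 subr0 => ->.
  by rewrite mulrAC.
- by apply: continuousM.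
- by rewrite hE.
Qed.

Lemma near_between (a t b : R) : a < t < b -> \forall s \near t, a < s < b.
Proof.
move=> atb; have : t \in `]a, b[ by rewrite in_itv.
by move/near_in_itvoo; apply: filterS => s; rewrite in_itv.
Qed.

Lemma near_open (T : topologicalType) (O : set T) (t : T) (P : T -> Prop) :
  open O -> O t -> (forall s, O s -> P s) -> \forall s \near t, P s.
Proof. by move=> oO Ot H; near=> s; apply: H; near: s; exact: open_nbhs_nbhs.
Unshelve. all: by end_near. Qed.

Lemma near_eq_continuous (T U : topologicalType) (f g : T -> U) (t : T) :
  (\forall s \near t, f s = g s) -> {for t, continuous f} -> {for t, continuous g}.
Proof.
move=> fg; have E := nbhs_singleton fg.
rewrite /prop_for /continuous_at -E => fC.
by apply: cvg_trans fC; apply: near_eq_cvg.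
Qed.

Lemma open_continuousS (T U : topologicalType) (O : set T) (f g : T -> U) (t : T) :
  open O -> O t -> (forall s, O s -> f s = g s) ->
  {for t, continuous f} -> {for t, continuous g}.
Proof. by move=> oO Ot fg; apply: near_eq_continuous; exact: near_open Ot fg. Qed.

Lemma mean_value f (df : R -> R) x y : x <= y ->
  (forall t, x < t < y -> has_derive f t (df t)) -> {within `[x, y], continuous f} ->
  exists2 c, x <= c <= y & f y - f x = df c * (y - x).
Proof.
move=> xy H cf.
have H' t : t \in `]x, y[ -> has_derive f t (df t) by rewrite in_itv/=; apply: H.
have [c] := MVT_segment xy H' cf.
by rewrite in_itv/= => cxy E; exists c.
Qed.

Lemma within_has_derive f (df : R -> R) x y :
  (forall t, x <= t <= y -> has_derive f t (df t)) -> {within `[x, y], continuous f}.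
Proof.
move=> H; apply/continuous_in_subspaceT => t; rewrite inE/= in_itv/=.
by move=> /H/has_derive_continuous.
Qed.

Lemma has_derive0_cst f a b :
  (forall t, a < t < b -> has_derive f t 0) ->
  forall x y, a < x < b -> a < y < b -> f x = f y.
Proof.
move=> df x y; wlog xy : x y / x <= y => [H|].
  by case: (leP x y) => [|/ltW] xy hx hy; [|symmetry]; apply: H.
move=> /andP[ax xb] /andP[ay yb].
have df' t : x <= t <= y -> has_derive f t 0.
  move=> /andP[xt ty]; apply: df.
  by rewrite (lt_le_trans ax xt) (le_lt_trans ty yb).
have df'' t : x < t < y -> has_derive f t 0.
  by move=> /andP[xt ty]; apply: df'; rewrite !ltW.
have [c _] := mean_value xy df'' (within_has_derive df').
by rewrite mul0r => /eqP; rewrite subr_eq0 => /eqP.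
Qed.

End Derivatives.

(** * Smoothness on open sets of the line *)

Section Smooth.
Context {R : realType}.
Implicit Types (f g : R -> R) (O U : set R).

(** Recursion on the order lets the closure properties go by induction, and the set [O] admits
    functions that are smooth only in the interior of a chart image. *)
Fixpoint smooth_upto (n : nat) O f : Prop :=
  match n with
  | 0 => forall t, O t -> {for t, continuous f}
  | n.+1 => (forall t, O t -> derivable f t 1) /\ smooth_upto n O (derive1 f)
  end.

Lemma eq_smooth_upto n O f g : open O -> (forall t, O t -> f t = g t) ->
  smooth_upto n O f -> smooth_upto n O g.
Proof.
move=> oO; elim: n f g => [|n IH] f g fg /=.
  by move=> fC t Ot; apply: open_continuousS fg (fC _ Ot).
move=> [df sf]; split.
  move=> t Ot; apply: near_eq_derivable (df _ Ot).
  exact: near_open Ot _.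
apply: IH sf => t Ot; rewrite !derive1E; apply: near_eq_derive.
exact: near_open Ot _.
Qed.

Lemma smooth_upto_intro n O f f' : open O ->
  (forall t, O t -> has_derive f t (f' t)) -> smooth_upto n O f' ->
  smooth_upto n.+1 O f.
Proof.
move=> oO df sf'; split; first by move=> t /df/has_derive_derivable.
by apply: eq_smooth_upto sf' => // t /df/has_derive_derive1.
Qed.

Lemma smooth_upto_elim n O f : smooth_upto n.+1 O f ->
  (forall t, O t -> has_derive f t (derive1 f t)) /\ smooth_upto n O (derive1 f).
Proof. by move=> [df sf]; split => // t /df/derivable_has_derive. Qed.

Lemma smooth_uptoW n O f : smooth_upto n.+1 O f -> smooth_upto n O f.
Proof.
elim: n f => [|n IH] f /smooth_upto_elim[df sf].
  by move=> t /df/has_derive_continuous.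
by split; [move=> t /df/has_derive_derivable|exact: IH].
Qed.

Lemma smooth_uptoS n O U f : U `<=` O -> smooth_upto n O f -> smooth_upto n U f.
Proof.
move=> UO; elim: n f => [|n IH] f /=; first by move=> fC t /UO/fC.
by move=> [df /IH]; split => // t /UO/df.
Qed.

Lemma smooth_upto_cst n O (c : R) : open O -> smooth_upto n O (fun=> c).
Proof.
move=> oO; elim: n c => [|n IH] c; first by move=> t _; exact: cst_continuous.
apply: (@smooth_upto_intro _ _ _ (fun=> 0)) => // t _; exact: has_derive_cst.
Qed.

Lemma smooth_upto_id n O : open O -> smooth_upto n O id.
Proof.
move=> oO; case: n => [|n]; first by move=> t _.
apply: (@smooth_upto_intro _ _ _ (fun=> 1)) => //; last exact: smooth_upto_cst.
by move=> t _; exact: has_derive_id.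
Qed.

Lemma smooth_uptoD n O f g : open O -> smooth_upto n O f -> smooth_upto n O g ->
  smooth_upto n O (fun t => f t + g t).
Proof.
move=> oO; elim: n f g => [|n IH] f g.
  by move=> fC gC t Ot; apply: continuousD; [exact: fC|exact: gC].
move=> /smooth_upto_elim[df sf] /smooth_upto_elim[dg sg].
apply: (@smooth_upto_intro _ _ _ (fun t => derive1 f t + derive1 g t)) => //.
  by move=> t Ot; apply: has_deriveD; [exact: df|exact: dg].
exact: IH.
Qed.

Lemma smooth_uptoM n O f g : open O -> smooth_upto n O f -> smooth_upto n O g ->
  smooth_upto n O (fun t => f t * g t).
Proof.
move=> oO; elim: n f g => [|n IH] f g.
  by move=> fC gC t Ot; apply: continuousM; [exact: fC|exact: gC].
move=> sf0 sg0.
have [df sf] := smooth_upto_elim sf0; have [dg sg] := smooth_upto_elim sg0.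
apply: (@smooth_upto_intro _ _ _
  (fun t => derive1 f t * g t + f t * derive1 g t))=> //.
  by move=> t Ot; apply: has_deriveM; [exact: df|exact: dg].
by apply: smooth_uptoD => //; apply: IH => //; exact: smooth_uptoW.
Qed.

Lemma smooth_upto_comp n O U f g : open O -> open U ->
  (forall t, O t -> U (g t)) -> smooth_upto n U f -> smooth_upto n O g ->
  smooth_upto n O (fun t => f (g t)).
Proof.
move=> oO oU OU; elim: n f g OU => [|n IH] f g OU.
  by move=> fC gC t Ot; apply: continuous_comp; [exact: gC|exact/fC/OU].
move=> sf0 sg0.
have [df sf] := smooth_upto_elim sf0; have [dg sg] := smooth_upto_elim sg0.
apply: (@smooth_upto_intro _ _ _
  (fun t => derive1 f (g t) * derive1 g t)) => //.
  by move=> t Ot; apply: has_derive_comp; [exact/df/OU|exact: dg].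
by apply: smooth_uptoM => //; apply: IH => //; exact: smooth_uptoW.
Qed.

Lemma smooth_uptoV n O f : open O -> (forall t, O t -> f t != 0) ->
  smooth_upto n O f -> smooth_upto n O (fun t => (f t)^-1).
Proof.
move=> oO; elim: n f => [|n IH] f f0.
  by move=> fC t Ot; apply: continuousV; [exact: f0|exact: fC].
move=> sf0; have [df sf] := smooth_upto_elim sf0.
apply: (@smooth_upto_intro _ _ _
  (fun t => (- 1 * derive1 f t) * ((f t)^-1 * (f t)^-1))) => //.
  move=> t Ot; apply: has_derive_eq (has_deriveV (f0 _ Ot) (df _ Ot)) _.
  by rewrite mulN1r expr2 invfM.
have sV : smooth_upto n O (fun t => (f t)^-1) by apply: IH => //; exact: smooth_uptoW.
by apply: smooth_uptoM => //; apply: smooth_uptoM => //; exact: smooth_upto_cst.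
Qed.

Lemma smooth_upto_sqrt n : smooth_upto n [set t : R | 0 < t] Num.sqrt.
Proof.
have oP : open [set t : R | 0 < t] by exact: open_gt.
elim: n => [|n IH]; first by move=> t _; exact: sqrt_continuous.
apply: (@smooth_upto_intro _ _ _ (fun t => (2 * Num.sqrt t)^-1)) => //.
  by move=> t t0; exact: is_derive1_sqrt.
apply: smooth_uptoV => //.
  by move=> t /= t0; rewrite mulf_neq0// gt_eqF// sqrtr_gt0.
by apply: smooth_uptoM => //; exact: smooth_upto_cst.
Qed.

Lemma smooth_funP f : smooth_fun f <-> forall n, smooth_upto n setT f.
Proof.
have H n : (forall k t, (k < n)%N -> derivable (derive1n k f) t 1) ->
    forall t, derivable (derive1n n f) t 1 -> {for t, continuous (derive1n n f)}.
  by move=> _ t /derivable1_diffP/differentiable_continuous.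
split=> [sf n|sf n t].
  have : forall k, smooth_upto n setT (derive1n k f); last by move/(_ 0%N).
  elim: n => [|n IH] k /=.
    by move=> t _; exact/differentiable_continuous/derivable1_diffP/sf.
  by split; [move=> t _; exact: sf|rewrite -derive1nS].
elim: n f sf {H} => [|n IH] f sf; first exact: (sf 1%N).1.
rewrite derive1Sn; apply: IH => m; exact: (sf m.+1).2.
Qed.

Lemma smooth_upto_cover n O U f : smooth_upto n O f -> smooth_upto n U f ->
  smooth_upto n (O `|` U) f.
Proof.
elim: n f => [|n IH] f /=; first by move=> fO fU t [/fO|/fU].
by move=> [dO sO] [dU sU]; split; [move=> t [/dO|/dU]|exact: IH].
Qed.

Lemma smooth_upto_pointwise n O f :
  (forall t, O t -> exists2 U, U t & smooth_upto n U f) -> smooth_upto n O f.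
Proof.
elim: n f => [|n IH] f H /=; first by move=> t /H[U Ut]; exact.
split; first by move=> t /H[U Ut] [+ _]; exact.
by apply: IH => t /H[U Ut] [_ sf]; exists U.
Qed.

(** The open sets [O] and the complement of [K] cover the line, and [f] is smooth on each of
    them. *)
Lemma smooth_fun_glue O (K : set R) f : open O -> closed K -> K `<=` O ->
  (forall n, smooth_upto n O f) -> (forall t, ~ K t -> f t = 0) -> smooth_fun f.
Proof.
move=> oO cK KO sf f0; apply/smooth_funP => n.
have -> : setT = O `|` ~` K.
  by apply/esym/seteqP; split => // t _; have [/KO|] := pselect (K t); [left|right].
apply: smooth_upto_cover => //.
apply: (@eq_smooth_upto _ _ (fun=> 0)); first exact: closed_openC.
  by move=> t /f0.
exact/smooth_upto_cst/closed_openC.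
Qed.

End Smooth.

Section Primitive.
Context {R : realType}.
Implicit Types (f : R -> R).

Lemma primitive_right f (a : R) : continuous f ->
  exists F : R -> R, forall t, a < t -> has_derive F t (f t).
Proof.
move=> cf.
exists (fun y => (\int[lebesgue_measure]_(t in `[a, y]) f t)%R) => t at_.
have tt1 : t < t + 1 by rewrite ltrDl.
have fi : lebesgue_measure.-integrable `[a, t + 1] (EFin \o f).
  apply: continuous_compact_integrable; first exact: segment_compact.
  exact: continuous_subspaceT.
have [dF <-] := continuous_FTC1_closed tt1 fi at_ (cf t).
exact: derivable_has_derive.
Qed.

Lemma has_derive_ext_cst f g h (a : R) :
  (forall t, a < t -> has_derive f t (h t)) ->
  (forall t, a < t -> has_derive g t (h t)) ->
  forall x y, a < x -> a < y -> f x - f y = g x - g y.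
Proof.
move=> df dg x y ax ay.
have d0 t : a < t < Num.max x y + 1 -> has_derive (fun s => f s - g s) t 0.
  move=> /andP[at_ _]; rewrite -(subrr (h t)).
  by apply: has_deriveB; [exact: df|exact: dg].
have := has_derive0_cst d0 (x := x) (y := y).
rewrite ax ay !ltr_pwDr ?le_max ?lexx ?orbT// => /(_ erefl erefl).
lra.
Qed.

Lemma primitive f : continuous f ->
  exists F : R -> R, forall t, has_derive F t (f t).
Proof.
move=> cf; have [P PE] := choice (fun a => primitive_right a cf).
(* The base point lies strictly to the left of both y and 0. Normalising at 0 makes the value
   independent of the base point, so the primitives on half-lines fit together. *)
pose A y : R := Num.min y 0 - 1.
exists (fun y => P (A y) y - P (A y) 0) => t.
apply: (@near_has_derive _ (fun y => P (A t - 1) y - P (A t - 1) 0)).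
  near=> s.
  have ts : A t - 1 < A s.
    have : `|t - s| < 1 by near: s; exact: cvgr_dist_lt.
    by rewrite /A ltr_norml => /andP[? ?]; rewrite /Num.min; case: ifP; case: ifP; lra.
  apply: (@has_derive_ext_cst _ _ f (A s)).
  - by move=> u us; apply: PE; apply: lt_trans us.
  - by move=> u us; apply: PE.
  - by rewrite /A ltrBlDr ltr_pwDr// ge_min lexx.
  - by rewrite /A ltrBlDr ltr_pwDr// ge_min lexx orbT.
rewrite -[f t]subr0; apply: has_deriveB; last exact: has_derive_cst.
apply: PE; rewrite /A /Num.min; case: ifP; lra.
Unshelve. all: by end_near. Qed.

End Primitive.

(** * Flat functions, bumps, and smooth steps *)

Section Bump.
Context {R : realType}.

(** The powers of 1/t make the family closed under differentiation up to linear combinations, so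
    smoothness of exp(-1/t) at 0 follows by induction on the order for all [k] at once. *)
Definition flat_exp (k : nat) (t : R) : R :=
  if 0 < t then (t ^+ k)^-1 * expR (- t^-1) else 0.
Local Notation flat := flat_exp.

Lemma flat_ge0 k t : 0 <= flat k t.
Proof.
rewrite /flat; case: ifP => // t0.
by rewrite mulr_ge0 ?expR_ge0// invr_ge0 exprn_ge0// ltW.
Qed.

(** With u = 1/t this is u^k exp(-u) <= k!, a bound of the exponential from below by one term of its
    series. *)
Lemma flat_le k t : flat k t <= (k`!)%:R.
Proof.
rewrite /flat; case: ifPn => [t0|_]; last exact: ler0n.
have u0 : 0 < t^-1 by rewrite invr_gt0.
rewrite expRN ler_pdivrMr ?expR_gt0// -exprVn.
case: k => [|k].
  rewrite expr0 mul1r; apply: le_trans (expR_ge1Dx _).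
  by rewrite lerDl ltW.
have k0 : (0 : R) < (k.+1`!)%:R by rewrite ltr0n fact_gt0.
rewrite -ler_pdivrMl// mulrC; apply: le_trans (expR_ge1Dxn k (ltW u0)).
by rewrite lerDr.
Qed.

Lemma flatS k t : flat k t = flat k.+1 t * t.
Proof.
rewrite /flat; case: (ltP 0 t) => [t0|_]; last by rewrite mul0r.
have tN : t != 0 by rewrite gt_eqF.
by rewrite exprS; field; rewrite expf_neq0 ?tN.
Qed.

Lemma flat_derive k t : has_derive (flat k) t (flat k.+2 t + - k%:R * flat k.+1 t).
Proof.
have [t0|t0|->] := ltgtP t 0.
- apply: (@near_has_derive _ (fun=> 0)).
    have : t - 1 < t < 0 by rewrite t0; lra.
    by move/near_between; apply: filterS => s /andP[_ s0]; rewrite /flat ltNge (ltW s0).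
  by rewrite /flat ltNge (ltW t0)/= mulr0 addr0; exact: has_derive_cst.
- apply: (@near_has_derive _ (fun s => (s ^+ k)^-1 * expR (- s^-1))).
    have : 0 < t < t + 1 by rewrite t0; lra.
    by move/near_between; apply: filterS => s /andP[s0 _]; rewrite /flat s0.
  have tN : t != 0 by rewrite gt_eqF.
  have d1 : has_derive (fun s : R => s ^+ k) t (k%:R * t ^+ k.-1).
    have := derivable_has_derive (@exprn_derivable _ k t 1).
    by rewrite exp_derive1.
  have d2 : has_derive (fun s : R => - s^-1) t (t ^- 2).
    apply: has_derive_eq (has_deriveN (has_deriveV tN (has_derive_id t))) _.
    by rewrite mulNr opprK mul1r.
  have d3 := @has_derive_comp _ expR _ t _ _ (is_derive_expR (- t^-1)) d2.
  apply: has_derive_eq (has_deriveM (has_deriveV _ d1) d3) _.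
    by rewrite expf_neq0.
  rewrite /flat t0; case: k {d1} => [|k] /=.
    by rewrite !expr0; field.
  by rewrite !exprS; field; rewrite tN expf_neq0.
(* At 0, two uses of [flatS] write the function as y^2 times the one of index k + 2, which is
   bounded; hence it is O(y^2). *)
- rewrite /flat ltxx mulr0 addr0; apply/has_deriveP => e e0.
  pose C : R := (k.+2`!)%:R.
  have C0 : 0 < C by rewrite ltr0n fact_gt0.
  near=> y; rewrite ltxx !subr0 mul0r subr0 -/(flat k y) flatS flatS -mulrA.
  rewrite normrM (ger0_norm (flat_ge0 _ _)) normrM mulrA ler_wpM2r//.
  apply: (@le_trans _ _ (C * `|y|)); first by rewrite ler_wpM2r// flat_le.
  rewrite -ler_pdivlMl// -[y]subr0 distrC ltW//.
  by near: y; apply: cvgr_dist_lt => //; rewrite mulr_gt0// invr_gt0.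
Unshelve. all: by end_near. Qed.

Lemma flat_smooth n k : smooth_upto n setT (flat k).
Proof.
elim: n k => [|n IH] k.
  by move=> t _; exact: has_derive_continuous (flat_derive k t).
apply: (@smooth_upto_intro _ _ _ _ (fun t => flat k.+2 t + - k%:R * flat k.+1 t)).
- exact: openT.
- by move=> t _; exact: flat_derive.
- apply: smooth_uptoD => //; first exact: openT.
  apply: smooth_uptoM => //; first exact: openT.
  by apply: smooth_upto_cst; exact: openT.
Qed.

Lemma bump (d : R) : 0 < d -> exists j : R -> R,
  [/\ smooth_fun j, forall t, 0 <= j t, forall t, 0 < t < d -> 0 < j t &
      forall t, ~ (0 < t < d) -> j t = 0].
Proof.
move=> d0; exists (fun t => flat 0 t * flat 0 (d + - 1 * t)); split.
- apply/smooth_funP => n; have oT : open [set: R] by exact: openT.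
  apply: smooth_uptoM => //; first exact: flat_smooth.
  apply: (@smooth_upto_comp _ _ _ setT (flat 0) (fun t => d + - 1 * t)) => //; first exact: flat_smooth.
  apply: smooth_uptoD => //; first exact: smooth_upto_cst.
  by apply: smooth_uptoM => //; [exact: smooth_upto_cst|exact: smooth_upto_id].
- by move=> t; rewrite mulr_ge0// flat_ge0.
- move=> t /andP[t0 td]; rewrite /flat t0 mulN1r subr_gt0 td.
  by rewrite !mulr_gt0 ?expR_gt0// invr_gt0 exprn_gt0// subr_gt0.
- move=> t H; rewrite /flat mulN1r subr_gt0.
  by case: (ltP 0 t) H => t0; case: (ltP t d) => td; rewrite ?mulr0 ?mul0r// => /(_ isT).
Qed.

Lemma smooth_step (d : R) : 0 < d -> exists J j : R -> R,
  [/\ smooth_fun J, smooth_fun j, forall t, has_derive J t (j t) &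
   [/\ forall t, t <= 0 -> J t = 0, forall t, d <= t -> J t = J d,
      {homo J : x y / x <= y}, forall t, 0 <= j t &
      [/\ forall t, 0 < t < d -> 0 < j t, forall t, ~ (0 < t < d) -> j t = 0 & 0 < J d]]].
Proof.
move=> d0; have [j [sj j0 jp jz]] := bump d0.
have cj : continuous j by move=> t; move/smooth_funP : sj => /(_ 0%N)/(_ t I).
have [F dF] := primitive cj.
pose J t := F t - F 0.
have dJ t : has_derive J t (j t).
  by rewrite -[j t]subr0; apply: has_deriveB => //; exact: has_derive_cst.
have mv x y : x <= y -> exists2 c, x <= c <= y & J y - J x = j c * (y - x).
  by move=> xy; apply: mean_value => //; apply: (@within_has_derive _ _ j) => // t _; exact: dJ.
exists J, j; split => //.
  apply/smooth_funP => -[|n].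
    by move=> t _; exact: has_derive_continuous (dJ t).
  apply: (@smooth_upto_intro _ _ _ _ j); [exact: openT|by move=> t _; exact: dJ|].
  by move/smooth_funP : sj.
have incr : {homo J : x y / x <= y}.
  move=> x y xy; have [c _ E] := mv _ _ xy.
  by rewrite -subr_ge0 E mulr_ge0// subr_ge0.
have Jle0 t : t <= 0 -> J t = 0.
  move=> t0; have [c /andP[_ c0]] := mv _ _ t0.
  by rewrite jz ?ltNge ?c0// mul0r /J; lra.
split => //.
- move=> t td; have [c /andP[dc _]] := mv _ _ td.
  rewrite jz; last by rewrite (ltNge c) dc andbF.
  by rewrite mul0r; lra.
- split => //.
  (* The height is positive because [J] already gains a positive amount on the middle third, where
     the density [j] does not vanish. *)
  have d13 : d / 3 <= d * 2 / 3 by lra.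
  have [c /andP[c1 c2] E] := mv _ _ d13.
  have jc : 0 < j c by apply: jp; apply/andP; split; lra.
  have : J (d * 2 / 3) <= J d by apply: incr; lra.
  have : J 0 <= J (d / 3) by apply: incr; lra.
  rewrite Jle0//.
  have : 0 < j c * (d * 2 / 3 - d / 3) by apply: mulr_gt0 => //; lra.
  by rewrite -E; lra.
Qed.

End Bump.

(** * Weak derivatives *)

Section WeakDerivative.
Context {R : realType}.
Implicit Types (f g u v q : R -> R) (O K : set R) (a b t x y : R).
Local Notation mu := (@lebesgue_measure R).

Lemma smooth_fun_continuous f : smooth_fun f -> continuous f.
Proof. by move=> /smooth_funP /(_ 0%N) H t; exact: H. Qed.

Lemma smooth_fun_derive f t : smooth_fun f -> has_derive f t (derive1 f t).
Proof. by move=> /smooth_funP /(_ 1%N)[H _]; exact/derivable_has_derive/H. Qed.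

Lemma smooth_fun_derive1 f : smooth_fun f -> smooth_fun (derive1 f).
Proof. by move=> /smooth_funP H; apply/smooth_funP => n; exact: (H n.+1).2. Qed.

Lemma compact_closedR K : compact K -> closed K.
Proof. by apply: compact_closed; exact: Rhausdorff. Qed.

Lemma compact_openC K : compact K -> open (~` K).
Proof. by move=> cK; rewrite openC; exact: compact_closedR. Qed.

Lemma derive1_outside_compact f K t : compact K -> (forall s, ~ K s -> f s = 0) ->
  ~ K t -> derive1 f t = 0.
Proof.
move=> cK f0 Kt; apply: has_derive_derive1.
apply: (@near_has_derive _ (fun=> 0)); last exact: has_derive_cst.
have oK : open (~` K) by exact: compact_openC.
by apply: near_open oK Kt _ => s /f0.
Qed.

Lemma compact_bound g K : compact K -> {within K, continuous g} ->
  exists2 C : R, 0 < C & forall t, K t -> `|g t| <= C.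
Proof.
move=> cK cg; have : compact (g @` K) by exact: continuous_compact.
move=> /compact_bounded[M [_ HM]].
exists (`|M| + 1); first by rewrite ltr_wpDl.
by move=> t Kt; apply: HM; [rewrite (le_lt_trans (ler_norm M))// ltrDl|exists t].
Qed.

Lemma integrable_mul_test O K u (g : R -> R) : locally_integrable O u ->
  continuous g -> compact K -> K `<=` O -> (forall t, ~ K t -> g t = 0) ->
  mu.-integrable O (EFin \o (fun t => u t * g t)).
Proof.
move=> [mu_ oO iu] cg cK KO g0.
have mO : measurable O by exact: open_measurable.
have mK : measurable K by exact: compact_measurable.
have mug : measurable_fun O (fun t => u t * g t).
  apply: measurable_funM => //.
  apply: measurable_funTS; exact: continuous_measurable_fun.
apply/integrableP; split; first exact/measurable_EFinP.
have [C C0 gC] : exists2 C : R, 0 < C & forall t, K t -> `|g t| <= C.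
  by apply: compact_bound => //; exact: continuous_subspaceT.
apply: (@le_lt_trans _ _ (\int[mu]_(t in O) ((C%:E * `|u t|%:E) * (\1_K t)%:E))%E).
  apply: ge0_le_integral => //=.
  - by apply/measurable_EFinP; apply: measurableT_comp.
  - apply: emeasurable_funM; last exact/measurable_EFinP.
    by apply: emeasurable_funM => //; apply/measurable_EFinP; apply: measurableT_comp.
  - move=> t Ot; rewrite -!EFinM lee_fin normrM indicE.
    have [Kt|Kt] := pselect (K t).
      by rewrite mem_set// mulr1 mulrC ler_wpM2r// gC.
    by rewrite g0// normr0 mulr0 !mulr_ge0// ltW.
have -> : (\int[mu]_(t in O) ((C%:E * `|u t|%:E) * (\1_K t)%:E) =
    \int[mu]_(t in K) (C%:E * `|u t|%:E))%E.
  have -> : K = O `&` K by apply/esym/setIidPr.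
  rewrite integral_mkcondr epatch_indic; apply: eq_integral => t tO.
  by rewrite !indicE in_setI tO.
rewrite ge0_integralZl//; last 2 first.
- by apply/measurable_EFinP; apply: measurableT_comp => //; exact: (measurable_funS mO KO).
- by rewrite lee_fin ltW.
by rewrite lte_mul_pinfty// ?lee_fin ?ltW// iu.
Qed.

Lemma Rintegral_support (D E : set R) f : (forall t, D t -> ~ E t -> f t = 0) ->
  (forall t, E t -> ~ D t -> f t = 0) ->
  \int[mu]_(t in D) f t = \int[mu]_(t in E) f t.
Proof.
move=> H1 H2; rewrite Rintegral_mkcond [RHS]Rintegral_mkcond.
congr (Rintegral _ _ _); apply/funext => t; rewrite !patchE.
have [Dt|Dt] := pselect (D t); have [Et|Et] := pselect (E t);
  rewrite ?(mem_set Dt) ?(mem_set Et) ?(memNset Dt) ?(memNset Et)//.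
- exact: H1.
- by rewrite H2.
Qed.

Lemma FTC_compact_support O a b (G G' : R -> R) : a < b ->
  (forall t, has_derive G t (G' t)) -> continuous G' ->
  (forall t, ~ (a <= t <= b) -> G' t = 0) ->
  (forall t, ~ O t -> G' t = 0) ->
  \int[mu]_(t in O) G' t = G b - G a.
Proof.
move=> ab dG cG' G'0 G'O.
have -> : \int[mu]_(t in O) G' t = \int[mu]_(t in `[a, b]) G' t.
  by apply: Rintegral_support => t; [move=> _ /=; rewrite in_itv; exact: G'0|move=> _; exact: G'O].
rewrite /Rintegral (@continuous_FTC2 _ G' G)//.
- exact: continuous_subspaceT.
- split.
  + by move=> x _; exact: has_derive_derivable (dG x).
  + by apply: cvg_at_right_filter; exact: has_derive_continuous (dG a).
  + by apply: cvg_at_left_filter; exact: has_derive_continuous (dG b).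
- by move=> x _; exact: has_derive_derive1 (dG x).
Qed.

Lemma open_locally_integrable O g : open O -> (forall t, O t -> {for t, continuous g}) ->
  locally_integrable O g.
Proof.
move=> oO cg; split => //.
  apply: open_continuous_measurable_fun => //.
  by move=> t /set_mem; exact: cg.
move=> K KO cK.
have cgK : {within K, continuous g}.
  by apply/continuous_in_subspaceT => t /set_mem/KO; exact: cg.
by have /integrableP[_] := continuous_compact_integrable cK cgK.
Qed.

Lemma locally_integrable_mul O u g : locally_integrable O u ->
  (forall t, O t -> {for t, continuous g}) ->
  locally_integrable O (fun t => g t * u t).
Proof.
move=> [mu_ oO iu] cg; split => //.
  apply: measurable_funM => //; apply: open_continuous_measurable_fun => //.
  by move=> t /set_mem; exact: cg.
move=> K KO cK.
have [C C0 gC] : exists2 C : R, 0 < C & forall t, K t -> `|g t| <= C.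
  apply: compact_bound => //.
  by apply/continuous_in_subspaceT => t /set_mem/KO; exact: cg.
have mO : measurable O by exact: open_measurable.
have mK : measurable K by exact: compact_measurable.
have mgK : measurable_fun K g.
  apply: (measurable_funS (open_measurable oO)) => //.
  by apply: open_continuous_measurable_fun => // t /set_mem; exact: cg.
have muK : measurable_fun K u by apply: (measurable_funS mO KO).
apply: (@le_lt_trans _ _ (\int[mu]_(t in K) (C%:E * `|u t|%:E))%E).
  apply: ge0_le_integral => //=.
  - by apply/measurable_EFinP/measurableT_comp => //; exact: measurable_funM.
  - by apply: emeasurable_funM => //; apply/measurable_EFinP/measurableT_comp.
  - by move=> t Kt; rewrite -EFinM lee_fin normrM ler_wpM2r// gC.
rewrite ge0_integralZl//; last 2 first.
- by apply/measurable_EFinP/measurableT_comp.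
- by rewrite lee_fin ltW.
by rewrite lte_mul_pinfty// ?lee_fin ?ltW// iu.
Qed.

Lemma test_fun_data O eta : test_fun O eta -> exists K, [/\ compact K, K `<=` O,
  continuous eta, continuous (derive1 eta) &
  (forall t, ~ K t -> eta t = 0) /\ (forall t, ~ K t -> derive1 eta t = 0)].
Proof.
move=> [sE [K [cK KO E0]]]; exists K; split => //.
- exact: smooth_fun_continuous.
- exact/smooth_fun_continuous/smooth_fun_derive1.
- by split => // t; exact: derive1_outside_compact.
Qed.

Lemma weak_derivD O u v u' v' : weak_deriv O u u' -> weak_deriv O v v' ->
  weak_deriv O (fun t => u t + v t) (fun t => u' t + v' t).
Proof.
move=> [iu iu' wu] [iv iv' wv]; split; [exact: locally_integrableD..|].
move=> eta test; have [K [cK KO c1 c2 [e1 e2]]] := test_fun_data test.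
have mO : measurable O by case: iu => _ oO _; exact: open_measurable.
under eq_Rintegral do rewrite mulrDl.
under [in RHS]eq_Rintegral do rewrite mulrDl.
rewrite !RintegralD//; try exact: (integrable_mul_test _ _ cK).
by rewrite wu// wv// opprD.
Qed.

Lemma weak_derivZ O u u' (c : R) : weak_deriv O u u' ->
  weak_deriv O (fun t => c * u t) (fun t => c * u' t).
Proof.
move=> [iu iu' wu]; split; [by apply: locally_integrable_mul => // t _; exact: cst_continuous..|].
move=> eta test; have [K [cK KO c1 c2 [e1 e2]]] := test_fun_data test.
have mO : measurable O by case: iu => _ oO _; exact: open_measurable.
under eq_Rintegral do rewrite -mulrA.
under [in RHS]eq_Rintegral do rewrite -mulrA.
rewrite !RintegralZl//; try exact: (integrable_mul_test _ _ cK).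
by rewrite wu// mulrN.
Qed.

(** The weak derivative of [q] is tested against X eta. Although [X] is smooth on [O] only, the
    compact support of eta makes this product, extended by 0, a test function. *)
Lemma weak_deriv_mul_smooth O q v X : (forall n, smooth_upto n O X) ->
  weak_deriv O q v ->
  weak_deriv O (fun t => X t * q t) (fun t => X t * v t + derive1 X t * q t).
Proof.
move=> sX [iq iv wq].
have oO : open O by case: iq.
have mO : measurable O by exact: open_measurable.
have dX t : O t -> has_derive X t (derive1 X t) by move=> Ot; exact/derivable_has_derive/(sX 1%N).1.
have cX t : O t -> {for t, continuous X} by exact: (sX 0%N).
have cX' t : O t -> {for t, continuous (derive1 X)} by exact: (sX 1%N).2.
have i1 : locally_integrable O (fun t => X t * q t) by exact: locally_integrable_mul.
have i2 : locally_integrable O (fun t => X t * v t) by exact: locally_integrable_mul.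
have i3 : locally_integrable O (fun t => derive1 X t * q t) by exact: locally_integrable_mul.
split => //; first exact: locally_integrableD.
move=> eta test; have [K [cK KO c1 c2 [e1 e2]]] := test_fun_data test.
pose z t := X t * eta t.
have z0 t : ~ K t -> z t = 0 by move=> /e1 H; rewrite /z H mulr0.
have sz : smooth_fun z.
  apply: (@smooth_fun_glue _ O K) => //; first exact: compact_closedR.
  move=> n; apply: smooth_uptoM => //.
  by apply: (@smooth_uptoS _ _ setT) => //; case: test => /smooth_funP.
have tz : test_fun O z by split => //; exists K; split.
have dz t : O t -> derive1 z t = derive1 X t * eta t + X t * derive1 eta t.
  move=> Ot; apply: has_derive_derive1; apply: has_deriveM; first exact: dX.
  by apply: smooth_fun_derive; case: test.
have := wq _ tz.
have -> : \int[mu]_(t in O) (q t * derive1 z t) =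
    \int[mu]_(t in O) ((derive1 X t * q t) * eta t + (X t * q t) * derive1 eta t).
  by apply: eq_Rintegral => t /set_mem Ot; rewrite dz//; ring.
have -> : \int[mu]_(t in O) (v t * z t) = \int[mu]_(t in O) ((X t * v t) * eta t).
  by apply: eq_Rintegral => t /set_mem Ot; rewrite /z; ring.
rewrite RintegralD//; try exact: (integrable_mul_test _ _ cK).
move=> E.
under [in RHS]eq_Rintegral do rewrite mulrDl.
rewrite RintegralD//; try exact: (integrable_mul_test _ _ cK).
lra.
Qed.

(** The product u eta vanishes off a compact part of [O], so it is of class C^1 on the whole line
    and its derivative has integral 0; the shape of [O] does not matter. *)
Lemma weak_deriv_C1 O u u' : open O -> (forall t, O t -> has_derive u t (u' t)) ->
  (forall t, O t -> {for t, continuous u'}) -> weak_deriv O u u'.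
Proof.
move=> oO du cu'.
have cu t : O t -> {for t, continuous u} by move=> /du/has_derive_continuous.
have mO : measurable O by exact: open_measurable.
have i1 : locally_integrable O u by exact: open_locally_integrable.
have i2 : locally_integrable O u' by exact: open_locally_integrable.
split => // eta test; have [K [cK KO c1 c2 [e1 e2]]] := test_fun_data test.
have deta t : has_derive eta t (derive1 eta t) by apply: smooth_fun_derive; case: test.
have [N N0 KN] : exists2 N : R, 0 < N & forall t, K t -> `|t| <= N.
  by apply: (compact_bound (g := id)) => //; apply: continuous_subspaceT => ? ?.
pose G t := u t * eta t; pose G' t := u' t * eta t + u t * derive1 eta t.
have oK : open (~` K) by exact: compact_openC.
have G0 t : ~ K t -> G t = 0 by move=> Kt; rewrite /G e1// mulr0.
have G'0 t : ~ K t -> G' t = 0 by move=> Kt; rewrite /G' e1// e2// !mulr0 addr0.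
have dG t : has_derive G t (G' t).
  have [/KO Ot|Kt] := pselect (K t); first by apply: has_deriveM => //; exact: du.
  rewrite G'0//; apply: (@near_has_derive _ (fun=> 0)); last exact: has_derive_cst.
  by apply: near_open oK Kt _ => s /G0.
have cG' : continuous G'.
  move=> t; have [/KO Ot|Kt] := pselect (K t).
    by apply: (@continuousD _ _ _ (fun s => u' s * eta s) (fun s => u s * derive1 eta s));
      apply: continuousM; [exact: cu'|exact: c1|exact: cu|exact: c2].
  apply: (@open_continuousS _ _ _ (fun=> 0) G' t oK Kt); last exact: cst_continuous.
  by move=> s /G'0.
have := @FTC_compact_support O (- N - 1) (N + 1) G G' _ dG cG' _ _.
rewrite !G0 ?subrr; last 2 first.
- by move=> /KN; rewrite ler_norml => /andP[]; lra.
- by move=> /KN; rewrite ler_norml => /andP[]; lra.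
have NN : - N - 1 < N + 1 by lra.
move=> /(_ NN) H.
have : \int[mu]_(t in O) G' t = 0.
  apply: H => t Ht; apply: G'0; last by move=> /KO.
  by move=> /KN; rewrite ler_norml => /andP[? ?]; apply: Ht; apply/andP; split; lra.
rewrite RintegralD//; try exact: (integrable_mul_test _ _ cK).
lra.
Qed.

End WeakDerivative.

(** * Pointwise consequences of weak derivatives *)

Section WeakMonotone.
Context {R : realType}.
Implicit Types (f g u v q : R -> R) (O K : set R) (a b t x y L C : R).
Local Notation mu := (@lebesgue_measure R).

Lemma translate_has_derive (f f' : R -> R) (c t : R) :
  (forall s, has_derive f s (f' s)) -> has_derive (fun s => f (s - c)) t (f' (t - c)).
Proof.
move=> df; rewrite -[f' _]mulr1.
apply: (@has_derive_comp _ f (fun s => s - c)); first exact: df.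
by rewrite -[1]subr0; apply: has_deriveB; [exact: has_derive_id|exact: has_derive_cst].
Qed.

Lemma translate_smooth f (c : R) : smooth_fun f -> smooth_fun (fun s => f (s - c)).
Proof.
move=> /smooth_funP sf; apply/smooth_funP => n; have oT : open [set: R] by exact: openT.
apply: (@smooth_upto_comp _ _ _ setT f (fun s => s - c)) => //.
by apply: smooth_uptoD => //; [exact: smooth_upto_id|exact: smooth_upto_cst].
Qed.

Lemma smooth_funB f g : smooth_fun f -> smooth_fun g -> smooth_fun (fun s => f s + - 1 * g s).
Proof.
move=> /smooth_funP sf /smooth_funP sg; apply/smooth_funP => n.
have oT : open [set: R] by exact: openT.
by do ?[apply: smooth_uptoD|apply: smooth_uptoM|apply: smooth_upto_cst] => //.
Qed.

Lemma ae_mono d (T : measurableType d) (nu : {measure set T -> \bar R}) (P Q : T -> Prop) :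
  (forall p, P p -> Q p) -> {ae nu, forall p, P p} -> {ae nu, forall p, Q p}.
Proof. by move=> PQ H; exact: (@filterS _ _ (ae_filter_ringOfSetsType nu) _ _ PQ H). Qed.

Lemma ae_conj d (T : measurableType d) (nu : {measure set T -> \bar R}) (P Q : T -> Prop) :
  {ae nu, forall p, P p} -> {ae nu, forall p, Q p} -> {ae nu, forall p, P p /\ Q p}.
Proof. by move=> HP HQ; exact: (@filterI _ _ (ae_filter_ringOfSetsType nu) _ _ HP HQ). Qed.

Lemma ae_ge0_Rintegral O f : measurable O -> measurable_fun O f ->
  {ae mu, forall t, O t -> 0 <= f t} -> 0 <= \int[mu]_(t in O) f t.
Proof.
move=> mO mf H.
have -> : \int[mu]_(t in O) f t = \int[mu]_(t in O) `|f t|.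
  rewrite /Rintegral; congr fine; apply: ae_eq_integral => //.
  - exact/measurable_EFinP.
  - by apply/measurable_EFinP/measurableT_comp.
  - apply: ae_mono H => t Ht Ot; congr EFin.
    by rewrite ger0_norm// Ht.
by apply: Rintegral_ge0 => t _.
Qed.

(* If q y < q x, the test function rising from 0 to J d near x and falling back
   near y gives a negative integral against v. *)
Lemma weak_deriv_nondecreasing O q v x y : weak_deriv O q v ->
  (forall t, O t -> {for t, continuous q}) -> `[x, y] `<=` O -> x <= y ->
  {ae mu, forall t, x <= t <= y -> 0 <= v t} -> q x <= q y.
Proof.
move=> [iq iv wq] cq xyO; rewrite le_eqVlt => /predU1P[->//|xy] v0.
rewrite leNgt; apply/negP => qyx.
have oO : open O by case: iq.
have mO : measurable O by exact: open_measurable.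
have Ox : O x by apply: xyO; rewrite /= in_itv/= lexx ltW.
have Oy : O y by apply: xyO; rewrite /= in_itv/= lexx ltW.
(* Since q x = m + 2e and q y = m - 2e, continuity gives q >= m + e on the right of x and q <= m on
   the left of y. *)
pose m := (q x + q y) / 2.
pose e := (q x - q y) / 4; have e0 : 0 < e by rewrite /e; lra.
have mx : m + e < q x by rewrite /m /e; lra.
have my : q y < m by rewrite /m; lra.
have [d [d0 dxy dx dy]] : exists d, [/\ 0 < d, x + d < y - d,
   forall t, x <= t <= x + d -> m + e <= q t & forall t, y - d <= t <= y -> q t <= m].
  near (0 : R)^'+ => d; exists d; split.
  - by near: d; exact: nbhs_right_gt.
  - have : d < (y - x) / 2 by near: d; apply: nbhs_right_lt; lra.
    lra.
  - move=> t txd; rewrite ltW//; move: t txd; near: d.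
    have /cvgr_gt/(_ _ mx)[r /= r0 He] := cq _ Ox.
    exists r => //= d; rewrite /= sub0r normrN => de d0 t /andP[xt txd].
    apply: He; rewrite /= distrC ger0_norm ?subr_ge0//.
    by have := ler_norm d; lra.
  - move=> t txd; rewrite ltW//; move: t txd; near: d.
    have /cvgr_lt/(_ _ my)[r /= r0 He] := cq _ Oy.
    exists r => //= d; rewrite /= sub0r normrN => de d0 t /andP[xt txd].
    apply: He; rewrite /= ger0_norm ?subr_ge0//.
    by have := ler_norm d; lra.
have [J [j [sJ sj dJ [J0 Jd Jh j0 [jp jz Jd0]]]]] := smooth_step d0.
pose eta t := J (t - x) + - 1 * J (t - (y - d)).
pose eta' t := j (t - x) - j (t - (y - d)).
have deta t : has_derive eta t (eta' t).
  have -> : eta' t = j (t - x) + - 1 * j (t - (y - d)) by rewrite /eta'; lra.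
  by apply: has_deriveD; [|apply: has_deriveMl]; apply: (translate_has_derive _ _ dJ).
have eta1 : derive1 eta = eta' by apply/funext => t; exact: has_derive_derive1 (deta t).
have cj : continuous j by exact: smooth_fun_continuous.
have eta_out t : ~ (x <= t <= y) -> eta t = 0.
  move=> /negP; rewrite negb_and -!ltNge => /orP[] H; rewrite /eta.
    by rewrite !J0; lra.
  by rewrite (Jd (t - x)) ?(Jd (t - (y - d))); lra.
have cxy : compact `[x, y] by exact: segment_compact.
have test : test_fun O eta.
  split; first by apply: smooth_funB; apply: translate_smooth.
  exists `[x, y]%classic; split => // t; rewrite /= in_itv/=; exact: eta_out.
have eta_ge0 t : 0 <= eta t.
  by rewrite /eta mulN1r subr_ge0; apply: Jh; lra.
have ceta : continuous eta by move=> t; exact: has_derive_continuous (deta t).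
have ceta' : continuous eta'.
  by rewrite -eta1; apply/smooth_fun_continuous/smooth_fun_derive1; case: test.
have eta'_out t : ~ (x <= t <= y) -> eta' t = 0.
  move=> H; rewrite -eta1; apply: (derive1_outside_compact cxy) => [s|]; rewrite /= in_itv//=.
  exact: eta_out.
have oxy t : ~ O t -> ~ (x <= t <= y) by move=> nO H; apply/nO/xyO; rewrite /= in_itv.
have eta'O : \int[mu]_(t in O) eta' t = 0.
  rewrite (@FTC_compact_support _ O x y eta eta')//; last by move=> t /oxy/eta'_out.
  by rewrite /eta !subrr (J0 0)// (J0 (x - _)) ?(Jd (y - x)); lra || (rewrite (_ : y - (y - d) = d); lra).
have jO : \int[mu]_(t in O) j (t - x) = J d.
  have jxz t : ~ (x <= t <= x + d) -> j (t - x) = 0.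
    by move=> H; apply: jz => /andP[h1 h2]; apply: H; apply/andP; split; lra.
  rewrite (@FTC_compact_support _ O x (x + d) (fun t => J (t - x)) (fun t => j (t - x)))//.
  - by rewrite subrr (J0 0)// subr0; congr J; lra.
  - by rewrite ltrDl.
  - by move=> t; exact: translate_has_derive.
  - move=> t; apply: (@continuous_comp _ _ _ (fun t => t - x) j); last exact: cj.
    by apply: continuousB; [exact: cvg_id|exact: cst_continuous].
  - by move=> t /oxy H; apply: jxz => /andP[h1 h2]; apply: H; apply/andP; split; lra.
have [K [cK KO c1 c2 [e1 e2]]] := test_fun_data test.
have mv : measurable_fun O v by case: iv.
have vint : 0 <= \int[mu]_(t in O) (v t * eta t).
  apply: ae_ge0_Rintegral => //.
    by apply: measurable_funM => //; apply: measurable_funTS; exact: continuous_measurable_fun.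
  apply: ae_mono v0 => t Ht _.
  have [xty|] := pselect (x <= t <= y); first by rewrite mulr_ge0// Ht.
  by move=> /eta_out ->; rewrite mulr0.
have := wq _ test; rewrite eta1 => E.
have iqe : mu.-integrable O (EFin \o (fun t => q t * eta' t)).
  by rewrite -eta1; exact: (integrable_mul_test _ _ cK).
have ime : mu.-integrable O (EFin \o (fun t => m * eta' t)).
  rewrite -eta1; apply: (integrable_mul_test _ _ cK) => //.
  by apply: open_locally_integrable => // t _; exact: cst_continuous.
have Ik (k : R) g : continuous g -> (forall t, ~ (x <= t <= y) -> g t = 0) ->
    mu.-integrable O (EFin \o (fun t => k * g t)).
  move=> cg g0; apply: (integrable_mul_test _ cg cxy) => //.
  by apply: open_locally_integrable => // t _; exact: cst_continuous.
have I1 g : continuous g -> (forall t, ~ (x <= t <= y) -> g t = 0) ->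
    mu.-integrable O (EFin \o g).
  move=> cg g0; have := Ik 1 g cg g0.
  by rewrite (_ : (fun t => 1 * g t) = g)//; apply/funext => t; rewrite mul1r.
have ie' : mu.-integrable O (EFin \o eta') by exact: I1.
have idiff : mu.-integrable O (EFin \o (fun t => q t * eta' t - m * eta' t)).
  by have := @integrableB _ _ _ mu O _ _ _ iqe ime; apply; exact: open_measurable.
have E2 : \int[mu]_(t in O) (q t * eta' t - m * eta' t) = - \int[mu]_(t in O) (v t * eta t).
  rewrite RintegralB// E RintegralZl// ?eta'O ?mulr0 ?subr0//.
have cjx : continuous (fun t => j (t - x)).
  move=> t; apply: (@continuous_comp _ _ _ (fun t => t - x) j); last exact: cj.
  by apply: continuousB; [exact: cvg_id|exact: cst_continuous].
have jx0 t : ~ (x <= t <= y) -> j (t - x) = 0.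
  by move=> H; apply: jz => /andP[h1 h2]; apply: H; apply/andP; split; lra.
have ije : mu.-integrable O (EFin \o (fun t => e * j (t - x))) by exact: Ik.
have ij : mu.-integrable O (EFin \o (fun t => j (t - x))) by exact: I1.
(* Subtracting [m] is free because [eta'] has integral 0. On the rise q - m >= e and [eta'] is the
   bump; on the fall q - m <= 0 and [eta'] is minus the bump, so the product is nonnegative. *)
have : \int[mu]_(t in O) (e * j (t - x)) <= \int[mu]_(t in O) (q t * eta' t - m * eta' t).
  apply: le_Rintegral => //.
  move=> t Ot; rewrite -mulrBl /eta'.
  have [t1|/jz ->] := pselect (0 < t - x < d).
    have := j0 (t - x); rewrite (jz (t - (y - d))); last by move=> /andP[]; move/andP: t1; lra.
    have : m + e <= q t by apply: dx; move/andP: t1; lra.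
    by rewrite subr0 => h1 h2; apply: ler_wpM2r => //; lra.
  rewrite mulr0 sub0r.
  have [t1|/jz ->] := pselect (0 < t - (y - d) < d); last by rewrite oppr0 mulr0.
  have : q t <= m by apply: dy; move/andP: t1; lra.
  by move=> h1; rewrite mulrN -mulNr mulr_ge0//; lra.
rewrite E2 RintegralZl// jO.
have : 0 < e * J d by exact: mulr_gt0.
lra.
Unshelve. all: by end_near. Qed.

(** The functions q + (C - L) t and -q + (C + L) t have nonnegative weak derivatives, hence are
    nondecreasing. *)
Lemma weak_deriv_lipschitz O q v x y L C : weak_deriv O q v ->
  (forall t, O t -> {for t, continuous q}) -> `[x, y] `<=` O -> x <= y ->
  {ae mu, forall t, x <= t <= y -> `|v t - L| <= C} ->
  `|q y - q x - L * (y - x)| <= C * (y - x).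
Proof.
move=> wq cq xyO xy vC.
have oO : open O by case: wq => -[].
have aff (k : R) : weak_deriv O (fun t => k * t) (fun=> k).
  apply: weak_deriv_C1 => // t _; last exact: cst_continuous.
  by rewrite -[X in has_derive _ _ X]mulr1; apply: has_deriveMl; exact: has_derive_id.
have caff (k t : R) : {for t, continuous (fun t => k * t)}.
  by apply: continuousM; [exact: cst_continuous|exact: cvg_id].
have H1 : q x + (C - L) * x <= q y + (C - L) * y.
  apply: (weak_deriv_nondecreasing (weak_derivD wq (aff (C - L)))) xyO xy _.
    by move=> t Ot; apply: (@continuousD _ _ _ q); [exact: cq|exact: caff].
  apply: ae_mono vC => t Ht /Ht; rewrite ler_norml => /andP[]; lra.
have H2 : - 1 * q x + (C + L) * x <= - 1 * q y + (C + L) * y.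
  apply: (weak_deriv_nondecreasing (weak_derivD (weak_derivZ (-1) wq) (aff (C + L)))) xyO xy _.
    move=> t Ot; apply: (@continuousD _ _ _ (fun t => -1 * q t)); last exact: caff.
    by apply: continuousM; [exact: cst_continuous|exact: cq].
  apply: ae_mono vC => t Ht /Ht; rewrite ler_norml => /andP[]; lra.
by rewrite ler_norml; apply/andP; split; lra.
Qed.

(** A weak derivative is determined up to null sets only, so its limit at a point must ignore
    them. *)
Definition ess_limit v t L : Prop := forall e : R, 0 < e ->
  exists2 d : R, 0 < d & {ae mu, forall s, `|s - t| < d -> `|v s - L| <= e}.

Lemma open_contains_interval O t : open O -> O t ->
  exists2 d : R, 0 < d & forall s, `|s - t| < d -> O s.
Proof.
move=> oO Ot; have /nbhs_ballP[d /= d0 H] : nbhs t O by exact: open_nbhs_nbhs.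
by exists d => // s st; apply: H; rewrite /ball/= distrC.
Qed.

(** Near t the weak derivative is e-close to [L], and the Lipschitz estimate with constant e is
    exactly the definition of the derivative. This is the way back from weak to classical
    derivatives. *)
Lemma weak_deriv_has_derive O q v t L : weak_deriv O q v ->
  (forall t, O t -> {for t, continuous q}) -> O t -> ess_limit v t L ->
  has_derive q t L.
Proof.
move=> wq cq Ot vL; apply/has_deriveP => e e0.
have oO : open O by case: wq => -[].
have [d d0 H] := vL _ e0.
have [d' d'0 H'] := open_contains_interval oO Ot.
near=> s.
have sd : `|s - t| < d by near: s; rewrite near_simpl; exists d => //= s; rewrite /= distrC.
have sd' : `|s - t| < d' by near: s; rewrite near_simpl; exists d' => //= s; rewrite /= distrC.
move: sd sd'; rewrite !ltr_norml => /andP[sd1 sd2] /andP[sd1' sd2'].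
have [ts|/ltW st] := leP t s.
  rewrite [X in _ <= _ * X]ger0_norm ?subr_ge0//.
  apply: (weak_deriv_lipschitz wq cq) => //.
    move=> u; rewrite /= in_itv/= => /andP[? ?]; apply: H'.
    by rewrite ltr_norml; apply/andP; split; lra.
  apply: ae_mono H => u Hu /andP[? ?]; apply: Hu.
  by rewrite ltr_norml; apply/andP; split; lra.
have -> : q s - q t - L * (s - t) = - (q t - q s - L * (t - s)) by lra.
rewrite normrN (distrC s) [X in _ <= _ * X]ger0_norm ?subr_ge0//.
apply: (weak_deriv_lipschitz wq cq) => //.
  move=> u; rewrite /= in_itv/= => /andP[? ?]; apply: H'.
  by rewrite ltr_norml; apply/andP; split; lra.
apply: ae_mono H => u Hu /andP[? ?]; apply: Hu.
by rewrite ltr_norml; apply/andP; split; lra.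
Unshelve. all: by end_near. Qed.

Lemma continuous_ess_limit v t : {for t, continuous v} -> ess_limit v t (v t).
Proof.
move=> cv e e0; have /cvgr_dist_le/(_ _ e0)[d /= d0 H] := cv.
exists d => //; apply: aeW => s st.
by have := H s; rewrite /= distrC => /(_ st); rewrite distrC.
Qed.

(* Lebesgue differentiation of w over [a, z], tested against steps converging
   to the indicator of ]a, z[. *)
Lemma weak_deriv0_ae0 O w a b : weak_deriv O (fun=> 0) w -> `[a, b] `<=` O ->
  {ae mu, forall t, a < t < b -> w t = 0}.
Proof.
move=> [_ iw H] abO.
have oO : open O by case: iw.
have mO : measurable O by exact: open_measurable.
have mw : measurable_fun O w by case: iw.
have H0 eta : test_fun O eta -> \int[mu]_(t in O) (w t * eta t) = 0.
  move=> /H; under eq_Rintegral do rewrite mul0r.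
  by rewrite {1}/Rintegral integral0 => /eqP; rewrite eq_sym oppr_eq0 => /eqP.
have [ba|ab] := leP b a.
  by apply: aeW => t /andP[h1 h2]; exfalso; have := lt_trans h1 h2; rewrite ltNge ba.
have Iab : mu.-integrable `[a, b] (EFin \o w).
  apply/integrableP; split; last by case: iw => _ _; apply => //; exact: segment_compact.
  by apply/measurable_EFinP; apply: measurable_funS mw.
have key z : a < z <= b -> \int[mu]_(t in `[a, z]) w t = 0.
  move=> /andP[az zb].
  have azO : `[a, z] `<=` O.
    by apply: (subset_trans _ abO); apply: subset_itvl; rewrite bnd_simp.
  have mazO : measurable_fun `[a, z] w by apply: (measurable_funS mO azO).
  have Iaz : mu.-integrable `[a, z] (EFin \o w).
    apply/integrableP; split; last by case: iw => _ _; apply => //; exact: segment_compact.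
    exact/measurable_EFinP.
  pose dn (n : nat) := (z - a) / 2 / n.+1%:R.
  have dn0 n : 0 < dn n by rewrite /dn !divr_gt0// subr_gt0.
  have /choice[Jj HJ] n : exists Jj : (R -> R) * (R -> R), 
      [/\ smooth_fun Jj.1, forall t, 0 <= Jj.1 t <= 1, forall t, t <= 0 -> Jj.1 t = 0 &
      forall t, dn n <= t -> Jj.1 t = 1].
    have [J [j [sJ sj dJ [J0 Jd Jh j0 [jp jz Jd0]]]]] := smooth_step (dn0 n).
    exists ((fun t => (J (dn n))^-1 * J t), j); split => /=.
    - apply/smooth_funP => k; have oT : open [set: R] by exact: openT.
      apply: smooth_uptoM => //; first exact: smooth_upto_cst.
      by move/smooth_funP : sJ.
    - move=> t; rewrite mulr_ge0 ?invr_ge0 ?(ltW Jd0)//=; last first.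
        by have [t0|t0] := leP 0 t; [rewrite -(J0 0)// Jh|rewrite J0// ltW].
      rewrite ler_pdivrMl// mulr1.
      by have [t0|t0] := leP t (dn n); [exact: Jh|rewrite Jd// ltW].
    - by move=> t /J0 ->; rewrite mulr0.
    - by move=> t /Jd ->; rewrite mulVf// gt_eqF.
  pose J n := (Jj n).1.
  (* It rises from 0 to 1 on [a, a + dn n] and falls back on [z - dn n, z]; the factor 1/2 in [dn]
     keeps the two ramps from overlapping. *)
  pose eta n t := J n (t - a) + - 1 * J n (t - (z - dn n)).
  have eta_out n t : ~ (a <= t <= z) -> eta n t = 0.
    move=> /negP; rewrite negb_and -!ltNge => Ht; rewrite /eta /J.
    have [_ _ J0 J1] := HJ n; have := dn0 n => dn0n.
    have dnz : dn n <= (z - a) / 2.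
      by rewrite /dn ler_pdivrMr// ler_peMr ?ler1n//; lra.
    case/orP : Ht => Ht; first by rewrite !J0; lra.
    by rewrite !J1; lra.
  have cJ n : continuous (J n) by apply: smooth_fun_continuous; case: (HJ n).
  have test n : test_fun O (eta n).
    split; first by apply: smooth_funB; apply: translate_smooth; case: (HJ n).
    exists `[a, z]%classic; split => //; first exact: segment_compact.
    by move=> t; rewrite /= in_itv/=; exact: eta_out.
  have ceta n : continuous (eta n).
    by apply: smooth_fun_continuous; case: (test n).
  have eta1 n t : `|eta n t| <= 1.
    have [_ J01 _ _] := HJ n; rewrite /eta /J.
    have := J01 (t - a); have := J01 (t - (z - dn n)).
    by move=> /andP[? ?] /andP[? ?]; rewrite ler_norml; apply/andP; split; lra.
  have lim_eta t : a < t < z -> (fun n => eta n t) @ \oo --> (1 : R).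
    move=> /andP[at_ tz]; apply/cvgrPdist_le => e e0.
    have dn_cvg : dn n @[n --> \oo] --> (0 : R).
      rewrite -[X in _ --> X](mulr0 ((z - a) / 2)).
      by apply: cvgM; [exact: cvg_cst|exact: cvg_harmonic].
    near=> n.
    have dnt : dn n < Num.min (t - a) (z - t).
      by near: n; apply: (cvgr_lt 0) => //; rewrite lt_min !subr_gt0 at_.
    rewrite /eta /J; have [_ _ J0 J1] := HJ n.
    move: dnt; rewrite lt_min => /andP[? ?].
    rewrite J1 ?J0; [|lra..].
    by rewrite mulr0 addr0 subrr normr0 ltW.
  have mab : measurable (`[a, z] : set R) by [].
  have [|||||_ _] := @dominated_convergence _ _ _ mu `[a, z] mab
    (fun n t => (w t * eta n t)%:E) (fun t => (w t)%:E) (fun t => `|w t|%:E).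
  - move=> n; apply/measurable_EFinP; apply: measurable_funM => //.
    by apply: measurable_funTS; exact: continuous_measurable_fun.
  - exact/measurable_EFinP.
  - have Nz : mu.-negligible ([set a; z] : set R).
      exists [set a; z]; split => //; last first.
        rewrite measureU0//; first exact: lebesgue_measure_set1.
        exact: lebesgue_measure_set1.
      exact: measurableU.
    apply: negligibleS Nz => t /= /not_implyP[]; rewrite in_itv/= => /andP[h1 h2] h3.
    apply: contrapT => h4; apply: h3; apply: cvg_EFin; first by near=> n.
    have -> : fine \o (fun n => (w t * eta n t)%:E) = (fun n => w t * eta n t) by [].
    rewrite -[X in _ --> X]mulr1; apply: cvgM; first exact: cvg_cst.
    apply: lim_eta; rewrite !lt_neqAle h1 h2 !andbT.
    by apply/andP; split; apply/eqP => E; apply: h4; [left|right]; rewrite /= E.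
  - by have := integrable_abse Iaz; apply: eq_integrable.
  - apply: aeW => t n _ /=; rewrite normrM lee_fin ler_piMr//.
  have E n : (\int[mu]_(t in `[a, z]) (w t * eta n t)%:E = 0)%E.
    have I : mu.-integrable `[a, z] (EFin \o (fun t => w t * eta n t)).
      have cz : compact `[a, z] by exact: segment_compact.
      have := integrable_mul_test iw (ceta n) cz azO.
      move=> Hi; apply: (@integrableS _ _ _ mu O `[a, z]%classic) => //; apply: Hi => t.
      by rewrite /= in_itv/=; exact: eta_out.
    have := H0 _ (test n); rewrite (@Rintegral_support _ _ `[a, z]%classic).
    - by rewrite /Rintegral => E; rewrite -[LHS]fineK ?E//; exact: integrable_fin_num I.
    - by move=> t _ /=; rewrite in_itv/= => /eta_out ->; rewrite mulr0.
    - by move=> t /azO.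
  move=> Hlim; rewrite /Rintegral.
  have -> : (\int[mu]_(t in `[a, z]) (w t)%:E = 0)%E; last by [].
  apply: (cvg_unique _ Hlim) => //.
  rewrite (_ : [sequence _]_n = fun=> 0%E); last by apply/funext => n; exact: E.
  exact: cvg_cst.
(* Extension by 0 puts [w] in the scope of the differentiation theorem on the line; the primitive of
   [f] from [a] vanishes on ]a, b]. *)
pose f := w \_ `[a, b].
have fi : mu.-integrable setT (EFin \o f).
  by rewrite /f -restrict_EFin; apply/integrable_restrict => //; rewrite setTI.
have Fz z : a < z <= b -> \int[mu]_(t in `[a, z]) f t = 0.
  move=> azb; rewrite -[RHS](key z azb); apply: eq_Rintegral => t.
  rewrite inE/= in_itv/= => /andP[at_ tz]; rewrite /f patchE mem_set//= in_itv/= at_.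
  by case/andP: azb => _; exact: le_trans.
have floc : locally_integrable setT f by apply: open_integrable_locally => //; exact: openT.
have fiz y : mu.-integrable `[a, y] (EFin \o f) by apply: (integrableS measurableT _ _ fi).
have := @FTC1 R f (BLeft a) fiz floc.
apply: ae_mono => t Ht /andP[at_ tb].
have [|dF E] := Ht; first by rewrite /= lte_fin.
have ft : f t = w t by rewrite /f patchE mem_set//= in_itv/= !ltW.
rewrite -ft -E; apply: has_derive_derive1.
apply: (@near_has_derive _ (fun=> 0)); last exact: has_derive_cst.
have /near_between : a < t < b by rewrite at_.
by apply: filterS => z /andP[az zb]; rewrite Fz// az ltW.
Unshelve. all: by end_near. Qed.

End WeakMonotone.

(** * Orbits of a local flow *)

Section Connectedness.
Context {R : realType}.

Lemma connected_locally_constant (M : topologicalType) (P : M -> Prop) :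
  connected [set: M] ->
  (forall p : M, exists2 N : set M, nbhs p N & forall x y, N x -> N y -> P x -> P y) ->
  forall x y, P x -> P y.
Proof.
move=> cM H x y Px.
have oP : open [set z | P z].
  rewrite openE => z Pz; have [N Nz HN] := H z.
  by apply: filterS (Nz) => w Nw; exact: (HN z w (nbhs_singleton Nz) Nw Pz).
have oNP : open (~` [set z | P z]).
  rewrite openE => z nPz; have [N Nz HN] := H z.
  by apply: filterS (Nz) => w Nw Pw; apply: nPz; exact: (HN w z Nw (nbhs_singleton Nz) Pw).
suff : [set z | P z] = [set: M] by move/seteqP => [_ /(_ y I)].
apply: cM; first by exists x.
  by exists [set z | P z] => //; rewrite setTI.
by exists [set z | P z]; [rewrite -openC|rewrite setTI].
Qed.

(** The indicator function of [P] has derivative 0 on the interval. *)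
Lemma interval_locally_constant (P : R -> Prop) (a b : R) :
  (forall t, a < t < b -> \forall s \near t, P s <-> P t) ->
  forall x y, a < x < b -> a < y < b -> P x -> P y.
Proof.
move=> H x y xab yab Px.
pose f t : R := if pselect (P t) then 1 else 0.
have df t : a < t < b -> has_derive f t 0.
  move=> tab; apply: (@near_has_derive _ (fun=> f t)); last exact: has_derive_cst.
  apply: filterS (H t tab) => s; rewrite /f.
  by case: pselect => Ps; case: pselect => Pt // [h1 h2]; exfalso; auto.
have := has_derive0_cst df xab yab; rewrite /f.
case: (pselect (P x)) => [px|//]; case: (pselect (P y)) => [//|py] /= /eqP.
by rewrite oner_eq0.
Qed.

End Connectedness.

(** * Chains of arcs and elapsed time *)

Section Reach.
Context {R : realType} {M : Type} (r : M -> R) (e : M -> R -> M).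
Hypothesis e_eq : forall p q a b h, `|a| < r p -> `|b| < r q ->
  `|a + h| < r p -> `|b + h| < r q -> e p a = e q b -> e p (a + h) = e q (b + h).

(* In time t, the flow leads from p to z through n arcs. *)
Fixpoint reach_in (n : nat) (t : R) (p z : M) : Prop :=
  match n with
  | 0 => t = 0 /\ p = z
  | n.+1 => exists q a h, [/\ `|a| < r q, `|a + h| < r q, 0 <= h, p = e q a &
                              reach_in n (t - h) (e q (a + h)) z]
  end.

Definition reach t p z := exists n, reach_in n t p z.

Lemma reach_ge0 t p z : reach t p z -> 0 <= t.
Proof.
move=> [n]; elim: n t p => [t p [->]//|n IH] t p /= [q [a [h [_ _ h0 _ /IH]]]]; lra.
Qed.

Lemma reach_refl p : reach 0 p p.
Proof. by exists 0. Qed.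

Lemma reach_trans s t p q z : reach s p q -> reach t q z -> reach (s + t) p z.
Proof.
move=> [n Hn] [m Hm]; exists (n + m)%N; elim: n s p Hn => [|n IH] s p /=.
  by move=> [-> ->]; rewrite add0r add0n.
move=> [q' [a [h [ha hah h0 -> /IH H]]]]; exists q', a, h; split => //.
by rewrite addrAC.
Qed.

Lemma reach_arc q a b : `|a| < r q -> `|b| < r q -> a <= b ->
  reach (b - a) (e q a) (e q b).
Proof.
move=> ha hb ab; exists 1 => /=; exists q, a, (b - a).
by rewrite addrC subrK subrr; split => //; rewrite subr_ge0.
Qed.

Lemma norm_between (a b c d : R) : `|a| < d -> `|b| < d -> a <= c <= b -> `|c| < d.
Proof. rewrite !ltr_norml => /andP[? ?] /andP[? ?] /andP[? ?]; lra. Qed.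

Lemma reach_split s t p z : reach t p z -> 0 <= s <= t ->
  exists2 q, reach s p q & reach (t - s) q z.
Proof.
move=> [n]; elim: n s t p => [|n IH] s t p /=.
  move=> [-> ->] /andP[s0 s0']; have -> : s = 0 by apply/le_anti/andP.
  by exists z; rewrite ?subrr; exact: reach_refl.
move=> [q [a [h [ha hah h0 -> H]]]] /andP[s0 st].
have [hs|sh] := leP h s.
  have [|q' H1 H2] := IH (s - h) _ _ H; first by apply/andP; split; lra.
  exists q'; last by have -> : t - s = t - h - (s - h) by lra.
  have : reach (a + h - a + (s - h)) (e q a) q'.
    by apply: reach_trans H1; apply: reach_arc => //; lra.
  by rewrite (_ : a + h - a + (s - h) = s); last lra.
have has : `|a + s| < r q by apply: (norm_between ha hah); apply/andP; split; lra.
exists (e q (a + s)).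
  have : reach (a + s - a) (e q a) (e q (a + s)) by apply: reach_arc => //; lra.
  by rewrite (_ : a + s - a = s); last lra.
have -> : t - s = (a + h - (a + s)) + (t - h) by lra.
apply: (@reach_trans _ _ _ (e q (a + h))); first by apply: reach_arc => //; lra.
by exists n.
Qed.

Lemma reach_in0 n p z : reach_in n 0 p z -> p = z.
Proof.
elim: n p => [|n IH] p /=; first by case.
move=> [q [a [h [ha hah h0 -> H]]]].
have hh : h = 0.
  have : 0 <= 0 - h by apply: (@reach_ge0 (0 - h) (e q (a + h)) z); exists n.
  lra.
by apply: IH; move: H; rewrite hh addr0 subr0.
Qed.

(** Induction on the total number of arcs. The shorter of the two first arcs is removed from both
    chains; what remains of the longer one is still a single arc, since arcs through a common point
    agree. *)
Lemma reach_in_functional n m t p z z' :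
  reach_in n t p z -> reach_in m t p z' -> z = z'.
Proof.
move: {2}(n + m)%N (leqnn (n + m)) => k.
elim: k n m t p z z' => [|k IH] n m t p z z'.
  by rewrite leqn0 addn_eq0 => /andP[/eqP-> /eqP->] /= [_ ->] [_ ->].
(* Both chains may be assumed nonempty, the first one starting with the shorter arc. An empty chain
   forces time 0, in which no chain moves. *)
wlog step : n m z z' / exists n' m' q a h q' a' h',
    [/\ n = n'.+1, m = m'.+1, h <= h' &
    [/\ `|a| < r q, `|a + h| < r q, 0 <= h, p = e q a & reach_in n' (t - h) (e q (a + h)) z] /\
    [/\ `|a'| < r q', `|a' + h'| < r q', 0 <= h', p = e q' a' & reach_in m' (t - h') (e q' (a' + h')) z']].
  move=> W nmk; case: n nmk => [|n] nmk.
    by move=> /= [-> ->] /reach_in0.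
  case: m nmk => [|m] nmk.
    by move=> /[swap] /= -[-> ->] H; apply/esym/(@reach_in0 n.+1).
  move=> /[dup] Hn /= [q [a [h Hh]]] /[dup] Hm /= [q' [a' [h' Hh']]].
  have [hh|/ltW hh] := leP h h'.
    by apply: (W n.+1 m.+1) => //; exists n, m, q, a, h, q', a', h'.
  apply/esym; apply: (W m.+1 n.+1) => //; last by rewrite addnC.
  by exists m, n, q', a', h', q, a, h.
move: step => [n' [m' [q [a [h [q' [a' [h' [-> -> hh [[ha hah h0 pE H] [ha' hah' h'0 pE' H']]]]]]]]]]].
rewrite addSn ltnS => nmk _ _.
have ha'h : `|a' + h| < r q' by apply: (norm_between ha' hah'); apply/andP; split; lra.
have E : e q (a + h) = e q' (a' + h) by apply: e_eq => //; rewrite -pE.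
apply: (IH n' m'.+1 (t - h) (e q (a + h))) => //=.
exists q', (a' + h), (h' - h); split => //; first by rewrite addrA addrAC addrK.
  by rewrite subr_ge0.
by rewrite (_ : t - h - (h' - h) = t - h') 1?(_ : a' + h + (h' - h) = a' + h')//; lra.
Qed.

Lemma reach_functional t p z z' : reach t p z -> reach t p z' -> z = z'.
Proof. by move=> [n Hn] [m]; exact: reach_in_functional Hn. Qed.

End Reach.

Section ReachBack.
Context {R : realType} {M : Type} (r : M -> R) (e : M -> R -> M).
Hypothesis e_eq : forall p q a b h, `|a| < r p -> `|b| < r q ->
  `|a + h| < r p -> `|b + h| < r q -> e p a = e q b -> e p (a + h) = e q (b + h).

Let e' p t := e p (- t).

Lemma reach_opp t p z : reach r e t p z -> reach r e' t z p.
Proof.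
move=> [n]; elim: n t p => [t p [-> ->]|n IH t p /= [q [a [h [ha hah h0 -> /IH H]]]]].
  exact: reach_refl.
have -> : t = (t - h) + (- a - - (a + h)) by lra.
apply: (reach_trans H).
have -> : e q (a + h) = e' q (- (a + h)) by rewrite /e' opprK.
have -> : e q a = e' q (- a) by rewrite /e' opprK.
by apply: reach_arc; rewrite ?normrN//; lra.
Qed.

(** This is functionality for the flow run backwards, whose arcs [e'] satisfy the same
    compatibility. *)
Lemma reach_injective t p p' z : reach r e t p z -> reach r e t p' z -> p = p'.
Proof.
move=> /reach_opp H /reach_opp; apply: reach_functional H => x y a b h ha hb hah hbh.
rewrite /e' !opprD; apply: e_eq; rewrite ?normrN// -opprD normrN//.
Qed.

End ReachBack.

(** * First return, periodic orbits, and the set of later points *)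

Section Flow.
Context {R : realType} {M : topologicalType}.
Variables (r : M -> R) (e : M -> R -> M).
Hypothesis hausM : hausdorff_space M.
Hypothesis r0 : forall p, 0 < r p.
Hypothesis e0 : forall p, e p 0 = p.
Hypothesis e_cont : forall p t, `|t| < r p -> {for t, continuous (e p)}.
Hypothesis e_inj : forall p s t, `|s| < r p -> `|t| < r p -> e p s = e p t -> s = t.
Hypothesis e_nbhs : forall p (d : R), 0 < d -> d <= r p ->
  nbhs p (e p @` [set t | `|t| < d]).
Hypothesis e_shift : forall p t, `|t| < r p -> \forall h \near (0 : R), e (e p t) h = e p (t + h).

Lemma near_shift0 (P : R -> Prop) (t : R) :
  (\forall h \near (0 : R), P (t + h)) -> \forall s \near t, P s.
Proof.
move=> /nbhs_ballP[d /= d0 Hd]; apply/nbhs_ballP; exists d => // s ts.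
have := Hd (s - t); rewrite (_ : t + (s - t) = s); last lra.
apply.
by move: ts; rewrite /ball/= sub0r normrN distrC.
Qed.

(** The times ]l, u[ for which both arcs are defined form an interval. The times at which they agree
    are open by [e_shift], and closed because [M] is Hausdorff and the arcs are continuous. *)
Lemma arcs_agree p q a b h : `|a| < r p -> `|b| < r q ->
  `|a + h| < r p -> `|b + h| < r q -> e p a = e q b -> e p (a + h) = e q (b + h).
Proof.
move=> ha hb hah hbh E.
pose l := Num.max (- r p - a) (- r q - b).
pose u := Num.min (r p - a) (r q - b).
have I k : l < k < u -> `|a + k| < r p /\ `|b + k| < r q.
  rewrite gt_max lt_min !ltr_norml => /andP[/andP[? ?] /andP[? ?]].
  by split; apply/andP; split; lra.
have I' k : `|a + k| < r p -> `|b + k| < r q -> l < k < u.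
  rewrite gt_max lt_min !ltr_norml => /andP[? ?] /andP[? ?].
  by do ?[apply/andP; split]; lra.
apply: (@interval_locally_constant _ (fun k => e p (a + k) = e q (b + k)) l u _ 0 h).
- move=> t /I[ht ht'].
  have [Et|Et] := pselect (e p (a + t) = e q (b + t)).
    apply: near_shift0; apply: filterS2 (e_shift ht) (e_shift ht') => k.
    by rewrite Et -!addrA => -> ->.
  have sepM := hausM; rewrite open_hausdorff in sepM.
  have [[A B]] := sepM _ _ (introN eqP Et).
  rewrite /= !inE => -[At Bt] [oA oB AB0].
  have AB x : ~ (A x /\ B x).
    by move=> ABx; have : (A `&` B) x := ABx; rewrite AB0.
  apply: near_shift0.
  have cA : \forall k \near (0 : R), A (e p (a + t + k)).
    have : \forall s \near (a + t), A (e p s) by apply: (e_cont ht); exact: open_nbhs_nbhs.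
    move=> /nbhs_ballP[d d0 Hd]; apply/nbhs_ballP; exists d => // k; rewrite /ball/= sub0r normrN => kd.
    by apply: Hd; rewrite /ball/= opprD addrA subrr sub0r normrN.
  have cB : \forall k \near (0 : R), B (e q (b + t + k)).
    have : \forall s \near (b + t), B (e q s) by apply: (e_cont ht'); exact: open_nbhs_nbhs.
    move=> /nbhs_ballP[d d0 Hd]; apply/nbhs_ballP; exists d => // k; rewrite /ball/= sub0r normrN => kd.
    by apply: Hd; rewrite /ball/= opprD addrA subrr sub0r normrN.
  apply: filterS2 cA cB => k; rewrite -!addrA => hA hB; split => // E'.
  by exfalso; apply: (AB (e p (a + (t + k)))); split; rewrite // E'.
- by apply: I'; rewrite addr0.
- exact: I'.
- by rewrite !addr0.
Qed.

Local Notation reach := (reach r e).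

Lemma reach_fwd t p z z' : reach t p z -> reach t p z' -> z = z'.
Proof. by apply: reach_functional; exact: arcs_agree. Qed.

Lemma reach_bwd t p p' z : reach t p z -> reach t p' z -> p = p'.
Proof. by apply: reach_injective; exact: arcs_agree. Qed.

Lemma norm0_lt p : `|0 : R| < r p.
Proof. by rewrite normr0. Qed.

Lemma reach_from p t : 0 <= t -> t < r p -> reach t p (e p t).
Proof.
move=> t0 tr; rewrite -[t in reach t]subr0 -[X in reach _ X _]e0.
by apply: reach_arc => //; [exact: norm0_lt|rewrite ger0_norm].
Qed.

Lemma reach_to p t : 0 <= t -> t < r p -> reach t (e p (- t)) p.
Proof.
move=> t0 tr; rewrite -[X in reach _ _ X]e0.
rewrite -[t in reach t](_ : 0 - - t = t); last by lra.
by apply: reach_arc => //; [rewrite normrN ger0_norm|exact: norm0_lt|lra].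
Qed.

Lemma reach_back s t p q z : reach t p z -> reach s q z -> s <= t -> reach (t - s) p q.
Proof.
move=> H H1 st; have s0 := reach_ge0 H1.
have [|w Hw Hw'] := reach_split H (s := t - s); first by apply/andP; split; lra.
suff -> : q = w by [].
by apply: reach_bwd H1 _; move: Hw'; rewrite opprB addrC subrK.
Qed.

Lemma reach_forth s t p q z : reach t p z -> reach s p q -> s <= t -> reach (t - s) q z.
Proof.
move=> H H1 st; have s0 := reach_ge0 H1.
have [|w Hw Hw'] := reach_split H (s := s); first by apply/andP; split; lra.
by rewrite (reach_fwd H1 Hw).
Qed.

Lemma first_return_ge p t : 0 < t -> reach t p p -> r p <= t.
Proof.
move=> t0 H; rewrite leNgt; apply/negP => tr.
have := reach_fwd H (reach_from (ltW t0) tr); rewrite -[LHS]e0 => E.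
by have := e_inj (norm0_lt p) _ E; rewrite gtr0_norm// => /(_ tr) tE; rewrite -tE ltxx in t0.
Qed.

(** The difference of two distinct return times is again a return time, hence at least [r p]. A
    return time within [r p] of the infimum is therefore the smallest one. *)
Lemma first_return p t : 0 < t -> reach t p p ->
  exists2 L : R, 0 < L /\ reach L p p & forall s, 0 < s -> reach s p p -> L <= s.
Proof.
move=> t0 H; pose S := [set s : R | 0 < s /\ reach s p p].
have S0 : S !=set0 by exists t.
have Slb s : S s -> r p <= s by move=> [s0]; exact: first_return_ge.
have hS : has_inf S by split => //; exists (r p).
have [L [L0 HL] Lr] := inf_adherent (r0 p) hS.
exists L => // s s0 Hs; rewrite leNgt; apply/negP => sL.
have : inf S <= s by apply: ge_inf => //; exists (r p).
have : r p <= L - s by apply: Slb; split; [lra|apply: reach_forth Hs _ => //; lra].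
lra.
Qed.

Definition reach_later p0 : set M := [set q | exists2 t, 0 < t & reach t p0 q].

(** Travelling along a short arc through q changes the time of arrival by the time travelled, so
    being later than [p0] is the same for q and its neighbours as long as the arc avoids [p0]. Thus
    [p0] is the only place where the set can begin. *)
Lemma no_return_separation p0 : (forall t, 0 < t -> ~ reach t p0 p0) ->
  [/\ open (reach_later p0), forall t, 0 < t < r p0 -> reach_later p0 (e p0 t),
      forall t, - r p0 < t <= 0 -> ~ reach_later p0 (e p0 t) &
      forall q, q <> p0 -> ~ reach_later p0 q -> \forall q' \near q, ~ reach_later p0 q'].
Proof.
move=> nr; split.
- rewrite openE => q [t t0 Ht].
  have d0 : 0 < Num.min (r q) t by rewrite lt_min r0.
  have dr : Num.min (r q) t <= r q by rewrite ge_min lexx.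
  apply: filterS (e_nbhs d0 dr) => _ [b /= + <-].
  rewrite lt_min => /andP[br bt].
  have [b0|/ltW b0] := leP 0 b.
    exists (t + b); first by rewrite ltr_wpDr.
    by apply: reach_trans Ht _; apply: reach_from => //; rewrite -[b]ger0_norm.
  rewrite ler0_norm// in br bt.
  exists (t - - b); first by rewrite subr_gt0.
  apply: (reach_back Ht); last exact: ltW.
  by have := reach_to (p := q) (t := - b); rewrite opprK oppr_ge0; apply.
- by move=> t /andP[t0 tr]; exists t => //; apply: reach_from => //; exact: ltW.
- move=> t /andP[rt t0] [s s0 Hs].
  apply: (nr (s + - t)); first by rewrite ltr_wpDr// oppr_ge0.
  apply: reach_trans Hs _; have := reach_to (p := p0) (t := - t).
  by rewrite opprK oppr_ge0; apply => //; lra.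
- move=> q qp nq.
  (* By injectivity the arc through q meets [p0] at most once, and at a nonzero time; it is
     shortened to stop before that time. *)
  have [d [d0 dr dp]] : exists d : R, [/\ 0 < d, d <= r q & forall a, `|a| < d -> e q a <> p0].
    have [[a ar aE]|na] := pselect (exists2 a, `|a| < r q & e q a = p0); last first.
      by exists (r q); split => // a ha E; apply: na; exists a.
    have a0 : a != 0 by apply/eqP => a0; apply: qp; rewrite -aE a0 e0.
    exists `|a|; split; [by rewrite normr_gt0|exact: ltW|] => b ba E.
    have /e_inj : e q b = e q a by rewrite E aE.
    by move=> /(_ (lt_trans ba ar) ar) ba'; rewrite ba' ltxx in ba.
  apply: filterS (e_nbhs d0 dr) => _ [b /= bd <-] [t t0 Ht].
  have br : `|b| < r q by exact: lt_le_trans dr.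
  have [b0|b0] := leP b 0.
    apply: nq; exists (t + - b); first by rewrite ltr_wpDr// oppr_ge0.
    apply: reach_trans Ht _; have := reach_to (p := q) (t := - b).
    by rewrite opprK oppr_ge0; apply => //; rewrite -ler0_norm.
  rewrite gtr0_norm// in bd br.
  have Hb := reach_from (ltW b0) br.
  have [bt|tb] := leP b t.
    have := reach_back Ht Hb bt => H.
    have [tb|tb] := leP t b.
      have E : t - b = 0 by lra.
      by move: H; rewrite E => -[n Hn]; apply: qp; exact/esym/(reach_in0 Hn).
    by apply: nq; exists (t - b) => //; lra.
  have := @reach_arc _ _ r e q (b - t) b.
  rewrite (_ : b - (b - t) = t); last by lra.
  move=> H.
  have btd : `|b - t| < d by rewrite gtr0_norm//; lra.
  have {}H : reach t (e q (b - t)) (e q b).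
    apply: H; [exact: lt_le_trans btd dr|by rewrite gtr0_norm|lra].
  by apply: (dp _ btd); apply: reach_bwd H Ht.
Qed.

Lemma return_periodic p0 (t0 : R) : connected [set: M] -> 0 < t0 -> reach t0 p0 p0 ->
  exists (L : R) (gamma : R -> M), [/\ 0 < L, forall t, gamma (t + L) = gamma t,
    forall t h, `|h| < r (gamma t) -> gamma (t + h) = e (gamma t) h,
    forall s t, gamma s = gamma t -> exists n : int, s = t + n%:~R * L &
    forall q, exists t, gamma t = q].
Proof.
move=> cM t00 Ht0; have [L [L0 HL] Lmin] := first_return t00 Ht0.
have Hn n : reach (n%:R * L) p0 p0.
  elim: n => [|n IH]; first by rewrite mul0r; exact: reach_refl.
  by rewrite -natr1 mulrDl mul1r; exact: reach_trans IH HL.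
have large (t : R) : exists n : nat, 0 <= t + n%:R * L.
  exists (Num.truncn (`|t| / L)).+1.
  have : `|t| / L < (Num.truncn (`|t| / L)).+1%:R by exact: truncnS_gt.
  rewrite ltr_pdivrMr// => h; have := ler_norm (- t); rewrite normrN; lra.
have total t : 0 <= t -> exists z, reach t p0 z.
  move=> t_ge0; have [n Hnt] := large (- t).
  have [|z Hz _] := reach_split (Hn n) (s := t); last by exists z.
  by rewrite t_ge0; lra.
have shift t n k z : reach (t + n%:R * L) p0 z -> reach (t + (n + k)%:R * L) p0 z.
  move=> H; rewrite (_ : t + (n + k)%:R * L = k%:R * L + (t + n%:R * L)).
    exact: reach_trans (Hn k) H.
  by rewrite natrD mulrDl; lra.
(* Only nonnegative times can be reached, so a time of either sign is first shifted by a multiple of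
   the period; the point obtained does not depend on the shift. *)
have /choice[gamma gE] t : exists z, forall n : nat, 0 <= t + n%:R * L -> reach (t + n%:R * L) p0 z.
  have [n Hnt] := large t; have [z Hz] := total _ Hnt.
  exists z => m Hmt; have [w Hw] := total _ Hmt.
  suff -> : z = w by [].
  apply: reach_fwd (shift _ _ m _ Hz) _; rewrite addnC.
  exact: shift.
have gU t n z : reach (t + n%:R * L) p0 z -> gamma t = z.
  by move=> H; have t_ge0 := reach_ge0 H; exact: reach_fwd (gE t n t_ge0) H.
have large2 (t h : R) : exists n : nat, 0 <= t + n%:R * L /\ 0 <= t + h + n%:R * L.
  have [n Hnt] := large t; have [m Hm] := large (t + h).
  exists (n + m)%N; rewrite natrD mulrDl.
  have : 0 <= n%:R * L by rewrite mulr_ge0// ltW.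
  have : 0 <= m%:R * L by rewrite mulr_ge0// ltW.
  by split; lra.
have flow t h : `|h| < r (gamma t) -> gamma (t + h) = e (gamma t) h.
  move=> hr; have [n [n1 n2]] := large2 t h.
  apply: (gU _ n).
  have [h0|/ltW h0] := leP 0 h.
    rewrite addrAC; apply: reach_trans (gE _ _ n1) _; apply: reach_from => //.
    by rewrite -(ger0_norm h0).
  rewrite (_ : t + h + n%:R * L = t + n%:R * L - - h); last by lra.
  apply: reach_back (gE _ _ n1) _ _; last by lra.
  have := reach_to (p := gamma t) (t := - h).
  by rewrite opprK oppr_ge0; apply => //; rewrite -ler0_norm.
have gp : gamma 0 = p0 by apply: (gU 0 0%N); rewrite mul0r addr0; exact: reach_refl.
exists L, gamma; split => //.
- move=> t; have [n n1] := large t; apply: (gU _ n).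
  rewrite (_ : t + L + n%:R * L = t + (n + 1)%:R * L); last by rewrite natrD; lra.
  exact/shift/gE.
- move=> s t; wlog st : s t / s <= t => [W E|].
    have [st|/ltW ts] := leP s t; first exact: W.
    by have [n ->] := W _ _ ts (esym E); exists (- n); rewrite mulrNz; lra.
  move=> E; have [n n1] := large s.
  have Hs := gE s n n1.
  have nt : 0 <= t + n%:R * L by lra.
  have Ht := gE t n nt; rewrite -E in Ht.
  have : reach (t + n%:R * L - (s + n%:R * L)) p0 p0 by apply: reach_back Ht Hs _; lra.
  rewrite (_ : _ - _ = t - s); last by lra.
  have ts0 : 0 <= t - s by lra.
  set d := t - s in ts0 *; have dE : d = t - s by [].
  move=> Hd; have d0 := ts0.
  (* The remainder of [d] modulo [L] would be a return time below the smallest one unless it is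
     0. *)
  pose k := Num.truncn (d / L).
  have /andP[k1 k2] : k%:R <= d / L < k.+1%:R.
    by apply: truncn_itv; rewrite divr_ge0// ltW.
  rewrite ler_pdivlMr// in k1; rewrite ltr_pdivrMr// -natr1 mulrDl mul1r in k2.
  have := reach_back Hd (Hn k) k1.
  have [h|h] := leP (d - k%:R * L) 0.
    by move=> _; exists (- k%:Z); rewrite mulrNz -pmulrn; lra.
  by move=> /(Lmin _ h); lra.
(* Arcs are neighbourhoods, and an arc that meets the orbit lies in it, so the orbit is open and
   closed. *)
- have conn : forall p : M, exists2 N : set M, nbhs p N & forall x y, N x -> N y ->
      (exists t, gamma t = x) -> exists t, gamma t = y.
    move=> p; exists (e p @` [set t | `|t| < r p]); first exact: e_nbhs.
    move=> _ _ [a /= ha <-] [b /= hb <-] [t tE].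
    have [n [n1 n2]] := large2 t (b - a).
    have Ht := gE t n n1; rewrite tE in Ht.
    exists (t + (b - a)); apply: (gU _ n).
    have [ab|/ltW ba] := leP a b.
      by rewrite addrAC; apply: reach_trans Ht _; exact: reach_arc.
    rewrite (_ : t + (b - a) + n%:R * L = t + n%:R * L - (a - b)); last by lra.
    by apply: reach_back Ht _ _; [exact: reach_arc|lra].
  by move=> q; apply: (connected_locally_constant cM conn (x := p0)); exists 0.
Qed.

End Flow.

(** * The equation in a chart *)

Section LocalSolutions.
Context {R : realType}.
Implicit Types (f g u v q s V : R -> R) (O K A : set R) (a b t x y L C lam : R).
Local Notation mu := (@lebesgue_measure R).

Lemma within_continuousP A f :
  {within A, continuous f} <->
  forall x, A x -> forall e : R, 0 < e ->
    exists2 d : R, 0 < d & forall y, A y -> `|y - x| < d -> `|f y - f x| < e.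
Proof.
split=> [cf x Ax e e0|H].
  move/subspace_continuousP : cf => /(_ x Ax)/cvgrPdist_lt/(_ _ e0).
  rewrite near_withinE => /nbhs_ballP[d /= d0 Hd].
  exists d => // y Ay yd; rewrite distrC; apply: Hd => //.
  by rewrite /ball/= distrC.
apply/subspace_continuousP => x Ax; apply/cvgrPdist_lt => e e0.
have [d d0 Hd] := H x Ax e e0.
rewrite near_withinE; apply/nbhs_ballP; exists d => //= y; rewrite /ball/= => xy Ay.
by rewrite distrC Hd// distrC.
Qed.

Lemma within_continuous_near A O f x : {within A, continuous f} -> open O ->
  O `<=` A -> O x -> {for x, continuous f}.
Proof.
move=> cf oO OA Ox; 
have : {within O, continuous f} by exact: continuous_subspaceW cf.
by rewrite continuous_open_subspace//; apply; exact: mem_set.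
Qed.

Lemma interior_approx a b f x (e : R) : a < b -> {within `[a, b], continuous f} ->
  a <= x <= b -> 0 < e -> exists2 y, a < y < b & `|f y - f x| < e.
Proof.
move=> ab /within_continuousP cf axb e0.
have [|d d0 Hd] := cf x _ e e0; first by rewrite /= in_itv.
(* The point y is x moved by the fraction [th] towards the midpoint. The bound 1/2 serves the open
   interval, the other one the distance to x, and the added 1 avoids a zero denominator. *)
pose m := (a + b) / 2; pose th := Num.min (1 / 2) (d / (`|m - x| + 1)).
have p0 : 0 < `|m - x| + 1 by rewrite ltr_wpDl.
have th0 : 0 < th by rewrite /th lt_min !divr_gt0.
have th2 : th <= 1 / 2 by rewrite /th ge_min lexx.
have thd : th <= d / (`|m - x| + 1) by rewrite /th ge_min lexx orbT.
move/andP : axb => [ax xb].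
have E : x + th * (m - x) = (1 - th) * x + th * m by lra.
have h1 : a < x + th * (m - x) < b.
  have mE : m = (a + b) / 2 by [].
  rewrite E; apply/andP; split.
    have : 0 <= (1 - th) * (x - a) by apply: mulr_ge0; lra.
    have : 0 < th * (m - a) by apply: mulr_gt0 => //; lra.
    lra.
  have : 0 <= (1 - th) * (b - x) by apply: mulr_ge0; lra.
  have : 0 < th * (b - m) by apply: mulr_gt0 => //; lra.
  lra.
exists (x + th * (m - x)) => //; apply: Hd.
  by rewrite /= in_itv/=; case/andP: h1 => h1 h2; rewrite !ltW.
rewrite addrC addKr normrM (gtr0_norm th0).
apply: (@le_lt_trans _ _ (d / (`|m - x| + 1) * `|m - x|)); first by rewrite ler_wpM2r.
by rewrite mulrAC ltr_pdivrMr// ltr_pM2l// ltrDl.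
Qed.

(** The equation is known in the interior of a chart image only; estimates reach a boundary point by
    continuity. *)
Lemma oscillation_closure a b f C : a < b -> {within `[a, b], continuous f} ->
  (forall x y, a < x -> x <= y -> y < b -> `|f y - f x| <= C) ->
  forall x y, a <= x <= b -> a <= y <= b -> `|f y - f x| <= C.
Proof.
move=> ab cf H x y axb ayb; apply/ler_addgt0Pr => e e0.
have e20 : 0 < e / 2 by rewrite divr_gt0.
have [x' /andP[ax' x'b] x'x] := interior_approx ab cf axb e20.
have [y' /andP[ay' y'b] y'y] := interior_approx ab cf ayb e20.
have H' : `|f y' - f x'| <= C.
  have [xy|/ltW yx] := leP x' y'; first exact: H.
  by rewrite distrC; exact: H.
have -> : f y - f x = (f y - f y') + (f y' - f x') + (f x' - f x) by lra.
apply: (le_trans (ler_normD _ _)).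
have := ler_normD (f y - f y') (f y' - f x').
by rewrite (distrC (f y)); lra.
Qed.

Lemma segment_bound a b f : {within `[a, b], continuous f} -> a <= b ->
  exists2 c, a <= c <= b & forall t, a <= t <= b -> `|f t| <= `|f c|.
Proof.
move=> cf ab.
have cnf : {within `[a, b], continuous (fun t => `|f t|)}.
  by move=> t; apply: (@continuous_comp _ _ _ (f : subspace _ -> R) Num.norm); [exact: cf|exact: norm_continuous].
have [c cab Hc] := EVT_max ab cnf; exists c; first by move: cab; rewrite in_itv.
by move=> t tab; apply: Hc; rewrite in_itv.
Qed.

(* The equation -lap u + V u = lam u as the first order system u' = s q,
   q' = s (V - lam) u, where s is the square root of the metric. *)
Definition solution O s V lam u q : Prop :=
  [/\ forall t, O t -> {for t, continuous u}, forall t, O t -> {for t, continuous q},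
      weak_deriv O u (fun t => s t * q t) &
      exists2 v, weak_deriv O q v &
        {ae mu, forall t, O t -> v t = s t * (V t - lam) * u t}].

Lemma solution_comb O s V lam u q u' q' (c c' : R) :
  solution O s V lam u q -> solution O s V lam u' q' ->
  solution O s V lam (fun t => c * u t + c' * u' t) (fun t => c * q t + c' * q' t).
Proof.
move=> [cu cq wu [v wv vE]] [cu' cq' wu' [v' wv' vE']].
have cc f f' t : O t -> {for t, continuous f} -> {for t, continuous f'} ->
    {for t, continuous (fun t => c * f t + c' * f' t)}.
  move=> Ot cf cf'; apply: (@continuousD _ _ _ (fun t => c * f t) (fun t => c' * f' t));
  by apply: continuousM => //; exact: cst_continuous.
split.
- by move=> t Ot; apply: cc => //; [exact: cu|exact: cu'].
- by move=> t Ot; apply: cc => //; [exact: cq|exact: cq'].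
- have := weak_derivD (weak_derivZ c wu) (weak_derivZ c' wu').
  by rewrite (_ : (fun t => s t * (c * q t + c' * q' t)) =
    (fun t => c * (s t * q t) + c' * (s t * q' t)))//; apply/funext => t; ring.
- exists (fun t => c * v t + c' * v' t).
    exact: (weak_derivD (weak_derivZ c wv) (weak_derivZ c' wv')).
  by apply: ae_mono (ae_conj vE vE') => t [h h'] Ot; rewrite h// h'//; ring.
Qed.

Section FixedCoefficients.
Variables (O : set R) (s V : R -> R).
Hypothesis cs : forall t, O t -> {for t, continuous s}.
Hypothesis bV : forall t, O t -> exists d C : R, 0 < d /\
  {ae mu, forall r, `|r - t| < d -> `|V r| <= C}.

Lemma solution_open lam u q : solution O s V lam u q -> open O.
Proof. by case=> _ _ [[]]. Qed.

Lemma solution_derive lam u q t : solution O s V lam u q -> O t ->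
  has_derive u t (s t * q t).
Proof.
move=> [cu cq wu _] Ot; apply: (weak_deriv_has_derive wu) => //.
apply: (@continuous_ess_limit _ (fun t => s t * q t)).
by apply: continuousM; [exact: cs|exact: cq].
Qed.

(* The potential V drops out when the solutions are combined so as to vanish
   at t. *)
Lemma solution_cancel t (k1 k2 k3 k4 lam1 lam2 lam3 lam4 : R)
    u1 u2 u3 u4 q1 q2 q3 q4 :
  solution O s V lam1 u1 q1 -> solution O s V lam2 u2 q2 ->
  solution O s V lam3 u3 q3 -> solution O s V lam4 u4 q4 -> O t ->
  k1 * u1 t + k2 * u2 t + k3 * u3 t + k4 * u4 t = 0 ->
  has_derive (fun r => k1 * q1 r + k2 * q2 r + k3 * q3 r + k4 * q4 r) t
   (- s t * (k1 * lam1 * u1 t + k2 * lam2 * u2 t + k3 * lam3 * u3 t + k4 * lam4 * u4 t)).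
Proof.
move=> [cu1 cq1 _ [v1 w1 e1]] [cu2 cq2 _ [v2 w2 e2]].
move=> [cu3 cq3 _ [v3 w3 e3]] [cu4 cq4 _ [v4 w4 e4]] Ot U0.
have oO : open O by case: w1 => -[].
have cM (k : R) f r : {for r, continuous f} -> {for r, continuous (fun x => k * f x)}.
  by move=> cf; apply: continuousM => //; exact: cst_continuous.
have cD f g r : {for r, continuous f} -> {for r, continuous g} ->
  {for r, continuous (fun x => f x + g x)} by exact: continuousD.
have c4 f1 f2 f3 f4 (c1 c2 c3 c4 : R) r : {for r, continuous f1} ->
    {for r, continuous f2} -> {for r, continuous f3} -> {for r, continuous f4} ->
    {for r, continuous (fun x => c1 * f1 x + c2 * f2 x + c3 * f3 x + c4 * f4 x)}.
  move=> h1 h2 h3 h4.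
  exact: (cD _ _ _ (cD _ _ _ (cD _ _ _ (cM c1 _ _ h1) (cM c2 _ _ h2)) (cM c3 _ _ h3)) (cM c4 _ _ h4)).
pose U r := k1 * u1 r + k2 * u2 r + k3 * u3 r + k4 * u4 r.
pose G r := k1 * lam1 * u1 r + k2 * lam2 * u2 r + k3 * lam3 * u3 r + k4 * lam4 * u4 r.
have cU : {for t, continuous U}.
  by apply: c4; [exact: cu1|exact: cu2|exact: cu3|exact: cu4].
have cG : {for t, continuous G}.
  by apply: c4; [exact: cu1|exact: cu2|exact: cu3|exact: cu4].
have w := weak_derivD (weak_derivD (weak_derivD (weak_derivZ k1 w1) (weak_derivZ k2 w2))
   (weak_derivZ k3 w3)) (weak_derivZ k4 w4).
apply: (weak_deriv_has_derive w) => //.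
  by move=> r Or; apply: c4; [exact: cq1|exact: cq2|exact: cq3|exact: cq4].
move=> e e0.
have [d1 [C [d10 HC]]] := bV Ot.
have [d2 d20 HO] := open_contains_interval oO Ot.
have csU : {for t, continuous (fun r => s r * U r)} by apply: continuousM => //; exact: cs.
have csG : {for t, continuous (fun r => s r * G r)} by apply: continuousM => //; exact: cs.
have C0 : 0 < `|C| + 1 by rewrite ltr_wpDl.
have e1' : 0 < e / 2 / (`|C| + 1) by rewrite !divr_gt0.
have e2' : 0 < e / 2 by rewrite divr_gt0.
have /cvgr_dist_le/(_ _ e1')[d3 /= d30 H3] := csU.
have /cvgr_dist_le/(_ _ e2')[d4 /= d40 H4] := csG.
exists (Num.min (Num.min d1 d2) (Num.min d3 d4)); first by rewrite !lt_min d10 d20 d30.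
apply: ae_mono (ae_conj HC (ae_conj (ae_conj e1 e2) (ae_conj e3 e4))) => r.
move=> [hC [[h1 h2] [h3 h4]]].
rewrite !lt_min => /andP[/andP[rd1 rd2] /andP[rd3 rd4]].
have Or := HO _ rd2; rewrite h1// h2// h3// h4//.
have := hC rd1 => VC.
have := H3 r; rewrite /= distrC => /(_ rd3); rewrite /U U0 mulr0 sub0r normrN -/(U r) => HU.
have := H4 r; rewrite /= distrC => /(_ rd4); rewrite distrC => HG.
(* All occurrences of [V] are collected in front of s U, which is continuous and vanishes at t; a
   local bound of [V] then suffices. The rest is continuous. *)
have -> : k1 * (s r * (V r - lam1) * u1 r) + k2 * (s r * (V r - lam2) * u2 r) +
   k3 * (s r * (V r - lam3) * u3 r) + k4 * (s r * (V r - lam4) * u4 r) -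
   - s t * (k1 * lam1 * u1 t + k2 * lam2 * u2 t + k3 * lam3 * u3 t + k4 * lam4 * u4 t)
  = V r * (s r * U r) - (s r * G r - s t * G t) by rewrite /U /G; ring.
apply: (le_trans (ler_normB _ _)).
suff : `|V r * (s r * U r)| <= e / 2 by lra.
rewrite normrM.
apply: (@le_trans _ _ ((`|C| + 1) * (e / 2 / (`|C| + 1)))).
  apply: ler_pM => //; apply: (le_trans VC); apply: (le_trans (ler_norm C)).
  by rewrite lerDl.
by rewrite mulrC divfK// gt_eqF.
Qed.

(** From a common zero, sup |u| <= S (b - a) sup |q| and sup |q| <= K (b - a) sup |u|. As the
    product of the two constants is below 1, both suprema vanish. The closed interval allows [x0] to
    be a boundary point. *)
Lemma solution_unique_continuation lam u q a b (S K : R) x0 :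
  solution O s V lam u q -> a < b -> `]a, b[ `<=` O ->
  {within `[a, b], continuous u} -> {within `[a, b], continuous q} ->
  (forall t, a < t < b -> `|s t| <= S) ->
  {ae mu, forall t, a < t < b -> `|s t * (V t - lam)| <= K} ->
  S * K * (b - a) ^+ 2 < 1 -> 0 <= S -> 0 <= K ->
  a <= x0 <= b -> u x0 = 0 -> q x0 = 0 ->
  forall t, a <= t <= b -> u t = 0 /\ q t = 0.
Proof.
move=> [cu cq wu [v wv vE]] ab abO cuab cqab sS VK SK S0 K0 x0ab ux0 qx0.
have ab' : a <= b by exact: ltW.
have [cM M1 M2] := segment_bound cuab ab'.
have [cN N1 N2] := segment_bound cqab ab'.
have sub x y : a < x -> x <= y -> y < b -> `[x, y] `<=` O.
  move=> ax xy yb r; rewrite /= in_itv/= => /andP[xr ry]; apply: abO.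
  by rewrite /= in_itv/= (lt_le_trans ax xr) (le_lt_trans ry yb).
have oscu : forall x y, a <= x <= b -> a <= y <= b ->
    `|u y - u x| <= S * `|q cN| * (b - a).
  apply: oscillation_closure => // x y ax xy yb.
  rewrite -[u y - u x]subr0 -(mul0r (y - x)).
  apply: (@le_trans _ _ (S * `|q cN| * (y - x))).
    apply: (weak_deriv_lipschitz wu) => //; first exact: sub.
    apply: aeW => r /andP[xr ry]; rewrite subr0 normrM ler_pM//.
      by apply: sS; rewrite (lt_le_trans ax xr) (le_lt_trans ry yb).
    by apply: N2; rewrite (ltW (lt_le_trans ax xr)) (ltW (le_lt_trans ry yb)).
  by apply: ler_wpM2l; [rewrite mulr_ge0|lra].
have oscq : forall x y, a <= x <= b -> a <= y <= b ->
    `|q y - q x| <= K * `|u cM| * (b - a).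
  apply: oscillation_closure => // x y ax xy yb.
  rewrite -[q y - q x]subr0 -(mul0r (y - x)).
  apply: (@le_trans _ _ (K * `|u cM| * (y - x))).
    apply: (weak_deriv_lipschitz wv) => //; first exact: sub.
    apply: ae_mono (ae_conj VK vE) => r [hK hv] /andP[xr ry].
    have arb : a < r < b by rewrite (lt_le_trans ax xr) (le_lt_trans ry yb).
    have Or : O r by apply: abO; rewrite /= in_itv.
    rewrite subr0 hv// normrM ler_pM//; first exact: hK.
    by apply: M2; case/andP: arb => h1 h2; rewrite !ltW.
  by apply: ler_wpM2l; [rewrite mulr_ge0|lra].
have := oscu _ _ x0ab M1; rewrite ux0 subr0 => hu.
have := oscq _ _ x0ab N1; rewrite qx0 subr0 => hq.
have ba0 : 0 < b - a by lra.
have Mz : `|u cM| = 0.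
  apply/eqP; rewrite eq_le normr_ge0 andbT.
  have h : `|u cM| <= S * K * (b - a) ^+ 2 * `|u cM|.
    apply: (le_trans hu).
    have -> : S * K * (b - a) ^+ 2 * `|u cM| = S * (K * `|u cM| * (b - a)) * (b - a) by ring.
    by apply: ler_wpM2r; [exact: ltW|apply: ler_wpM2l].
  rewrite leNgt; apply/negP => M0.
  have : S * K * (b - a) ^+ 2 * `|u cM| < 1 * `|u cM| by rewrite ltr_pM2r.
  by rewrite mul1r; lra.
have Nz : `|q cN| = 0.
  by apply/eqP; rewrite eq_le normr_ge0 andbT; move: hq; rewrite Mz mulr0 mul0r.
move=> t tab; split; apply/eqP; rewrite -normr_eq0 eq_le normr_ge0 andbT.
  by rewrite -Mz M2.
by rewrite -Nz N2.
Qed.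

End FixedCoefficients.

End LocalSolutions.

(** * Charts, metric, and volume *)

Section Charts.
Context {R : realType} {M : topologicalType} (A : atlas R M).
Implicit Types (p q x y z : M) (s t : R) (f F : R -> R).

Definition cmap_at x : M -> R := cmap (chart_at A x).
Definition cinv_at x : R -> M := cinv (chart_at A x).
Definition cdom_at x : set M := cdom (chart_at A x).
Local Notation c := cmap_at.
Local Notation ci := cinv_at.
Local Notation D := cdom_at.

Lemma cdom_at_open x : open (D x).
Proof. exact: cdom_open. Qed.

Lemma cdom_at_self x : D x x.
Proof. exact: chart_at_dom. Qed.

Lemma cinv_atK x z : D x z -> ci x (c x z) = z.
Proof. exact: cmapK. Qed.

Lemma cimg_cmap x z : D x z -> cimg A x (c x z).
Proof. by move=> Dz; exists z. Qed.

Lemma cinv_dom x t : cimg A x t -> D x (ci x t).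
Proof. by move=> [z Dz <-]; rewrite -/(c x z) cinv_atK. Qed.

Lemma cmap_atK x t : cimg A x t -> c x (ci x t) = t.
Proof. by move=> [z Dz <-]; rewrite -/(c x z) cinv_atK. Qed.

Lemma cimgE x : exists2 O : set R, open O & cimg A x = O `&` [set t | 0 <= t].
Proof. exact: cimg_open. Qed.

Lemma cimg_ge0 x t : cimg A x t -> 0 <= t.
Proof. by have [U _ ->] := cimgE x; case. Qed.

Lemma cimg_near x t : cimg A x t ->
  exists2 d : R, 0 < d & forall s, 0 <= s -> `|s - t| < d -> cimg A x s.
Proof.
have [U oU ->] := cimgE x; move=> [Ut _].
by have [d d0 Hd] := open_contains_interval oU Ut; exists d => // s s0 /Hd.
Qed.

Lemma cint_open x : open (cint A x).
Proof.
rewrite /cint; have [U oU ->] := cimgE x.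
rewrite (_ : _ `&` _ = U `&` [set t | 0 < t]); first by apply: openI => //; exact: open_gt.
apply/seteqP; split => t /=; first by case=> -[].
by move=> [Ut t0]; do ?split => //; exact: ltW.
Qed.

Lemma cint_cimg x : cint A x `<=` cimg A x.
Proof. by move=> t []. Qed.

Lemma cmeasurable_cimg x : measurable (cimg A x : set R).
Proof.
have [U oU ->] := cimgE x; apply: measurableI; first exact: open_measurable.
by rewrite (_ : [set t | 0 <= t] = `[0, +oo[%classic)//; apply/seteqP; split => t /=; rewrite in_itv/= andbT.
Qed.

Lemma cmap_at_continuous x z : D x z -> {for z, continuous (c x)}.
Proof.
move=> Dz; have := @cmap_continuous _ _ (chart_at A x).
by rewrite continuous_open_subspace; [apply; exact: mem_set|exact: cdom_at_open].
Qed.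

Lemma cinv_at_near x t (N : set M) : cimg A x t -> nbhs (ci x t) N ->
  exists2 d : R, 0 < d & forall s, cimg A x s -> `|s - t| < d -> N (ci x s).
Proof.
move=> xt Nt; have /subspace_continuousP/(_ _ xt) := @cinv_continuous _ _ (chart_at A x).
move=> /(_ N Nt); rewrite /= /fmap/= nbhs_filterE /within/= => /nbhs_ballP[d /= d0 Hd].
by exists d => // s xs st; apply: Hd => //; rewrite /ball/= distrC.
Qed.

Lemma cmap_at_near x z (P : R -> Prop) : D x z -> (\forall s \near c x z, P s) ->
  \forall y \near z, D x y /\ P (c x y).
Proof.
move=> Dz HP; have nD : nbhs z (D x).
  by apply: open_nbhs_nbhs; split => //; exact: cdom_at_open.
have nP : nbhs z (c x @^-1` [set s | P s]) by exact: (cmap_at_continuous Dz).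
by apply: filterS2 nD nP.
Qed.

Lemma near_dist (t d : R) : 0 < d -> \forall s \near t, `|s - t| < d.
Proof.
by move=> d0; apply/nbhs_ballP; exists d => // s; rewrite /ball/= distrC.
Qed.

Lemma half_deriv_eq f F (t d l : R) : has_derive F t l -> 0 < d ->
  (forall s, t <= s -> s < t + d -> F s = f s) -> half_deriv f t = l.
Proof.
move=> /has_deriveP dF d0 E; apply/cvg_lim; first exact: Rhausdorff.
apply/cvgrPdist_le => e e0.
have /nbhs_ballP[d' /= d'0 Hd'] := dF _ e0.
near=> h.
have h0 : 0 < h by near: h; exact: nbhs_right_gt.
have hd : h < d by near: h; exact: nbhs_right_lt.
have hd' : h < d' by near: h; exact: nbhs_right_lt.
have := Hd' (t + h); rewrite /ball/= opprD addrA subrr sub0r normrN gtr0_norm// => /(_ hd').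
rewrite -(E (t + h)) ?lerDl ?ltrD2l ?(ltW h0)// -(E t) ?ltrDl//.
rewrite (_ : t + h - t = h); last by lra.
rewrite (gtr0_norm h0) => H.
rewrite -(ler_pM2r h0) -[X in _ * X <= _](gtr0_norm h0) -normrM mulrBl mulrAC mulVf ?gt_eqF// mul1r.
by rewrite distrC.
Unshelve. all: by end_near. Qed.

Lemma transition x y z : D x z -> D y z -> exists2 F : R -> R, smooth_fun F &
  exists2 d : R, 0 < d & forall s, 0 <= s -> `|s - c x z| < d ->
    [/\ cimg A x s, D y (ci x s) & F s = c y (ci x s)].
Proof.
move=> Dx Dy; have xt : cimg A x (c x z) by exact: cimg_cmap.
have [|F sF /nbhs_ballP[d1 /= d10 H1]] := @transition_smooth _ _ A x y (c x z).
  by exists z.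
have [d2 d20 H2] := cimg_near xt.
have [|d3 d30 H3] := cinv_at_near (N := D y) xt.
  by rewrite cinv_atK//; apply: open_nbhs_nbhs; split => //; exact: cdom_at_open.
exists F => //; exists (Num.min d1 (Num.min d2 d3)); first by rewrite !lt_min d10 d20.
move=> s s0; rewrite !lt_min => /and3P[sd1 sd2 sd3].
have xs := H2 _ s0 sd2; have ys := H3 _ xs sd3.
split => //; apply: H1; first by rewrite /ball/= distrC.
by exists (ci x s); [split => //; exact: cinv_dom|exact: cmap_atK].
Qed.

(** The Jacobian [jac] is the case where [y] is [z]; arbitrary target charts are needed to state the
    chain rule. *)
Definition dtrans x y z : R := half_deriv (c y \o ci x) (c x z).

Lemma dtrans_derive x y z F (d : R) : smooth_fun F -> 0 < d ->
  (forall s, 0 <= s -> `|s - c x z| < d -> F s = c y (ci x s)) -> D x z ->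
  has_derive F (c x z) (dtrans x y z).
Proof.
move=> sF d0 E Dx.
have := smooth_fun_derive (c x z) sF; rewrite /dtrans.
move=> H; rewrite (@half_deriv_eq _ F _ d (derive1 F (c x z)))// => s ts sd /=.
apply: E; first by rewrite (le_trans _ ts)// (@cimg_ge0 x)//; exact: cimg_cmap.
by rewrite ger0_norm ?subr_ge0//; lra.
Qed.

(** Transition maps are one-sided at a boundary point, so the chain rule is applied to smooth
    extensions and then read on the right of the point. *)
Lemma dtrans_chain x y w z : D x z -> D y z -> D w z ->
  dtrans x w z = dtrans y w z * dtrans x y z.
Proof.
move=> Dx Dy Dw.
have [F1 s1 [d1 d10 E1]] := transition Dx Dw.
have [F2 s2 [d2 d20 E2]] := transition Dy Dw.
have [F3 s3 [d3 d30 E3]] := transition Dx Dy.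
have x0 : 0 <= c x z by apply: (@cimg_ge0 x); exact: cimg_cmap.
have D2 : has_derive F2 (c y z) (dtrans y w z).
  by apply: (dtrans_derive s2 d20) => // s s0 /E2[]; last by [].
have D3 : has_derive F3 (c x z) (dtrans x y z).
  by apply: (dtrans_derive s3 d30) => // s s0 /E3[]; last by [].
have F3z : F3 (c x z) = c y z.
  by have [|_ _ ->] := E3 _ x0; rewrite ?subrr ?normr0// cinv_atK.
have cF3 : {for c x z, continuous F3} := has_derive_continuous D3.
have /cvgr_dist_lt/(_ _ d20) := cF3; rewrite F3z => /nbhs_ballP[d4 /= d40 H4].
have DD : has_derive (fun s => F2 (F3 s)) (c x z) (dtrans y w z * dtrans x y z).
  by apply: has_derive_comp => //; rewrite F3z.
apply: (half_deriv_eq DD (d := Num.min (Num.min d1 d3) d4)); first by rewrite !lt_min d10 d30.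
move=> s xs; rewrite -ltrBlDl !lt_min => /andP[/andP[sd1 sd3] sd4].
have s0 : 0 <= s by exact: le_trans xs.
have nE : `|s - c x z| = s - c x z by rewrite ger0_norm// subr_ge0.
have [|cs ys E] := E3 s s0; first by rewrite nE.
rewrite /= E.
have [||_ _ ->] := E2 (c y (ci x s)).
- by apply: (@cimg_ge0 y); exact: cimg_cmap.
- by rewrite -E distrC; apply: H4; rewrite /ball/= distrC nE.
- by rewrite cinv_atK.
Qed.

Lemma dtrans_id x z : D x z -> dtrans x x z = 1.
Proof.
move=> Dx; have [d d0 Hd] := cimg_near (cimg_cmap Dx).
apply: (half_deriv_eq (F := id) (d := d)) => //; first exact: has_derive_id.
move=> s xs sd /=; rewrite cmap_atK//; apply: Hd.
  by rewrite (le_trans _ xs)// (@cimg_ge0 x)//; exact: cimg_cmap.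
by rewrite ger0_norm ?subr_ge0//; lra.
Qed.

Lemma dtransK x y z : D x z -> D y z -> dtrans y x z * dtrans x y z = 1.
Proof. by move=> Dx Dy; rewrite -dtrans_chain// dtrans_id. Qed.

Lemma dtrans_neq0 x y z : D x z -> D y z -> dtrans x y z != 0.
Proof.
move=> Dx Dy; apply/eqP => E; have := dtransK Dx Dy.
by rewrite E mulr0 => /eqP; rewrite eq_sym oner_eq0.
Qed.

Lemma jacE x z : jac A x z = dtrans x z z.
Proof. by []. Qed.

Lemma jac_neq0 x z : D x z -> jac A x z != 0.
Proof. by move=> Dx; rewrite jacE dtrans_neq0//; exact: cdom_at_self. Qed.

Lemma jac_self z : jac A z z = 1.
Proof. by rewrite jacE dtrans_id//; exact: cdom_at_self. Qed.

Lemma jac_trans x y z : D x z -> D y z -> jac A x z = jac A y z * dtrans x y z.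
Proof. by move=> Dx Dy; rewrite !jacE -dtrans_chain//; exact: cdom_at_self. Qed.

Lemma trans_has_derive x y z : D x z -> D y z -> 0 < c x z ->
  has_derive (fun t => c y (ci x t)) (c x z) (dtrans x y z).
Proof.
move=> Dx Dy x0; have [F sF [d d0 E]] := transition Dx Dy.
have DF : has_derive F (c x z) (dtrans x y z).
  by apply: (dtrans_derive sF d0) => // s s0 /E[]; last by [].
apply: near_has_derive DF.
have x01 : 0 < c x z < c x z + 1 by apply/andP; split => //; lra.
apply: filterS2 (near_between x01) (near_dist (c x z) d0) => s /andP[s0 _] sd.
by have [_ _ ->] := E s (ltW s0) sd.
Qed.

(* An interior minimum would force the derivative of the transition map, which
   is nonzero, to vanish. *)
Lemma interior_invariant x y z : D x z -> D y z -> 0 < c x z -> 0 < c y z.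
Proof.
move=> Dx Dy x0; rewrite lt_neqAle (@cimg_ge0 y) ?andbT; last exact: cimg_cmap.
apply/eqP => y0.
have [F sF [d d0 E]] := transition Dx Dy.
set t := c x z in x0 E *.
have l0 := dtrans_neq0 Dx Dy; set l := dtrans x y z in l0.
have DF : has_derive F t l by apply: (dtrans_derive sF d0) => // s s0 /E[]; last by [].
have Ft : F t = 0.
  by have [|_ _ ->] := E t (ltW x0); [rewrite subrr normr0|rewrite cinv_atK].
have e0 : 0 < `|l| / 2 by rewrite divr_gt0// normr_gt0.
move/has_deriveP : DF => /(_ _ e0)/nbhs_ballP[d' /= d'0 Hd'].
pose h := Num.min (Num.min d d') t / 2.
have h0 : 0 < h by rewrite divr_gt0// !lt_min d0 d'0.
have [hd hd' ht] : [/\ h < d, h < d' & h < t].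
  have h2 : h < Num.min (Num.min d d') t by rewrite /h ltr_pdivrMr// ltr_pMr ?ltr1n// !lt_min d0 d'0.
  by move: h2; rewrite !lt_min => /andP[/andP[]].
(* The step goes against the sign of the derivative, so the transition map would have to become
   negative. *)
pose s := t - Num.sg l * h.
have sg1 : `|Num.sg l| = 1 by rewrite normr_sg l0.
have sE : `|s - t| = h by rewrite /s addrC addKr normrN normrM sg1 mul1r gtr0_norm.
have s0 : 0 <= s.
  rewrite /s subr_ge0; apply: (le_trans (ler_norm _)).
  by rewrite normrM sg1 mul1r gtr0_norm// ltW.
have [|_ ys Fs] := E s s0; first by rewrite sE.
have := Hd' s; rewrite /ball/= distrC sE => /(_ hd'); rewrite Ft subr0 Fs.
have := @cimg_ge0 y _ (cimg_cmap ys).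
have -> : l * (s - t) = - (`|l| * h).
  by rewrite /s addrC addKr mulrN mulrA [l * _]mulrC -normrEsg.
rewrite opprK => h1 /(le_trans (ler_norm _)).
have : 0 < `|l| * h by rewrite mulr_gt0// normr_gt0.
lra.
Qed.

End Charts.

Section RiemannianCharts.
Context {R : realType} {M : topologicalType} {A : atlas R M}.
Variable g : riemannian_metric A.
Implicit Types (p q x y z : M) (s t : R).
Local Notation c := (cmap_at A).
Local Notation ci := (cinv_at A).
Local Notation D := (cdom_at A).

(** In dimension one the same density measures arc length and volume. *)
Definition rho x t : R := Num.sqrt (bilinear_loc A g x t).

Lemma bilinear_gt0 x t : cimg A x t -> 0 < bilinear_loc A g x t.
Proof.
move=> xt; rewrite /bilinear_loc mulr_gt0 ?metric_gt0// exprn_even_gt0//=.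
by apply: jac_neq0; exact: cinv_dom.
Qed.

Lemma rho_gt0 x t : cimg A x t -> 0 < rho x t.
Proof. by move=> xt; rewrite sqrtr_gt0 bilinear_gt0. Qed.

Lemma rho_cmap x z : D x z -> rho x (c x z) = Num.sqrt (g z) * `|jac A x z|.
Proof.
move=> Dx; rewrite /rho /bilinear_loc -/(ci x (c x z)) cinv_atK//.
by rewrite sqrtrM ?(ltW (metric_gt0 _ _))// sqrtr_sqr.
Qed.

Lemma rho_smooth x n : smooth_upto n (cint A x) (rho x).
Proof.
apply: smooth_upto_pointwise => t xt.
have [F sF /nbhs_ballP[d /= d0 Hd]] := metric_smooth g (cint_cimg xt).
have [d' d'0 Hd'] := open_contains_interval (@cint_open _ _ A x) xt.
pose U := ball t (Num.min d d').
have UE s : U s -> [/\ cint A x s, 0 < F s & F s = bilinear_loc A g x s].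
  rewrite /U /ball/= lt_min => /andP[sd sd'].
  have xs : cint A x s by apply: Hd'; rewrite distrC.
  have E : F s = bilinear_loc A g x s by apply: Hd => //; exact: cint_cimg.
  by split => //; rewrite E bilinear_gt0//; exact: cint_cimg.
have oU : open U by exact: ball_open.
exists U; first by apply: ballxx; rewrite lt_min d0.
apply: (@eq_smooth_upto _ _ _ (fun s => Num.sqrt (F s))) => //.
  by move=> s /UE[_ _ E]; rewrite E.
apply: (@smooth_upto_comp _ _ _ [set s | 0 < s]) => //.
- by move=> s /UE[].
- exact: smooth_upto_sqrt.
- by apply: (@smooth_uptoS _ _ setT) => //; move/smooth_funP : sF.
Qed.

Lemma rho_continuous x t : cint A x t -> {for t, continuous (rho x)}.
Proof. exact: (rho_smooth x 0). Qed.

Lemma rho_within x : {within cimg A x, continuous (rho x)}.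
Proof.
apply/within_continuousP => t xt e e0.
have [F sF /nbhs_ballP[d /= d0 Hd]] := metric_smooth g xt.
have cF : {for t, continuous (fun s => Num.sqrt (F s))}.
  apply: (@continuous_comp _ _ _ F Num.sqrt); last exact: sqrt_continuous.
  exact: smooth_fun_continuous.
have /cvgr_dist_lt/(_ _ e0)/nbhs_ballP[d' /= d'0 Hd'] := cF.
exists (Num.min d d'); first by rewrite lt_min d0.
move=> s xs; rewrite lt_min => /andP[sd sd'].
rewrite /rho -(Hd s)//; last by rewrite /ball/= distrC.
rewrite -(Hd t)//; last exact: ballxx.
by rewrite distrC; apply: Hd'; rewrite /ball/= distrC.
Qed.

End RiemannianCharts.

(** * The Riemannian volume and null sets in charts *)

Section Measure.
Context {R : realType} {M : ptopologicalType} {A : atlas R M}.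
Variable g : riemannian_metric A.
Variable mu : {measure set (borel M) -> \bar R}.
Hypothesis volM : riemannian_volume g mu.
Implicit Types (p q x y z : M) (s t : R).
Local Notation c := (cmap_at A).
Local Notation ci := (cinv_at A).
Local Notation D := (cdom_at A).
Local Notation leb := (@lebesgue_measure R).

Lemma open_borel (U : set M) : open U -> measurable (U : set (borel M)).
Proof. by move=> oU; exact: sub_gen_smallest. Qed.

Lemma continuous_borel (f : M -> R) : continuous f ->
  measurable_fun [set: borel M] (f : borel M -> R).
Proof.
move=> /continuousP cf; apply: (measurability _ (RGenOpens.measurableE R)).
move=> _ [_ [a [b ->] <-]]; rewrite setTI; apply: open_borel.
exact/cf/interval_open.
Qed.

Lemma measurable_cinv x (B : set (borel M)) : measurable B ->
  measurable (cimg A x `&` ci x @^-1` B).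
Proof.
move=> mB; have : measurable_fun (cimg A x) (ci x : R -> borel M).
  apply: (@measurability _ _ _ (borel M) (cimg A x) (ci x : R -> borel M) open) => //.
  move=> _ [U oU <-].
  (* The preimage is open only relatively to the chart image; this interior is an open set of the
     line with that trace. *)
  pose V := [set t | cimg A x t -> U (ci x t)]^°.
  have -> : cimg A x `&` ci x @^-1` U = cimg A x `&` V.
    apply/seteqP; split => t [xt Ut]; split => //; last exact: (interior_subset Ut).
    have [|d d0 Hd] := cinv_at_near (N := U) xt; first exact: open_nbhs_nbhs.
    apply/nbhs_ballP; exists d => // s; rewrite /ball/= => ts xs.
    by apply: Hd => //; rewrite distrC.
  apply: measurableI; first exact: cmeasurable_cimg.
  by apply: open_measurable; exact: open_interior.
by apply => //; exact: cmeasurable_cimg.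
Qed.

Lemma chart_imageE x (B : set M) : B `<=` D x ->
  cmap (chart_at A x) @` B = cimg A x `&` ci x @^-1` B.
Proof.
move=> BD; apply/seteqP; split => t.
  by move=> [z Bz <-]; split => /=; [apply: cimg_cmap; exact: BD|rewrite cinv_atK//; exact: BD].
by move=> [xt Bt]; exists (ci x t) => //; exact: cmap_atK.
Qed.

Lemma measurable_rho x (B : set R) : measurable B -> B `<=` cimg A x ->
  measurable_fun B (fun t => (rho g x t)%:E).
Proof.
move=> mB BA; apply/measurable_EFinP.
apply: (measurable_funS (@cmeasurable_cimg _ _ A x) BA).
by apply: subspace_continuous_measurable_fun; [exact: cmeasurable_cimg|exact: rho_within].
Qed.

(* The density of the volume in a chart is positive. *)
Lemma null_chart x (B : set (borel M)) : measurable B -> B `<=` D x ->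
  mu B = 0%E <-> leb (cimg A x `&` ci x @^-1` B) = 0%E.
Proof.
move=> mB BD; set E := _ `&` _.
have mE : measurable E by exact: measurable_cinv.
have EA : E `<=` cimg A x by move=> t [].
have mr : measurable_fun E (fun t => (rho g x t)%:E) by exact: measurable_rho.
rewrite (volM mB BD) chart_imageE// -/E.
have -> : (\int[leb]_(t in E) (Num.sqrt (bilinear_loc A g x t))%:E =
           \int[leb]_(t in E) `|(rho g x t)%:E|)%E.
  by apply: eq_integral => t tE /=; rewrite ger0_norm ?sqrtr_ge0.
split=> [|E0].
  move/(ae_eq_integral_abs leb mE mr) => H.
  apply/negligibleP => //; apply: negligibleS H => t Et /= H.
  by have := H Et => -[] E0; have := rho_gt0 g (EA _ Et); rewrite E0 ltxx.
by apply: integral_abs_eq0.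
Qed.

Lemma ae_chart (P : M -> Prop) x : {ae mu, forall p : borel M, P p} ->
  {ae leb, forall t, cimg A x t -> P (ci x t)}.
Proof.
move=> [N [mN N0 HN]].
have mB : measurable (N `&` (D x : set (borel M))).
  by apply: measurableI => //; apply: open_borel; exact: cdom_at_open.
have B0 : mu (N `&` (D x : set (borel M))) = 0%E.
  by apply/eqP; rewrite -measure_le0 -N0 le_measure ?inE//; exact: subIset (or_introl (@subset_refl _ _)).
have BD : N `&` (D x : set (borel M)) `<=` D x by move=> ? [].
move/(null_chart mB BD) : B0 => E0.
exists (cimg A x `&` ci x @^-1` (N `&` (D x : set (borel M)))); split => //.
  exact: measurable_cinv.
move=> t /= /not_implyP[xt nP]; split => //=; split; last exact: cinv_dom.
exact: HN.
Qed.

Lemma open_measure_neq0 (U : set M) z x : open U -> U z -> U `<=` D x ->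
  0 < c x z -> mu U <> 0%E.
Proof.
move=> oU Uz UD x0 /(null_chart (open_borel oU) UD) E0.
have xt : cimg A x (c x z) by apply/cimg_cmap/UD.
have [d1 d10 H1] := cimg_near xt.
have [|d2 d20 H2] := cinv_at_near (N := U) xt.
  by rewrite cinv_atK; [exact: open_nbhs_nbhs|exact: UD].
pose d := Num.min d1 d2; have d0 : 0 < d by rewrite lt_min d10.
have sub : `]c x z, c x z + d[%classic `<=` cimg A x `&` ci x @^-1` U.
  move=> t; rewrite /= in_itv/= => /andP[zt td].
  have td' : `|t - c x z| < d by rewrite gtr0_norm ?subr_gt0//; lra.
  move: td'; rewrite lt_min => /andP[td1 td2].
  have xt' : cimg A x t by apply: H1 => //; exact/ltW/(lt_trans x0).
  by split => //=; exact: H2.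
pose I := `]c x z, (c x z + d)%R[%classic : set R.
have : (leb I <= 0)%E.
  rewrite -E0; apply: le_measure => //; rewrite inE.
    exact: measurable_itv.
  exact: (measurable_cinv x (open_borel oU)).
rewrite /I lebesgue_measure_itv/= lte_fin ltrDl d0 -EFinB lee_fin; lra.
Qed.

(** Lindelöf's argument: the basic open sets meeting [E] in a negligible set are countably many and
    cover [E]. *)
Lemma second_countable_negligible (E : set M) : @second_countable M ->
  (forall p : M, exists2 U : set M, nbhs p U & mu.-negligible (U `&` E)) ->
  mu.-negligible E.
Proof.
move=> [B cB [oB bB]] H.
pose B' := [set U | B U /\ mu.-negligible (U `&` E : set (borel M))].
have cB' : countable B' by apply: sub_countable cB; apply: subset_card_le => U [].
have [B0|] := pselect (B' !=set0); last first.
  move=> nB; exists set0; split => // p Ep; exfalso; apply: nB.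
  have [U Up nU] := H p; have [V [BV Vp] VU] := bB p U Up.
  exists V; split => //; apply: negligibleS nU => q [Vq Eq]; split => //; exact: VU.
have /pfcard_geP[B'0|[f]] := cB'; first by rewrite B'0 in B0; case: B0.
have nf n : mu.-negligible (f n `&` E) by case: (@funS _ _ setT B' f n I).
apply: negligibleS (negligible_bigcup nf) => p Ep.
have [U Up nU] := H p; have [V [BV Vp] VU] := bB p U Up.
have B'V : B' V.
  by split => //; apply: negligibleS nU => q [Vq Eq]; split => //; exact: VU.
have [n _ fn] := @surj _ _ setT B' f V B'V; exists n => //; split => //.
by rewrite fn.
Qed.

End Measure.

(** * Fluxes of eigenfunctions *)

Section Pairing.
Context {R : realType}.
Variables (O : set R) (s V : R -> R).
Hypothesis cs : forall t, O t -> {for t, continuous s}.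
Hypothesis s_neq0 : forall t, O t -> s t != 0.
Hypothesis bV : forall t, O t -> exists d C : R, 0 < d /\
  {ae @lebesgue_measure R, forall r, `|r - t| < d -> `|V r| <= C}.
Local Notation sol := (solution O s V).
Implicit Types (t l : R) (u q : R -> R).

(** Each product k q is split into k(t) q and (k - k(t)) q. The first parts combine by
    [solution_cancel]; in the second the factor vanishing at t makes continuity of q sufficient. *)
Lemma solution_pairing t (l1 l2 l3 l4 m1 m2 m3 m4 : R) u1 u2 u3 u4 q1 q2 q3 q4
    (k1 k2 k3 k4 : R -> R) :
  sol l1 u1 q1 -> sol l2 u2 q2 -> sol l3 u3 q3 -> sol l4 u4 q4 -> O t ->
  has_derive k1 t m1 -> has_derive k2 t m2 -> has_derive k3 t m3 -> has_derive k4 t m4 ->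
  k1 t * u1 t + k2 t * u2 t + k3 t * u3 t + k4 t * u4 t = 0 ->
  has_derive (fun r => k1 r * q1 r + k2 r * q2 r + k3 r * q3 r + k4 r * q4 r) t
    (- s t * (k1 t * l1 * u1 t + k2 t * l2 * u2 t + k3 t * l3 * u3 t + k4 t * l4 * u4 t)
     + (m1 * q1 t + m2 * q2 t + m3 * q3 t + m4 * q4 t)).
Proof.
move=> S1 S2 S3 S4 Ot d1 d2 d3 d4 K0.
have H := solution_cancel cs bV S1 S2 S3 S4 Ot K0.
have dk k m q : has_derive k t m -> {for t, continuous q} ->
    has_derive (fun r => (k r - k t) * q r) t (m * q t).
  move=> dk cq; apply: (has_derive_mul_vanishing (f := fun r => k r - k t)) => //.
    by rewrite subrr.
  by rewrite -[m]subr0; apply: has_deriveB => //; exact: has_derive_cst.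
have cq l u q : sol l u q -> {for t, continuous q} by case=> _ cq _ _; exact: cq.
have H1 := dk _ _ _ d1 (cq _ _ _ S1); have H2 := dk _ _ _ d2 (cq _ _ _ S2).
have H3 := dk _ _ _ d3 (cq _ _ _ S3); have H4 := dk _ _ _ d4 (cq _ _ _ S4).
have := has_deriveD H (has_deriveD (has_deriveD (has_deriveD H1 H2) H3) H4).
apply: near_has_derive; near=> r.
ring.
Unshelve. all: by end_near. Qed.

(** With coefficients u and -u', the vanishing condition of the pairing reads u u' - u' u = 0. The
    two idle slots carry the coefficient 0. *)
Lemma wronskian_derive l u q u' q' t : sol l u q -> sol l u' q' -> O t ->
  has_derive (fun r => u r * q' r - u' r * q r) t 0.
Proof.
move=> S S' Ot; have du := solution_derive cs S Ot; have du' := solution_derive cs S' Ot.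
have du'N := has_deriveN du'.
have z : has_derive (fun=> 0 : R) t 0 by exact: has_derive_cst.
have := solution_pairing S' S S S Ot du du'N z z.
move=> /(_ _); move=> H.
have /H {}H : u t * u' t + - u' t * u t + 0 * u t + 0 * u t = 0 by ring.
apply: has_derive_eq; first (apply: near_has_derive H; near=> r; ring).
ring.
Unshelve. all: by end_near. Qed.

Section SharedModulus.
Variables (l1 l2 : R) (a b c d qa qb qc qd : R -> R).
Hypotheses (Sa : sol l1 a qa) (Sb : sol l1 b qb) (Sc : sol l2 c qc) (Sd : sol l2 d qd).
Hypothesis mod_eq : forall t, O t -> a t ^+ 2 + b t ^+ 2 = c t ^+ 2 + d t ^+ 2.

Let oO : open O.
Proof. exact: solution_open Sa. Qed.

Lemma modulus_derive t : O t ->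
  has_derive (fun r => a r ^+ 2 + b r ^+ 2) t (2 * s t * (a t * qa t + b t * qb t)).
Proof.
move=> Ot; have da := solution_derive cs Sa Ot; have db := solution_derive cs Sb Ot.
by apply: has_derive_eq (has_deriveD (has_deriveM da da) (has_deriveM db db)) _; ring.
Qed.

Lemma shared_derivative t : O t -> a t * qa t + b t * qb t = c t * qc t + d t * qd t.
Proof.
move=> Ot; have dc := solution_derive cs Sc Ot; have dd := solution_derive cs Sd Ot.
have H1 := modulus_derive Ot.
have H2 : has_derive (fun r => a r ^+ 2 + b r ^+ 2) t (2 * s t * (c t * qc t + d t * qd t)).
  apply: (@near_has_derive _ (fun r => c r ^+ 2 + d r ^+ 2)).
    by apply: near_open oO Ot _ => r Or; rewrite mod_eq.
  by apply: has_derive_eq (has_deriveD (has_deriveM dc dc) (has_deriveM dd dd)) _; ring.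
have /mulfI E : 2 * s t != 0 by rewrite mulf_neq0// s_neq0.
exact/E/(has_derive_unique H1 H2).
Qed.

(** Second derivative of the vanishing difference of the squared moduli. The potential cancels
    because it multiplies this same difference. *)
Lemma kinetic_difference t : O t ->
  (l1 - l2) * (a t ^+ 2 + b t ^+ 2) = qa t ^+ 2 + qb t ^+ 2 - (qc t ^+ 2 + qd t ^+ 2).
Proof.
move=> Ot.
have da := solution_derive cs Sa Ot; have db := solution_derive cs Sb Ot.
have dc := has_deriveN (solution_derive cs Sc Ot).
have dd := has_deriveN (solution_derive cs Sd Ot).
have := solution_pairing Sa Sb Sc Sd Ot da db dc dd.
have -> : a t * a t + b t * b t + - c t * c t + - d t * d t = 0.
  by have := mod_eq Ot; rewrite !expr2; lra.
move=> /(_ erefl) H.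
have Z : has_derive (fun r => a r * qa r + b r * qb r + - c r * qc r + - d r * qd r) t 0.
  apply: (@near_has_derive _ (fun=> 0)); last exact: has_derive_cst.
  by apply: near_open oO Ot _ => r Or; have := shared_derivative Or; lra.
have := has_derive_unique H Z.
have := mod_eq Ot; rewrite !expr2 => E.
have -> : - s t * (a t * l1 * a t + b t * l1 * b t + - c t * l2 * c t + - d t * l2 * d t)
  + (s t * qa t * qa t + s t * qb t * qb t + - (s t * qc t) * qc t + - (s t * qd t) * qd t)
  = s t * (qa t * qa t + qb t * qb t - (qc t * qc t + qd t * qd t)
           - l1 * (a t * a t + b t * b t) + l2 * (c t * c t + d t * d t)) by ring.
move=> /eqP; rewrite mulf_eq0 (negbTE (s_neq0 Ot))/= -E => /eqP.
lra.
Qed.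

(** Lagrange's identity splits the product of |phi|^2 and |u'|^2 into the squares of the real and
    imaginary parts of conj(phi) u'; the real parts are equal by [shared_derivative]. *)
Lemma flux_difference t : O t ->
  (l1 - l2) * (a t ^+ 2 + b t ^+ 2) ^+ 2 =
  (a t * qb t - b t * qa t) ^+ 2 - (c t * qd t - d t * qc t) ^+ 2.
Proof.
move=> Ot; have E := mod_eq Ot; have S := shared_derivative Ot.
rewrite [X in _ * X]expr2 mulrA kinetic_difference//.
have -> : (a t * qb t - b t * qa t) ^+ 2 =
  (qa t ^+ 2 + qb t ^+ 2) * (a t ^+ 2 + b t ^+ 2) - (a t * qa t + b t * qb t) ^+ 2 by ring.
have -> : (c t * qd t - d t * qc t) ^+ 2 =
  (qc t ^+ 2 + qd t ^+ 2) * (c t ^+ 2 + d t ^+ 2) - (c t * qc t + d t * qd t) ^+ 2 by ring.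
by rewrite S E; ring.
Qed.

End SharedModulus.
End Pairing.

Section ComplexComponents.
Context {R : realType}.
Implicit Types (z w : R[i]) (k : R).

Lemma ReM z w : complex.Re (z * w) =
  complex.Re z * complex.Re w - complex.Im z * complex.Im w.
Proof. by case: z; case: w. Qed.

Lemma ImM z w : complex.Im (z * w) =
  complex.Re z * complex.Im w + complex.Im z * complex.Re w.
Proof. by case: z => a b; case: w => c d /=; rewrite addrC. Qed.

Lemma Re_conjc z : complex.Re (conjc z) = complex.Re z.
Proof. by case: z. Qed.

Lemma Im_conjc z : complex.Im (conjc z) = - complex.Im z.
Proof. by case: z. Qed.

Lemma Re_add z w : complex.Re (z + w) = complex.Re z + complex.Re w.
Proof. by case: z; case: w. Qed.

Lemma Im_add z w : complex.Im (z + w) = complex.Im z + complex.Im w.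
Proof. by case: z; case: w. Qed.

Lemma Re_opp z : complex.Re (- z) = - complex.Re z.
Proof. by case: z. Qed.

Lemma Im_opp z : complex.Im (- z) = - complex.Im z.
Proof. by case: z. Qed.

Definition complexE := (ReM, ImM, Re_conjc, Im_conjc, Re_add, Im_add, Re_opp, Im_opp).

Lemma complex_ext z w : complex.Re z = complex.Re w -> complex.Im z = complex.Im w -> z = w.
Proof. by case: z => a b; case: w => c d /= -> ->. Qed.

Definition normsq z : R := complex.Re z ^+ 2 + complex.Im z ^+ 2.

Lemma normsq_ge0 z : 0 <= normsq z.
Proof. by rewrite addr_ge0// sqr_ge0. Qed.

Lemma normsq_eq0 z : (normsq z == 0) = (z == 0).
Proof.
rewrite /normsq paddr_eq0 ?sqr_ge0// !sqrf_eq0.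
by case: z => a b; rewrite eq_complex.
Qed.

Lemma normcE z : `|z| = (Num.sqrt (normsq z))%:C.
Proof. by case: z. Qed.

Lemma normc_eq z w : `|z| = `|w| -> normsq z = normsq w.
Proof.
rewrite !normcE => -[] E.
by rewrite -[LHS]sqr_sqrtr ?normsq_ge0// E sqr_sqrtr// normsq_ge0.
Qed.

End ComplexComponents.

Section SelfAdjoint.
Context d (T : measurableType d) {R : realType}.
Variable mu : {measure set T -> \bar R}.
Implicit Types (u v w f psi : T -> R[i]) (H : (T -> R[i]) -> (T -> R[i]) -> Prop).

Lemma self_adjoint_symmetric H u w psi f : self_adjoint mu H ->
  H u w -> L2 mu u -> H psi f -> inner mu u f = inner mu w psi.
Proof.
move=> [_ sa] Huw Lu Hpsi.
have [] : adjoint mu H u w; last by move=> _ _; exact.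
by apply/sa; split => //; exists u => //; exact: aeW.
Qed.

Lemma L2_integrable_normsq u : L2 mu u -> mu.-integrable setT (fun p => (normsq (u p))%:E).
Proof.
move=> [[mr mi] fin]; apply/integrableP; split.
  apply/measurable_EFinP; apply: measurable_funD;
  by apply: measurable_funX.
apply: le_lt_trans fin; rewrite le_eqVlt; apply/orP; left; apply/eqP.
by apply: eq_integral => p _ /=; rewrite ger0_norm// normsq_ge0.
Qed.

(** Symmetry on the pair (phi, phi) equates the imaginary part of lam times the squared norm with
    its opposite. *)
Lemma eigenvalue_real H lam phi : self_adjoint mu H -> (forall psi f, H psi f -> L2 mu psi) ->
  eigenfunction mu H lam phi -> complex.Im lam = 0.
Proof.
move=> sa HL [Hphi nz]; have Lphi := HL _ _ Hphi.
have := self_adjoint_symmetric sa Hphi Lphi Hphi.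
rewrite /inner => /(congr1 (@complex.Im R)) /=.
have I := L2_integrable_normsq Lphi.
have -> : \int[mu]_p complex.Im (conjc (phi p) * (lam * phi p)) =
    complex.Im lam * \int[mu]_p normsq (phi p).
  rewrite -RintegralZl//; apply: eq_Rintegral => p _.
  by rewrite !complexE /normsq; ring.
have -> : \int[mu]_p complex.Im (conjc (lam * phi p) * phi p) =
    - complex.Im lam * \int[mu]_p normsq (phi p).
  rewrite -RintegralZl//; apply: eq_Rintegral => p _.
  by rewrite !complexE /normsq; ring.
move=> E; have [//|lam0] := eqVneq (complex.Im lam) 0; exfalso; apply: nz.
have N0 : \int[mu]_p normsq (phi p) = 0.
  apply/eqP; have : complex.Im lam * \int[mu]_p normsq (phi p) *+ 2 == 0.
    by rewrite mulr2n {2}E mulNr subrr.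
  by rewrite mulrn_eq0/= mulf_eq0 (negbTE lam0).
have : (\int[mu]_p `|(normsq (phi p))%:E| = 0)%E.
  have -> : (\int[mu]_p `|(normsq (phi p))%:E| = \int[mu]_p (normsq (phi p))%:E)%E.
    by apply: eq_integral => p _ /=; rewrite ger0_norm// normsq_ge0.
  by rewrite -[LHS]fineK ?[fine _]N0//; exact: integrable_fin_num.
have [mI _] := integrableP _ _ _ I.
move/(ae_eq_integral_abs mu measurableT mI).
apply: ae_mono => p /(_ Logic.I) [] /eqP.
by rewrite normsq_eq0 => /eqP.
Qed.

End SelfAdjoint.

(** * Real and imaginary parts as real solutions *)

Section Modes.
Context {R : realType} {M : ptopologicalType} {A : atlas R M}.
Variable g : riemannian_metric A.
Variable mu : {measure set (borel M) -> \bar R}.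
Hypothesis volM : riemannian_volume g mu.
Variable V : M -> R.
Hypothesis Vloc : Linfty_loc mu V.
Implicit Types (p q x y z : M) (s t l : R) (f df h dh : M -> R).
Local Notation c := (cmap_at A).
Local Notation ci := (cinv_at A).
Local Notation D := (cdom_at A).
Local Notation leb := (@lebesgue_measure R).

Definition loc f x t : R := f (ci x t).

(* g^(-1/2) df in the chart at x. *)
Definition mom df x t : R := df (ci x t) * jac A x (ci x t) / rho g x t.

(** The equation is imposed in the interior of the charts; continuity of [mom] on the whole chart
    image carries first order data to boundary points. *)
Definition mode l f df : Prop :=
  [/\ continuous f, forall x, {within cimg A x, continuous (mom df x)} &
      forall x, solution (cint A x) (rho g x) (loc V x) l (loc f x) (mom df x)].

Lemma eq_weak_deriv O (u v u' v' : R -> R) : (forall t, O t -> u t = u' t) ->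
  (forall t, O t -> v t = v' t) -> weak_deriv O u v -> weak_deriv O u' v'.
Proof.
move=> uE vE [[mu_ oO iu] [mv _ iv] w].
have loc_eq (a b : R -> R) : (forall t, O t -> a t = b t) -> measurable_fun O a ->
    (forall K, K `<=` O -> compact K -> (\int[leb]_(t in K) `|a t|%:E < +oo)%E) ->
    locally_integrable O b.
  move=> ab ma ia; split => //.
    by apply: eq_measurable_fun ma => t /set_mem; exact: ab.
  move=> K KO cK; have := ia K KO cK; congr (_ < _)%E.
  by apply: eq_integral => t /set_mem/KO Ot; rewrite ab.
split; [exact: loc_eq uE mu_ iu|exact: loc_eq vE mv iv|].
move=> eta test; have := w _ test.
have -> : \int[leb]_(t in O) (u t * derive1 eta t) = \int[leb]_(t in O) (u' t * derive1 eta t).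
  by apply: eq_Rintegral => t /set_mem Ot; rewrite uE.
have -> // : \int[leb]_(t in O) (v t * eta t) = \int[leb]_(t in O) (v' t * eta t).
by apply: eq_Rintegral => t /set_mem Ot; rewrite vE.
Qed.

Lemma within_div (E : set R) (f h : R -> R) : {within E, continuous f} ->
  {within E, continuous h} -> (forall t, E t -> h t != 0) ->
  {within E, continuous (fun t => f t / h t)}.
Proof.
move=> /subspace_continuousP cf /subspace_continuousP ch h0.
apply/subspace_continuousP => t Et; apply: cvgM; first exact: cf.
by apply: cvgV; [exact: h0|exact: ch].
Qed.

Lemma loc_within f x : continuous f -> {within cimg A x, continuous (loc f x)}.
Proof.
move=> cf; apply/within_continuousP => t xt e e0.
have /cvgr_dist_lt/(_ _ e0) := cf (ci x t).
move=> /(cinv_at_near xt)[d d0 Hd]; exists d => // s xs st.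
by rewrite distrC; exact: Hd.
Qed.

Lemma loc_continuous f x t : continuous f -> cint A x t -> {for t, continuous (loc f x)}.
Proof.
move=> cf xt; apply: (within_continuous_near (loc_within (x := x) cf) (@cint_open _ _ A x)) => //.
exact: cint_cimg.
Qed.

Lemma mom_continuous df x t : {within cimg A x, continuous (mom df x)} ->
  cint A x t -> {for t, continuous (mom df x)}.
Proof.
move=> cf xt; apply: (within_continuous_near cf (@cint_open _ _ A x)) => //.
exact: cint_cimg.
Qed.

Lemma potential_bounded x t : cimg A x t -> exists d C : R, 0 < d /\
  {ae leb, forall r, 0 <= r -> `|r - t| < d -> `|loc V x r| <= C}.
Proof.
move=> xt; have [d d0 Hd] := cimg_near xt.
have t0 := cimg_ge0 xt.
pose a := Num.max 0 (t - d / 2); pose b := t + d / 2.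
have sub : `[a, b] `<=` cimg A x.
  move=> r; rewrite /= in_itv/= ge_max => /andP[/andP[r0 ar] rb]; apply: Hd => //.
  by rewrite ltr_norml; apply/andP; split; move: ar rb; rewrite /b; lra.
have cK : compact (ci x @` `[a, b]).
  apply: continuous_compact; last exact: segment_compact.
  apply: continuous_subspaceW sub _; exact: cinv_continuous.
have [_ /(_ _ cK)[C HC]] := Vloc.
exists (d / 2), C; split; first by rewrite divr_gt0.
apply: ae_mono (ae_chart volM x HC) => r Hr r0; rewrite ltr_norml => /andP[h1 h2].
have rab : `[a, b]%classic r.
  by rewrite /= in_itv/= ge_max r0 /b; apply/andP; split; lra.
by apply: Hr; [exact: sub|exists r].
Qed.

Lemma potential_bounded_interior x t : cint A x t -> exists d C : R, 0 < d /\
  {ae leb, forall r, `|r - t| < d -> `|loc V x r| <= C}.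
Proof.
move=> [xt /= t0]; have [d [C [d0 H]]] := potential_bounded xt.
exists (Num.min d t), C; split; first by rewrite lt_min d0.
apply: ae_mono H => r Hr; rewrite lt_min => /andP[rd rt].
by apply: Hr => //; move: rt; rewrite ltr_norml => /andP[]; lra.
Qed.

Lemma rho_neq0 x t : cint A x t -> rho g x t != 0.
Proof. by move=> /cint_cimg/(rho_gt0 g)/lt0r_neq0. Qed.

Lemma rho_mom df x t : cimg A x t -> rho g x t * mom df x t = df (ci x t) * jac A x (ci x t).
Proof. by move=> xt; rewrite /mom mulrC divfK// gt_eqF// rho_gt0. Qed.

Lemma weak_modes l f df lap_ : continuous f ->
  (forall x, {within cimg A x, continuous (fun t => df (ci x t) * jac A x (ci x t))}) ->
  (forall x, weak_deriv (cint A x) (loc f x) (fun t => df (ci x t) * jac A x (ci x t))) ->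
  (forall x, weak_deriv (cint A x) (fun t => (rho g x t)^-1 * (df (ci x t) * jac A x (ci x t)))
     (fun t => rho g x t * loc lap_ x t)) ->
  {ae mu, forall p : borel M, lap_ p = (V p - l) * f p} ->
  mode l f df.
Proof.
move=> cf cdf wf wdf lapE.
have cm x : {within cimg A x, continuous (mom df x)}.
  by apply: within_div => //; [exact: rho_within|move=> t /(rho_gt0 g)/lt0r_neq0].
split => // x; split.
- by move=> t xt; exact: loc_continuous.
- by move=> t xt; exact: mom_continuous.
- apply: eq_weak_deriv (wf x) => // t /cint_cimg xt.
  by rewrite rho_mom.
- exists (fun t => rho g x t * loc lap_ x t).
    by apply: eq_weak_deriv (wdf x) => // t xt; rewrite /mom mulrC.
  apply: ae_mono (ae_chart volM x lapE) => t Ht /cint_cimg/Ht.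
  by rewrite /loc => ->; rewrite mulrA.
Qed.

(** The potential and the eigenvalue are real, so the two components solve the equation
    separately. *)
Lemma H2_modes l phi dphi lap : H2 g mu phi dphi lap ->
  ae_equal mu (fun p => l%:C * phi p) (fun p => - lap p + (V p)%:C * phi p) ->
  mode l (fun p => complex.Re (phi p)) (fun p => complex.Re (dphi p)) /\
  mode l (fun p => complex.Im (phi p)) (fun p => complex.Im (dphi p)).
Proof.
move=> [[[cr ci_] cd] wg wl _] E.
have Ere : {ae mu, forall p : borel M, complex.Re (lap p) = (V p - l) * complex.Re (phi p)}.
  apply: ae_mono E => p /(congr1 (@complex.Re R)); rewrite !complexE /=; lra.
have Eim : {ae mu, forall p : borel M, complex.Im (lap p) = (V p - l) * complex.Im (phi p)}.
  apply: ae_mono E => p /(congr1 (@complex.Im R)); rewrite !complexE /=; lra.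
have re1 (a : R[i]) (k : R) : complex.Re (a * k%:C) = complex.Re a * k by rewrite !complexE /=; ring.
have im1 (a : R[i]) (k : R) : complex.Im (a * k%:C) = complex.Im a * k by rewrite !complexE /=; ring.
have re2 (a : R[i]) (k : R) : complex.Re (k%:C * a) = k * complex.Re a by rewrite !complexE /=; ring.
have im2 (a : R[i]) (k : R) : complex.Im (k%:C * a) = k * complex.Im a by rewrite !complexE /=; ring.
split.
- apply: (weak_modes (lap_ := fun p => complex.Re (lap p))) => // x.
  + have [H _] := cd x; move: H; rewrite /covector_loc.
    by under eq_fun do rewrite re1.
  + have [H _] := wg x; move: H; rewrite /fun_loc /covector_loc.
    by under [X in weak_deriv _ _ X -> _]eq_fun do rewrite re1.
  + have [H _] := wl x; move: H; rewrite /fun_loc /covector_loc.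
    under eq_fun do rewrite re2 re1.
    by under [X in weak_deriv _ _ X -> _]eq_fun do rewrite re2.
- apply: (weak_modes (lap_ := fun p => complex.Im (lap p))) => // x.
  + have [_ H] := cd x; move: H; rewrite /covector_loc.
    by under eq_fun do rewrite im1.
  + have [_ H] := wg x; move: H; rewrite /fun_loc /covector_loc.
    by under [X in weak_deriv _ _ X -> _]eq_fun do rewrite im1.
  + have [_ H] := wl x; move: H; rewrite /fun_loc /covector_loc.
    under eq_fun do rewrite im2 im1.
    by under [X in weak_deriv _ _ X -> _]eq_fun do rewrite im2.
Qed.

End Modes.

(** * Constancy of the flux, unique continuation, and the potential *)

Section ModeTheory.
Context {R : realType} {M : ptopologicalType} {A : atlas R M}.
Variable g : riemannian_metric A.
Variable mu : {measure set (borel M) -> \bar R}.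
Hypothesis volM : riemannian_volume g mu.
Variable V : M -> R.
Hypothesis Vloc : Linfty_loc mu V.
Hypothesis connM : connected [set: M].
Implicit Types (p q x y z : M) (s t l : R) (f df h dh : M -> R).
Local Notation c := (cmap_at A).
Local Notation ci := (cinv_at A).
Local Notation D := (cdom_at A).
Local Notation leb := (@lebesgue_measure R).
Local Notation mode := (mode g V).
Local Notation mom := (mom g).
Local Notation loc := (@loc R M A).

Let cs x := @rho_continuous _ _ _ g x.
Let sN0 x := @rho_neq0 _ _ _ g x.
Let bV x := @potential_bounded_interior _ _ _ _ _ volM _ Vloc x.

Lemma loc_cmap f x z : D x z -> loc f x (c x z) = f z.
Proof. by move=> Dx; rewrite /loc cinv_atK. Qed.

(** Dividing by [rho] leaves only the sign of the Jacobian: a derivative with respect to arc length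
    depends on the chart through its orientation alone. *)
Lemma mom_cmap df x z : D x z ->
  mom df x (c x z) = df z / Num.sqrt (g z) * Num.sg (jac A x z).
Proof.
move=> Dx; rewrite /mom cinv_atK// rho_cmap// invfM -!mulrA; congr (_ * _).
rewrite mulrCA; congr (_ * _).
by rewrite {1}[jac A x z]numEsg -mulrA divff ?mulr1// normr_eq0 jac_neq0.
Qed.

Lemma sqrt_metric_gt0 z : 0 < Num.sqrt (g z).
Proof. by rewrite sqrtr_gt0 metric_gt0. Qed.

Lemma sqr_sg_jac x z : D x z -> Num.sg (jac A x z) ^+ 2 = 1.
Proof. by move=> Dx; rewrite sqr_sg jac_neq0. Qed.

Definition flux f df h dh z : R := (f z * dh z - h z * df z) / Num.sqrt (g z).

Lemma flux_cmap f df h dh x z : D x z ->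
  loc f x (c x z) * mom dh x (c x z) - loc h x (c x z) * mom df x (c x z) =
  flux f df h dh z * Num.sg (jac A x z).
Proof. by move=> Dx; rewrite !mom_cmap// !loc_cmap// /flux; ring. Qed.

(** The left end is cut at 0, so the interval is one-sided at a boundary point while its interior
    stays inside the chart. *)
Lemma chart_interval p (e : R) : 0 < e -> exists a b : R,
  [/\ a < b, b - a <= e, a <= c p p <= b, 0 <= a &
  [/\ forall t, a <= t <= b -> cimg A p t, forall t, a < t < b -> cint A p t &
      nbhs p [set z | D p z /\ a <= c p z <= b]]].
Proof.
move=> e0; have Dp := cdom_at_self A p; have xt := cimg_cmap Dp.
have [d d0 Hd] := cimg_near xt; have t0 := cimg_ge0 xt.
pose k := Num.min d e / 2.
have k0 : 0 < k by rewrite divr_gt0// lt_min d0.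
have kd : k < d.
  have : Num.min d e <= d by rewrite ge_min lexx.
  by rewrite /k; lra.
have ke : k <= e / 2 by rewrite /k ler_pM2r ?invr_gt0// ge_min lexx orbT.
pose a := Num.max 0 (c p p - k); pose b := c p p + k.
have a0 : 0 <= a by rewrite /a le_max lexx.
have ak : c p p - k <= a by rewrite /a le_max lexx orbT.
have at0 : a <= c p p by rewrite /a ge_max t0; lra.
have cab t : a <= t <= b -> cimg A p t.
  move=> /andP[at_ tb]; apply: Hd; first exact: le_trans at_.
  by rewrite ltr_norml; apply/andP; split; move: tb; rewrite /b; lra.
exists a, b; split.
- by rewrite /b; lra.
- by rewrite /b; lra.
- by rewrite at0 /b /=; lra.
- exact: a0.
split => //.
  move=> t /andP[at_ tb]; split; last exact: le_lt_trans at_.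
  by apply: cab; rewrite !ltW.
have := cmap_at_near Dp (near_dist (c p p) k0).
apply: filterS => z [Dz]; rewrite ltr_norml => /andP[h1 h2]; split => //.
by rewrite /a /b ge_max (cimg_ge0 (cimg_cmap Dz))/=; apply/andP; split; lra.
Qed.

(** In one chart the Wronskian [W] is constant, up to the boundary by continuity. It equals the flux
    up to the sign of the Jacobian, so only absolute values can be compared from chart to chart. *)
Lemma flux_abs_constant l f df h dh p q : mode l f df -> mode l h dh ->
  `|flux f df h dh p| = `|flux f df h dh q|.
Proof.
move=> [cf cdf sf] [ch cdh sh].
apply: (connected_locally_constant (P := fun z => `|flux f df h dh p| = `|flux f df h dh z|) connM) (p) _ _ => //.
move=> x; have [a [b [ab _ _ a0 [cab ccab nN]]]] := chart_interval x (@ltr01 R).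
exists [set z | D x z /\ a <= c x z <= b] => // z z' [Dz az] [Dz' az'] ->.
pose W t := loc f x t * mom dh x t - loc h x t * mom df x t.
have WE y : D x y -> `|W (c x y)| = `|flux f df h dh y|.
  by move=> Dy; rewrite /W flux_cmap// normrM normr_sg jac_neq0// mulr1.
have sub : `[a, b] `<=` cimg A x by move=> t; rewrite /= in_itv/=; exact: cab.
have cW : {within `[a, b], continuous W}.
  have wM (u v : R -> R) : {within cimg A x, continuous u} -> {within cimg A x, continuous v} ->
      {within cimg A x, continuous (fun t => u t * v t)}.
    by move=> cu cv t; apply: continuousM; [exact: cu|exact: cv].
  have wB (u v : R -> R) : {within cimg A x, continuous u} -> {within cimg A x, continuous v} ->
      {within cimg A x, continuous (fun t => u t - v t)}.
    by move=> cu cv t; apply: continuousB; [exact: cu|exact: cv].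
  apply: (continuous_subspaceW sub).
  have c1 := wM _ _ (loc_within (x := x) cf) (cdh x).
  have c2 := wM _ _ (loc_within (x := x) ch) (cdf x).
  exact: wB c1 c2.
have dW t : a < t < b -> has_derive W t 0.
  by move=> /ccab xt; exact: (wronskian_derive (@cs x) (@bV x) (sf x) (sh x) xt).
have Wc t t' : a <= t -> t <= t' -> t' <= b -> W t = W t'.
  move=> at_ tt' t'b.
  have d' r : t < r < t' -> has_derive W r 0.
    by move=> /andP[h1 h2]; apply: dW; rewrite (le_lt_trans at_ h1) (lt_le_trans h2 t'b).
  have cW' : {within `[t, t'], continuous W}.
    by apply: continuous_subspaceW cW; apply: subset_itv; rewrite bnd_simp.
  by have [r _] := mean_value tt' d' cW'; rewrite mul0r => /eqP; rewrite subr_eq0 => /eqP.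
rewrite -!WE//; congr `|_|; move/andP : az => [h1 h2]; move/andP : az' => [h3 h4].
by have [le|/ltW le] := leP (c x z) (c x z'); [exact: Wc|symmetry; exact: Wc].
Qed.

Lemma unique_continuation l f df p : mode l f df -> f p = 0 -> df p = 0 ->
  forall q, f q = 0 /\ df q = 0.
Proof.
move=> [cf cdf sf] fp dfp q.
apply: (connected_locally_constant (P := fun z => f z = 0 /\ df z = 0) connM) (p) _ _ => //.
move=> {p fp dfp} x; have xt := cimg_cmap (cdom_at_self A x).
have /within_continuousP/(_ _ xt _ ltr01)[d1 d10 H1] := @rho_within _ _ _ g x.
have [d2 [C [d20 H2]]] := potential_bounded volM Vloc xt.
(* Bounds near x of the two coefficients of the first order system. *)
pose S := rho g x (c x x) + 1; pose K := S * (`|C| + `|l|).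
have S0 : 0 < S by rewrite /S ltr_wpDl// sqrtr_ge0.
have K0 : 0 <= K by rewrite /K mulr_ge0 ?(ltW S0) ?addr_ge0.
have SK0 : 0 <= S * K by rewrite mulr_ge0// ltW.
(* The last bound gives both e <= 1 and S K e < 1, hence S K e^2 < 1. *)
pose e := Num.min (Num.min (d1 / 2) (d2 / 2)) (S * K + 1)^-1.
have e0 : 0 < e by rewrite !lt_min !divr_gt0//= invr_gt0 ltr_wpDl.
have [ed1 ed2 eSK] : [/\ e < d1, e < d2 & e <= (S * K + 1)^-1].
  have : e <= d1 / 2 /\ e <= d2 / 2 /\ e <= (S * K + 1)^-1.
    by rewrite /e !ge_min !lexx ?orbT.
  by move=> [h1 [h2 h3]]; split => //; lra.
have [a [b [ab bae /andP[at0 t0b] a0 [cab ccab nN]]]] := chart_interval x e0.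
exists [set z | D x z /\ a <= c x z <= b] => // z z' [Dz az] [Dz' az'] [fz dfz].
have near_t t : a <= t <= b -> `|t - c x x| <= e.
  by move=> /andP[? ?]; rewrite ler_norml; apply/andP; split; lra.
have sub : `[a, b] `<=` cimg A x by move=> t; rewrite /= in_itv/=; exact: cab.
have z0 : loc f x (c x z) = 0 by rewrite loc_cmap.
have dz0 : mom df x (c x z) = 0 by rewrite mom_cmap// dfz !mul0r.
have uc : forall t, a <= t <= b -> loc f x t = 0 /\ mom df x t = 0.
  apply: (solution_unique_continuation (S := S) (K := K) (sf x) ab) z0 dz0 => //.
  - by apply: (continuous_subspaceW sub); exact: loc_within.
  - exact: (continuous_subspaceW sub).
  - move=> t /andP[at_ tb]; have tab : a <= t <= b by rewrite !ltW.
    have := H1 t (cab _ tab) (le_lt_trans (near_t _ tab) ed1).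
    rewrite ltr_norml => /andP[_ ?]; rewrite ger0_norm ?sqrtr_ge0// /S; lra.
  - apply: ae_mono H2 => t Ht /andP[at_ tb]; have tab : a <= t <= b by rewrite !ltW.
    have tC := Ht (le_trans a0 (ltW at_)) (le_lt_trans (near_t _ tab) ed2).
    have := H1 t (cab _ tab) (le_lt_trans (near_t _ tab) ed1).
    rewrite ltr_norml => /andP[_ ?]; rewrite normrM ler_pM//.
      by rewrite ger0_norm ?sqrtr_ge0// /S; lra.
    apply: (le_trans (ler_normB _ _)); rewrite lerD2r.
    exact: (le_trans tC (ler_norm C)).
  - have : S * K * (b - a) ^+ 2 <= S * K * e ^+ 2.
      by apply: ler_wpM2l => //; rewrite lerXn2r ?nnegrE; lra.
    have e1 : e <= 1 by apply: (le_trans eSK); rewrite invf_le1 ?lerDr// ltr_wpDl.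
    have : S * K * e ^+ 2 <= S * K * e by apply: ler_wpM2l => //; rewrite expr2 ler_piMr// ltW.
    have : S * K * e < 1.
      apply: (@le_lt_trans _ _ (S * K * (S * K + 1)^-1)); first exact: ler_wpM2l.
      by rewrite ltr_pdivrMr ?mul1r ?ltrDl// ltr_wpDl.
    lra.
  - exact: ltW S0.
have [f0 m0] := uc _ az'; split; first by rewrite -(loc_cmap f Dz').
have : df z' / Num.sqrt (g z') * Num.sg (jac A x z') = 0 by rewrite -mom_cmap.
move=> /eqP; rewrite !mulf_eq0 sgr_eq0 (negbTE (jac_neq0 Dz')) orbF invr_eq0.
by rewrite (gt_eqF (sqrt_metric_gt0 z')) orbF => /eqP.
Qed.

Lemma continuous_comb (T : topologicalType) (u v : T -> R) (k k' : R) :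
  continuous u -> continuous v -> continuous (fun w => k * u w + k' * v w).
Proof.
move=> cu cv w; apply: (@cvgD _ _ _ _ _ (fun w => k * u w) (fun w => k' * v w)).
  by apply: cvgM; [exact: cvg_cst|exact: cu].
by apply: cvgM; [exact: cvg_cst|exact: cv].
Qed.

Lemma mode_comb l f df h dh (k k' : R) : mode l f df -> mode l h dh ->
  mode l (fun z => k * f z + k' * h z) (fun z => k * df z + k' * dh z).
Proof.
move=> [cf cdf sf] [ch cdh sh].
have momE x : mom (fun z => k * df z + k' * dh z) x = fun t => k * mom df x t + k' * mom dh x t.
  by apply/funext => t; rewrite /mom; ring.
split.
- exact: continuous_comb.
- by move=> x; rewrite momE; apply: continuous_comb; [exact: cdf|exact: cdh].
- by move=> x; rewrite momE; exact: solution_comb.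
Qed.

Lemma interior_dense p (N : set M) : nbhs p N -> exists2 q, N q & D p q /\ cint A p (c p q).
Proof.
move=> Np; have Dp := cdom_at_self A p; have xt := cimg_cmap Dp.
have [d d0 Hd] := cimg_near xt.
have [|d' d'0 Hd'] := cinv_at_near (N := N) xt; first by rewrite cinv_atK.
pose e := Num.min d d' / 2; have e0 : 0 < e by rewrite divr_gt0// lt_min d0.
have [ed ed'] : e < d /\ e < d'.
  have : Num.min d d' <= d /\ Num.min d d' <= d' by rewrite !ge_min !lexx orbT.
  by rewrite /e => -[]; lra.
have t0 := cimg_ge0 xt.
have E : `|c p p + e - c p p| = e by rewrite addrC addKr gtr0_norm.
have xe : cimg A p (c p p + e) by apply: Hd; rewrite ?E//; lra.
exists (ci p (c p p + e)); first by apply: Hd' => //; rewrite E.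
split; first exact: cinv_dom.
by rewrite cmap_atK//; split => //=; lra.
Qed.

Section TwoEigenfunctions.
Variables (l1 l2 : R) (a da b db e de h dh : M -> R).
Hypotheses (ma : mode l1 a da) (mb : mode l1 b db).
Hypotheses (me : mode l2 e de) (mh : mode l2 h dh).
Hypothesis mod_eq : forall z, a z ^+ 2 + b z ^+ 2 = e z ^+ 2 + h z ^+ 2.

Lemma flux_difference_at x z : D x z -> 0 < c x z ->
  (l1 - l2) * (a z ^+ 2 + b z ^+ 2) ^+ 2 =
  flux a da b db z ^+ 2 - flux e de h dh z ^+ 2.
Proof.
move=> Dx x0; have xt : cint A x (c x z) by split => //; exact: cimg_cmap.
have mE t : cint A x t -> loc a x t ^+ 2 + loc b x t ^+ 2 = loc e x t ^+ 2 + loc h x t ^+ 2.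
  by move=> _; exact: mod_eq.
case: ma => _ _ /(_ x) sa; case: mb => _ _ /(_ x) sb.
case: me => _ _ /(_ x) se; case: mh => _ _ /(_ x) sh.
have := flux_difference (@cs x) (@sN0 x) (@bV x) sa sb se sh mE xt.
by rewrite !flux_cmap// !loc_cmap// !exprMn sqr_sg_jac// !mulr1.
Qed.

(* Without flux, both functions are constant multiples of the same real
   function, and they agree to first order at any point where they do not
   vanish. *)
Lemma no_flux_proportional p : 0 < a p ^+ 2 + b p ^+ 2 ->
  (forall z, flux a da b db z = 0) -> (forall z, flux e de h dh z = 0) ->
  exists k k' : R, forall z, e z = k * a z - k' * b z /\ h z = k * b z + k' * a z.
Proof.
move=> p0 F1 F2.
have crho : {for p, continuous (fun z => a z ^+ 2 + b z ^+ 2)}.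
  case: ma => ca _ _; case: mb => cb _ _.
  by apply: continuousD; apply: continuousM; [exact: ca|exact: ca|exact: cb|exact: cb].
have [q q0 [Dq xq]] := interior_dense (cvgr_gt _ crho _ p0).
have [_ x0] := xq.
have l12 : l1 = l2.
  have := flux_difference_at Dq x0; rewrite F1 F2 subrr => /eqP.
  by rewrite mulf_eq0 sqrf_eq0 (gt_eqF q0) orbF subr_eq0 => /eqP.
have := ma => -[_ _ /(_ p) sa]; have := mb => -[_ _ /(_ p) sb].
have := me => -[_ _ /(_ p) se]; have := mh => -[_ _ /(_ p) sh].
have mE t : cint A p t -> loc a p t ^+ 2 + loc b p t ^+ 2 = loc e p t ^+ 2 + loc h p t ^+ 2.
  by move=> _; exact: mod_eq.
have S := shared_derivative (@cs p) (@sN0 p) sa sb se sh mE xq.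
have W1 := flux_cmap a da b db Dq; rewrite F1 mul0r in W1.
have W2 := flux_cmap e de h dh Dq; rewrite F2 mul0r in W2.
have := mod_eq q; move: S W1 W2; rewrite !loc_cmap//.
have momE df := mom_cmap df Dq.
set qa := mom da p _; set qb := mom db p _; set qe := mom de p _; set qh := mom dh p _.
set N := a q ^+ 2 + b q ^+ 2 in q0 *.
move=> S W1 W2 NE; have N0 : N != 0 by rewrite gt_eqF.
(* The real part of conj(phi) u' at q, common to both eigenfunctions. Without flux it determines u'
   = (Dk / N) phi for each of them. *)
pose Dk := a q * qa + b q * qb.
have Ea : N * qa = Dk * a q.
  have -> : N * qa = Dk * a q - b q * (a q * qb - b q * qa) by rewrite /N /Dk; ring.
  by rewrite W1 mulr0 subr0.
have Eb : N * qb = Dk * b q.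
  have -> : N * qb = Dk * b q + a q * (a q * qb - b q * qa) by rewrite /N /Dk; ring.
  by rewrite W1 mulr0 addr0.
have Ee : N * qe = Dk * e q.
  have -> : N * qe = Dk * e q - h q * (e q * qh - h q * qe) by rewrite NE /Dk S; ring.
  by rewrite W2 mulr0 subr0.
have Eh : N * qh = Dk * h q.
  have -> : N * qh = Dk * h q + e q * (e q * qh - h q * qe) by rewrite NE /Dk S; ring.
  by rewrite W2 mulr0 addr0.
(* k + i k' is the quotient (e + i h) / (a + i b) at q. *)
pose k := (e q * a q + h q * b q) / N; pose k' := (h q * a q - e q * b q) / N.
have kN : N * k = e q * a q + h q * b q by rewrite /k mulrC divfK.
have k'N : N * k' = h q * a q - e q * b q by rewrite /k' mulrC divfK.
have zero df : N * mom df p (c p q) = 0 -> df q = 0.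
  rewrite momE => /eqP; rewrite mulf_eq0 (negbTE N0)/= !mulf_eq0 sgr_eq0 (negbTE (jac_neq0 Dq)) orbF.
  by rewrite invr_eq0 (gt_eqF (sqrt_metric_gt0 q)) orbF => /eqP.
have momD (f1 f2 f3 : M -> R) (k1 k2 : R) :
    mom (fun z => 1 * f1 z + 1 * (k1 * f2 z + k2 * f3 z)) p (c p q) =
    mom f1 p (c p q) + (k1 * mom f2 p (c p q) + k2 * mom f3 p (c p q)).
  by rewrite /mom; ring.
have me' : mode l1 e de by rewrite l12.
have mh' : mode l1 h dh by rewrite l12.
(* Real and imaginary parts of (e + i h) - (k + i k') (a + i b), to be shown zero to first order at
   q. *)
have m1 := mode_comb 1 1 me' (mode_comb (- k) k' ma mb).
have m2 := mode_comb 1 1 mh' (mode_comb (- k) (- k') mb ma).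
exists k, k' => z.
have [z1 _] : (1 * e z + 1 * (- k * a z + k' * b z) = 0) /\
    (1 * de z + 1 * (- k * da z + k' * db z) = 0).
  apply: (unique_continuation m1 (p := q)).
    apply: (mulfI N0); rewrite mulr0.
    have -> : N * (1 * e q + 1 * (- k * a q + k' * b q)) =
      N * e q - (N * k) * a q + (N * k') * b q by ring.
    by rewrite kN k'N /N; ring.
  apply: (zero (fun z => 1 * de z + 1 * (- k * da z + k' * db z))); rewrite momD -/qe -/qa -/qb.
  apply: (mulfI N0); rewrite mulr0.
  have -> : N * (N * (qe + (- k * qa + k' * qb))) =
    N * (N * qe) - (N * k) * (N * qa) + (N * k') * (N * qb) by ring.
  by rewrite kN k'N Ea Eb Ee /N; ring.
have [z2 _] : (1 * h z + 1 * (- k * b z + - k' * a z) = 0) /\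
    (1 * dh z + 1 * (- k * db z + - k' * da z) = 0).
  apply: (unique_continuation m2 (p := q)).
    apply: (mulfI N0); rewrite mulr0.
    have -> : N * (1 * h q + 1 * (- k * b q + - k' * a q)) =
      N * h q - (N * k) * b q - (N * k') * a q by ring.
    by rewrite kN k'N /N; ring.
  apply: (zero (fun z => 1 * dh z + 1 * (- k * db z + - k' * da z))); rewrite momD -/qh -/qa -/qb.
  apply: (mulfI N0); rewrite mulr0.
  have -> : N * (N * (qh + (- k * qb + - k' * qa))) =
    N * (N * qh) - (N * k) * (N * qb) - (N * k') * (N * qa) by ring.
  by rewrite kN k'N Ea Eb Eh /N; ring.
by split; [move: z1|move: z2]; lra.
Qed.

Section ConstantPotential.
Hypothesis scM : @second_countable M.
Hypothesis no_boundary : forall x z, D x z -> 0 < c x z.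
Hypothesis l12 : l1 != l2.
Hypothesis nowhere_zero : forall z, 0 < a z ^+ 2 + b z ^+ 2.

(** The fourth power of the modulus is, up to the nonzero factor l1 - l2, a difference of squares of
    fluxes, each of constant absolute value. *)
Lemma modulus_constant p z : a z ^+ 2 + b z ^+ 2 = a p ^+ 2 + b p ^+ 2.
Proof.
have E y := flux_difference_at (cdom_at_self A y) (no_boundary (cdom_at_self A y)).
have N2 : (a z ^+ 2 + b z ^+ 2) ^+ 2 = (a p ^+ 2 + b p ^+ 2) ^+ 2.
  apply: (@mulfI _ (l1 - l2)); first by rewrite subr_eq0.
  rewrite !E -(real_normK (num_real (flux a da b db z))) -(real_normK (num_real (flux e de h dh z))).
  rewrite (flux_abs_constant z p ma mb) (flux_abs_constant z p me mh).
  by rewrite !real_normK ?num_real.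
by apply/eqP; rewrite -(eqrXn2 (n := 2) _ (ltW (nowhere_zero z)) (ltW (nowhere_zero p)))// N2.
Qed.

(* On |phi|^2 = r the pair (a, b) rotates at rate w / r, so that its second
   derivatives are -(w / r)^2 (a, b). *)
Lemma potential_constant : exists C, {ae mu, forall z : borel M, V z = C}.
Proof.
have mV := Vloc.1.
pose p0 : M := point; pose r := a p0 ^+ 2 + b p0 ^+ 2.
pose w := flux a da b db p0; pose k := w ^+ 2 / r ^+ 2.
have r0 : r != 0 by rewrite gt_eqF//; exact: nowhere_zero.
exists (l1 - k); pose E := [set z : borel M | V z != l1 - k].
have mE : measurable E.
  have -> : E = [set: borel M] `&` V @^-1` (~` [set l1 - k]).
    by apply/seteqP; split => z /=; [move=> /eqP|move=> [_ /eqP]].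
  by apply: mV => //; exact: measurableC.
suff : mu.-negligible E.
  by apply: negligibleS => z /= nV; apply/eqP => Vz; exact: nV.
apply: second_countable_negligible => // p.
have Dp := cdom_at_self A p; have xt : cint A p (c p p) by split; [exact: cimg_cmap|exact: no_boundary].
have [d d0 Hd] := open_contains_interval (@cint_open _ _ A p) xt.
pose al := c p p - d / 2; pose be := c p p + d / 2.
have abO : `[al, be] `<=` cint A p.
  move=> t; rewrite /= in_itv/= => /andP[h1 h2]; apply: Hd.
  by move: h1 h2; rewrite /al /be ltr_norml => h1 h2; apply/andP; split; lra.
have := ma => -[_ _ /(_ p) sa]; have := mb => -[_ _ /(_ p) sb].
pose u := loc a p; pose v := loc b p; pose qa := mom da p; pose qb := mom db p.
have rE t : u t ^+ 2 + v t ^+ 2 = r by exact: modulus_constant.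
have s0 t : cint A p t -> rho g p t != 0 by exact: sN0.
have K0 t : cint A p t -> u t * qa t + v t * qb t = 0.
  move=> pt; have H1 := modulus_derive (@cs p) sa sb pt.
  have H2 : has_derive (fun t => u t ^+ 2 + v t ^+ 2) t 0.
    by rewrite (_ : (fun _ => _) = fun=> r); [exact: has_derive_cst|apply/funext => t'; exact: rE].
  have /eqP := has_derive_unique H1 H2.
  by rewrite !mulf_eq0 (negbTE (s0 _ pt)) pnatr_eq0 orbF/= => /eqP.
pose W t := u t * qb t - v t * qa t.
have W2 t : cint A p t -> W t ^+ 2 = w ^+ 2.
  move=> pt; have Dt := cinv_dom (cint_cimg pt); have tE := cmap_atK (cint_cimg pt).
  have := flux_cmap a da b db Dt; rewrite tE => H.
  rewrite /W H exprMn sqr_sg_jac// mulr1.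
  by rewrite -(real_normK (num_real _)) (flux_abs_constant _ p0 ma mb) real_normK// num_real.
have dW t : cint A p t -> has_derive W t 0.
  by move=> pt; exact: (wronskian_derive (@cs p) (@bV p) sa sb pt).
have qaE t : cint A p t -> qa t = - r^-1 * W t * v t.
  move=> pt; apply: (mulfI r0); rewrite -mulrA mulNr mulrN mulVKf//.
  by rewrite -(rE t) /W -[LHS]subr0 -[X in _ - X](mulr0 (u t)) -(K0 t pt); ring.
have qbE t : cint A p t -> qb t = r^-1 * W t * u t.
  move=> pt; apply: (mulfI r0); rewrite -mulrA mulVKf//.
  by rewrite -(rE t) /W -[LHS]subr0 -[X in _ - X](mulr0 (v t)) -(K0 t pt); ring.
(* The momentum has two weak derivatives, rho (V - l1) f by the equation and -k rho f by the
   rotation; they agree almost everywhere. *)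
have cW (f df : M -> R) : solution (cint A p) (rho g p) (loc V p) l1 (loc f p) (mom df p) ->
    (forall t, cint A p t -> has_derive (mom df p) t (- k * (rho g p t * loc f p t))) ->
    {ae leb, forall t, al < t < be -> rho g p t * (loc V p t - (l1 - k)) * loc f p t = 0}.
  move=> [cf _ _ [y wy yE]] dq.
  have w1 : weak_deriv (cint A p) (mom df p) (fun t => - k * (rho g p t * loc f p t)).
    apply: weak_deriv_C1 => //; first exact: cint_open.
    move=> t pt; apply: continuousM; first exact: cst_continuous.
    by apply: continuousM; [exact: cs|exact: cf].
  have w2 := weak_derivD wy (weak_derivZ (-1) w1).
  have w3 := @eq_weak_deriv R (cint A p) _ _ (fun=> 0) _ (fun t _ => _) (fun t _ => erefl) w2.
  have {}w3 := w3 (fun t => ltac:(ring)).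
  apply: ae_mono (ae_conj yE (weak_deriv0_ae0 w3 abO)) => t [yt zt] tab.
  have pt : cint A p t by apply: abO; rewrite /= in_itv/= !ltW//; case/andP: tab.
  by have := zt tab; rewrite yt// => <-; ring.
have dqa t : cint A p t -> has_derive qa t (- k * (rho g p t * u t)).
  move=> pt; apply: (@near_has_derive _ (fun t => - r^-1 * W t * v t)).
    by apply: near_open (@cint_open _ _ A p) pt _ => t' pt'; rewrite qaE.
  have dv := solution_derive (@cs p) sb pt.
  apply: has_derive_eq (has_deriveM (has_deriveM (has_derive_cst (- r^-1) t) (dW t pt)) dv) _.
  rewrite -/qb (qbE t pt) /k -(W2 t pt); field.
  exact: r0.
have dqb t : cint A p t -> has_derive qb t (- k * (rho g p t * v t)).
  move=> pt; apply: (@near_has_derive _ (fun t => r^-1 * W t * u t)).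
    by apply: near_open (@cint_open _ _ A p) pt _ => t' pt'; rewrite qbE.
  have du := solution_derive (@cs p) sa pt.
  apply: has_derive_eq (has_deriveM (has_deriveM (has_derive_cst (r^-1) t) (dW t pt)) du) _.
  rewrite -/qa (qaE t pt) /k -(W2 t pt); field.
  exact: r0.
(* Both components are used, as either may vanish somewhere, but not both at once. *)
have VE : {ae leb, forall t, al < t < be -> loc V p t = l1 - k}.
  apply: ae_mono (ae_conj (cW _ _ sa dqa) (cW _ _ sb dqb)) => t [Ha Hb] tab.
  have pt : cint A p t by apply: abO; rewrite /= in_itv/= !ltW//; case/andP: tab.
  apply/eqP; rewrite -subr_eq0; apply/eqP.
  have /eqP := Ha tab; have /eqP := Hb tab; rewrite !mulf_eq0 (negbTE (s0 _ pt))/=.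
  move=> /orP[/eqP//|/eqP v0] /orP[/eqP//|/eqP u0].
  by have := rE t; rewrite /u /v v0 u0 expr0n addr0 => /eqP; rewrite eq_sym (negbTE r0).
pose U : set M := [set z | D p z /\ al < c p z < be].
exists U.
  have := cmap_at_near Dp (near_dist (c p p) (_ : 0 < d / 2)).
  move=> /(_ ltac:(by rewrite divr_gt0)); apply: filterS => z [Dz]; rewrite ltr_norml => /andP[h1 h2].
  by split => //; rewrite /al /be; apply/andP; split; lra.
have mU : measurable (U : set (borel M)).
  apply: open_borel; rewrite openE => z [Dz zab].
  have := cmap_at_near Dz (near_between zab).
  by apply: filterS => y [Dy].
have mUE := measurableI _ _ mU mE.
apply/negligibleP => //; apply/(@null_chart _ _ _ g mu volM p) => //; first by move=> z [[]].
apply/negligibleP; first exact: measurable_cinv.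
apply: negligibleS VE => t [pt [[Dt]]]; rewrite cmap_atK// => tab /= /eqP nV H.
exact/nV/H.
Qed.

End ConstantPotential.
End TwoEigenfunctions.
End ModeTheory.

(** * The unit speed flow and its cutoff functions *)

Section ArcLength.
Context {R : realType}.
Implicit Types (o S T f : R -> R) (t : R).

Lemma positive_derive_increasing f (df : R -> R) :
  (forall t, has_derive f t (df t)) -> (forall t, 0 < df t) -> {homo f : x y / x < y}.
Proof.
move=> H df0 x y xy.
have [z _ E] := mean_value (ltW xy) (fun t _ => H t) (within_has_derive (fun t _ => H t)).
by rewrite -subr_gt0 E mulr_gt0// subr_gt0.
Qed.

Lemma arc_length_pos (O : set R) o t0 : open O -> O t0 ->
  (forall t, O t -> {for t, continuous o}) -> 0 < o t0 ->
  exists d r S T, [/\ 0 < d, 0 < r, forall t, `|t - t0| < d -> O t, S t0 = 0 &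
    [/\ forall t, `|t - t0| < d -> has_derive S t (o t), cancel S T &
     forall t, `|t| < r ->
       [/\ `|T t - t0| < d, S (T t) = t & has_derive T t (o (T t))^-1]]].
Proof.
move=> oO Ot0 co o0.
have /nbhs_ballP[D /= D0 HD] : \forall t \near t0, O t /\ 0 < o t.
  apply: filterI; first exact: open_nbhs_nbhs.
  exact: (cvgr_gt _ (co _ Ot0) _ o0).
pose d := D / 2; have d0 : 0 < d by rewrite divr_gt0.
(* Clamping to [t0 - d, t0 + d] extends the density to a positive continuous function on the line,
   whose primitive is increasing everywhere. *)
pose cl t := Num.max (t0 - d) (Num.min t (t0 + d)).
have clE t : `|t - t0| <= d -> cl t = t.
  rewrite ler_norml => /andP[h1 h2]; rewrite /cl min_l ?max_r//; lra.
have clb t : O (cl t) /\ 0 < o (cl t).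
  apply: HD; rewrite /ball/= distrC ltr_norml /cl; apply/andP; split.
    have : t0 - d <= Num.max (t0 - d) (Num.min t (t0 + d)) by rewrite le_max lexx.
    by rewrite {1}/d; lra.
  have : Num.max (t0 - d) (Num.min t (t0 + d)) <= t0 + d by rewrite ge_max ge_min lexx orbT andbT; lra.
  by rewrite {3}/d; lra.
have ccl : continuous cl.
  move=> t; apply: (@continuous_max R R^o (fun=> t0 - d) (fun t => Num.min t (t0 + d))); first exact: cst_continuous.
  by apply: (@continuous_min R R^o id (fun=> t0 + d)); [exact: cvg_id|exact: cst_continuous].
pose f t := o (cl t).
have cf : continuous f by move=> t; apply: continuous_comp; [exact: ccl|exact/co/(clb t).1].
have [F dF] := primitive cf.
pose S t := F t - F t0.
have dS t : has_derive S t (f t).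
  by have := has_deriveB (dF t) (has_derive_cst (F t0) t); rewrite subr0.
have incr : {homo S : x y / x < y} by apply: positive_derive_increasing dS _ => t; exact: (clb t).2.
have St0 : S t0 = 0 by rewrite /S subrr.
have Sinj : injective S.
  by move=> x y E; have [/(incr _ _)|/(incr _ _)|//] := ltgtP x y; rewrite E ltxx.
(* The default value 0 is taken only outside the range of [S], which contains all |t| < r for the
   radius chosen below. *)
pose T t := xget 0 [set s | S s = t].
have ST : cancel S T by move=> t; apply: xget_unique => // s /Sinj.
pose r := Num.min (S (t0 + d)) (- S (t0 - d)).
have r0 : 0 < r.
  by rewrite lt_min oppr_gt0 -St0; apply/andP; split; apply: incr; lra.
have dSo t : `|t - t0| < d -> has_derive S t (o t).
  by move=> td; rewrite -[in o t](clE _ (ltW td)); exact: dS.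
exists d, r, S, T; split => //.
  by move=> t td; rewrite -(clE _ (ltW td)); exact: (clb t).1.
split => // t; rewrite ltr_norml !lt_min => /andP[].
rewrite ltrNl lt_min ltrN2 => /andP[_ h1] /andP[h2 _].
have [s sI Es] : exists2 s, s \in `[t0 - d, t0 + d] & S s = t.
  apply: IVT; first lra.
    by apply: continuous_subspaceT => s; exact: has_derive_continuous (dS s).
  by rewrite ge_min le_max (ltW h1) (ltW h2) orbT.
have TS : T t = s by rewrite -Es ST.
have sd : `|s - t0| < d.
  move: sI; rewrite in_itv/= !le_eqVlt => /andP[/orP[/eqP E|s1] /orP[/eqP E'|s2]].
  - by move: h1; rewrite -Es E ltxx.
  - by move: h1; rewrite -Es E ltxx.
  - by move: h2; rewrite -Es E' ltxx.
  - by rewrite ltr_norml; apply/andP; split; lra.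
rewrite TS; split => //.
have n1 : {near s, cancel S T} by near=> u; exact: ST.
have n2 : {near s, continuous S} by near=> u; exact: has_derive_continuous (dS u).
rewrite -{1}Es; apply: (is_derive_inverse n1 n2 (dSo _ sd)).
by rewrite -(clE _ (ltW sd)) gt_eqF//; exact: (clb s).2.
Unshelve. all: by end_near. Qed.

Lemma arc_length (O : set R) o t0 : open O -> O t0 ->
  (forall t, O t -> {for t, continuous o}) -> o t0 != 0 ->
  exists d r S T, [/\ 0 < d, 0 < r, forall t, `|t - t0| < d -> O t, S t0 = 0 &
    [/\ forall t, `|t - t0| < d -> has_derive S t (o t), cancel S T &
     forall t, `|t| < r ->
       [/\ `|T t - t0| < d, S (T t) = t & has_derive T t (o (T t))^-1]]].
Proof.
move=> oO Ot0 co oN.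
have [h|h|/eqP] := ltgtP (o t0) 0.
3: by rewrite (negbTE oN).
2: exact: (arc_length_pos oO Ot0 co h).
have co' t : O t -> {for t, continuous (fun s => - o s)}.
  by move=> /co; exact: continuousN.
have [|d [r [S [T [d0 r0 dO St0 [dS ST TS]]]]]] := arc_length_pos oO Ot0 co'.
  by rewrite oppr_gt0.
exists d, r, (fun t => - S t), (fun t => T (- t)); split => //.
  by rewrite St0 oppr0.
split.
- by move=> t /dS/has_deriveN; rewrite opprK.
- by move=> t; rewrite opprK ST.
- move=> t tr; have [|h1 h2 h3] := TS (- t); first by rewrite normrN.
  split => //; first by rewrite h2 opprK.
  apply: has_derive_eq (has_derive_comp h3 (has_deriveN (has_derive_id t))) _.
  by rewrite invrN mulrNN mulr1.
Qed.

End ArcLength.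

(** * Arcs of the unit speed flow *)

Section Arcs.
Context {R : realType} {M : ptopologicalType} {A : atlas R M}.
Variable omega : M -> R.
Implicit Types (p q x y z : M) (s t : R).
Local Notation c := (cmap_at A).
Local Notation ci := (cinv_at A).
Local Notation D := (cdom_at A).

Definition form_loc x t : R := omega (ci x t) * jac A x (ci x t).

(* S p is the primitive of omega, that is, the signed arc length from p, in the
   chart at p, and T p is its inverse: the arc through p is ci p (T p t). *)
Definition arcs (d r : M -> R) (S T : M -> R -> R) : Prop := forall p,
  [/\ 0 < d p, 0 < r p, forall t, `|t - c p p| < d p -> cint A p t, S p (c p p) = 0 &
    [/\ forall t, `|t - c p p| < d p -> has_derive (S p) t (form_loc p t),
     cancel (S p) (T p) &
     forall t, `|t| < r p -> [/\ `|T p t - c p p| < d p, S p (T p t) = t &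
                               has_derive (T p) t (form_loc p (T p t))^-1]]].

Hypothesis no_boundary : forall x z, D x z -> 0 < c x z.
Hypothesis omega_neq0 : forall z, omega z != 0.
Hypothesis omega_cont : forall x t, cint A x t -> {for t, continuous (form_loc x)}.

Lemma cimg_cint x t : cimg A x t -> cint A x t.
Proof. by move=> xt; split => //; rewrite /= -(cmap_atK xt); exact/no_boundary/cinv_dom. Qed.

Lemma form_locE x z : D x z -> form_loc x (c x z) = omega z * jac A x z.
Proof. by move=> Dx; rewrite /form_loc cinv_atK. Qed.

Lemma form_loc_neq0 x t : cimg A x t -> form_loc x t != 0.
Proof. by move=> xt; rewrite mulf_neq0// jac_neq0//; exact: cinv_dom. Qed.

Lemma form_loc_trans x y z : D x z -> D y z ->
  form_loc x (c x z) = form_loc y (c y z) * dtrans A x y z.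
Proof. by move=> Dx Dy; rewrite !form_locE// (jac_trans Dx Dy) mulrA. Qed.

Lemma arcs_exist : exists d r S T, arcs d r S T.
Proof.
have H p : exists q : (R * R) * ((R -> R) * (R -> R)),
    [/\ 0 < q.1.1, 0 < q.1.2, forall t, `|t - c p p| < q.1.1 -> cint A p t, q.2.1 (c p p) = 0 &
    [/\ forall t, `|t - c p p| < q.1.1 -> has_derive q.2.1 t (form_loc p t),
     cancel q.2.1 q.2.2 &
     forall t, `|t| < q.1.2 -> [/\ `|q.2.2 t - c p p| < q.1.1, q.2.1 (q.2.2 t) = t &
                               has_derive q.2.2 t (form_loc p (q.2.2 t))^-1]]].
  have xt := cimg_cmap (cdom_at_self A p).
  have [d [r [S [T H]]]] := arc_length (@cint_open _ _ A p) (cimg_cint xt) (@omega_cont p) (form_loc_neq0 xt).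
  by exists ((d, r), (S, T)).
have [F HF] := choice H.
by exists (fun p => (F p).1.1), (fun p => (F p).1.2), (fun p => (F p).2.1), (fun p => (F p).2.2).
Qed.

Section Flow.
Variables (d r : M -> R) (S T : M -> R -> R).
Hypothesis arcsE : arcs d r S T.
Local Notation e p t := (ci p (T p t)).

(** As omega transforms like a covector, the arc length from p is a primitive of omega in every
    chart and not only in the one at p. *)
Lemma arc_param_derive x p z : D x z -> D p z -> `|c p z - c p p| < d p ->
  has_derive (fun t => S p (c p (ci x t))) (c x z) (form_loc x (c x z)).
Proof.
move=> Dx Dp zd; have [_ _ _ _ [dS _ _]] := arcsE p.
rewrite (form_loc_trans Dx Dp).
have H := trans_has_derive Dx Dp (no_boundary Dx).
have HS := dS _ zd; rewrite -(cinv_atK Dx) in HS.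
by rewrite -{2}(cinv_atK Dx); exact: (has_derive_comp HS H).
Qed.

Lemma cinv_at_continuous x t : cimg A x t -> {for t, continuous (ci x)}.
Proof.
move=> xt U /(cinv_at_near xt)[k k0 Hk].
have [k' k'0 Hk'] := open_contains_interval (@cint_open _ _ A x) (cimg_cint xt).
have kk : 0 < Num.min k k' by rewrite lt_min k0.
have := near_dist t kk; apply: filterS => s; rewrite lt_min => /andP[h1 h2].
by apply: Hk => //; exact/cint_cimg/Hk'.
Qed.

Lemma arc_cimg p t : `|t| < r p -> cimg A p (T p t).
Proof.
move=> tr; have [_ _ dO _ [_ _ /(_ _ tr)[Td _ _]]] := arcsE p.
exact/cint_cimg/dO.
Qed.

Lemma arc_start p : e p 0 = p.
Proof.
have [_ r0 _ S0 [_ ST _]] := arcsE p.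
by rewrite -S0 ST cinv_atK//; exact: cdom_at_self.
Qed.

Lemma arc_continuous p t : `|t| < r p -> {for t, continuous (fun t => e p t)}.
Proof.
move=> tr; have [_ _ _ _ [_ _ /(_ _ tr)[_ _ dT]]] := arcsE p.
apply: continuous_comp; first exact: has_derive_continuous dT.
exact/cinv_at_continuous/arc_cimg.
Qed.

Lemma arc_injective p s t : `|s| < r p -> `|t| < r p -> e p s = e p t -> s = t.
Proof.
move=> sr tr /(congr1 (c p)); rewrite !cmap_atK; try exact: arc_cimg.
have [_ _ _ _ [_ _ H]] := arcsE p.
by have [_ E1 _] := H _ sr; have [_ E2 _] := H _ tr => E; rewrite -E1 E E2.
Qed.

Lemma arc_nbhs p (k : R) : 0 < k -> k <= r p -> nbhs p ((fun t => e p t) @` [set t | `|t| < k]).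
Proof.
move=> k0 kr; have Dp := cdom_at_self A p.
have [d0 _ _ S0 [dS ST _]] := arcsE p.
have d1 : `|c p p - c p p| < d p by rewrite subrr normr0.
have cS := has_derive_continuous (dS _ d1).
have : \forall t \near c p p, `|S p t| < k.
  have /cvgr_dist_lt/(_ _ k0) := cS; apply: filterS => t.
  by rewrite S0 sub0r normrN.
move=> /(cmap_at_near Dp); apply: filterS => z [Dz zk].
by exists (S p (c p z)) => //; rewrite ST cinv_atK.
Qed.

(** Read in the chart at p, the arc lengths from p and from the point z reached at time t are both
    primitives of omega; near z they differ by the constant t. *)
Lemma arc_shift p t : `|t| < r p -> \forall h \near (0 : R), e (e p t) h = e p (t + h).
Proof.
move=> tr; have [dp0 _ dO _ [dS ST H]] := arcsE p; have [Td STt dT] := H _ tr.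
set s0 := T p t in Td STt dT *; set z := ci p s0.
have ps0 := arc_cimg tr; rewrite -/s0 in ps0.
have Dz := cdom_at_self A z; have Dpz : D p z by exact: cinv_dom.
have cz : c p z = s0 by exact: cmap_atK.
have [dz0 _ dzO Sz0 [dSz STz Hz]] := arcsE z.
have czN : \forall s \near s0, [/\ cimg A p s, D z (ci p s), `|c z (ci p s) - c z z| < d z & `|s - c p p| < d p].
  have h1 : \forall s \near s0, cint A p s by apply: near_open (cimg_cint ps0) _ => //; exact: cint_open.
  have h2 : \forall s \near s0, D z (ci p s) /\ `|c z (ci p s) - c z z| < d z.
    exact: (cinv_at_continuous ps0 (cmap_at_near Dz (near_dist (c z z) dz0))).
  have h3 : \forall s \near s0, `|s - c p p| < d p.
    have Td' : ball (c p p) (d p) s0 by rewrite /ball/= distrC.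
    by apply: near_open (ball_open _ _) Td' _ => // s; rewrite /ball/= distrC.
  by apply: filterS3 h1 h2 h3 => s s1 [s2 s3] s4; split => //; exact: cint_cimg.
have [k k0 Hk] : exists2 k : R, 0 < k & forall s, `|s - s0| < k ->
    S z (c z (ci p s)) = S p s - t.
  have /nbhs_ballP[k /= k0 Hk] := czN; exists k => // s sk.
  have inb u : s0 - k < u < s0 + k -> ball s0 k u.
    by move=> /andP[u1 u2]; rewrite /ball/= ltr_norml; apply/andP; split; lra.
  have dG u : s0 - k < u < s0 + k -> has_derive (fun u => S z (c z (ci p u)) - S p u) u 0.
    move=> /inb/Hk[pu Dzu ud us]; rewrite -(subrr (form_loc p u)).
    apply: has_deriveB; last exact: dS.
    by have := arc_param_derive (cinv_dom pu) Dzu ud; rewrite cmap_atK.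
  have sI : s0 - k < s < s0 + k.
    by move: sk; rewrite ltr_norml => /andP[h1 h2]; apply/andP; split; lra.
  have s0I : s0 - k < s0 < s0 + k by apply/andP; split; lra.
  have := has_derive0_cst dG sI s0I; rewrite -/z Sz0 STt => E.
  by apply/eqP; rewrite -subr_eq0 opprB addrA addrAC E sub0r addNr.
have cT := has_derive_continuous dT.
have cT0 : T p (t + h) @[h --> (0 : R)] --> s0.
  rewrite -[X in _ --> X]/(T p t) -{2}[t]addr0.
  apply: continuous_comp; last by rewrite addr0.
  by apply: continuousD; [exact: cst_continuous|exact: cvg_id].
have n1 : \forall h \near (0 : R), [/\ cimg A p (T p (t + h)), D z (ci p (T p (t + h))),
    `|c z (ci p (T p (t + h))) - c z z| < d z & `|T p (t + h) - c p p| < d p] := cT0 _ czN.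
have n2 : \forall h \near (0 : R), `|s0 - T p (t + h)| < k by move/cvgr_dist_lt/(_ _ k0) : cT0.
have n3 : \forall h \near (0 : R), `|h| < r p - `|t|.
  have r1 : 0 < r p - `|t| by rewrite subr_gt0.
  by have := near_dist 0 r1; apply: filterS => h; rewrite subr0.
apply: filterS3 n1 n2 n3 => h [ps Dzs zd _] sk hr.
have [|_ STh _] := H (t + h).
  by apply: le_lt_trans (ler_normD _ _) _; lra.
have : S z (c z (ci p (T p (t + h)))) = h.
  by rewrite Hk; [rewrite STh; lra|rewrite distrC].
by move=> /(congr1 (T z)); rewrite STz => <-; rewrite cinv_atK.
Qed.

End Flow.
End Arcs.

(** * Cutoff functions along the flow *)

Section Cutoff.
Context {R : realType} {M : ptopologicalType} {A : atlas R M}.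
Hypothesis hausM : hausdorff_space M.
Variable omega : M -> R.
Implicit Types (x y z : M) (s t : R) (b : R -> R).
Local Notation c := (cmap_at A).
Local Notation ci := (cinv_at A).
Local Notation D := (cdom_at A).
Local Notation ol := (form_loc (A := A) omega).

Hypothesis no_boundary : forall x z, D x z -> 0 < c x z.
Hypothesis ol_smooth : forall x n, smooth_upto n (cint A x) (ol x).

Variables (d r : M -> R) (S T : M -> R -> R).
Hypothesis arcsE : arcs (A := A) omega d r S T.
Variables (p : M) (U : set M) (k : R).
Hypotheses (k0 : 0 < k) (kr : k < r p).
Local Notation e t := (ci p (T p t)).
Hypothesis U_open : open U.
Hypothesis U_forward : forall t, 0 < t < r p -> U (e t).
Hypothesis U_backward : forall t, - r p < t <= 0 -> ~ U (e t).
Hypothesis U_exit : forall q, q <> p -> ~ U q -> \forall q' \near q, ~ U q'.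

Definition on_arc z : Prop :=
  [/\ D p z, `|c p z - c p p| < d p & `|S p (c p z)| < r p].

(* U is the part of M reached from p in positive time. The profile b, a function
   of the arc length from p, is constant beyond the arc through p. *)
Definition cutoff b z : R :=
  if `[< U z >] then (if `[< on_arc z >] then b (S p (c p z)) else b k) else 0.

Definition step_profile b : Prop :=
  [/\ smooth_fun b, forall t, t <= 0 -> b t = 0 & forall t, k <= t -> b t = b k].

(** Profiles are stable under differentiation, so the derivative of a cutoff along the flow is again
    a cutoff. At the junctions 0 and k the derivative vanishes by continuity. *)
Lemma step_profile_derive b : step_profile b -> step_profile (derive1 b) /\ derive1 b k = 0.
Proof.
move=> [sb b0 bk]; have db t := smooth_fun_derive t sb.
have cb' : continuous (derive1 b) by move=> t; exact: smooth_fun_continuous (smooth_fun_derive1 sb) _.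
have pos t : k < t -> derive1 b t = 0.
  move=> kt; apply: has_derive_derive1; apply: (@near_has_derive _ (fun=> b k)); last exact: has_derive_cst.
  by apply: near_open (@open_gt R k) kt _ => s /= /ltW/bk.
have neg t : t < 0 -> derive1 b t = 0.
  move=> t0; apply: has_derive_derive1; apply: (@near_has_derive _ (fun=> 0)); last exact: has_derive_cst.
  by apply: near_open (@open_lt R 0) t0 _ => s /= /ltW/b0.
have limit t : (forall e : R, 0 < e -> exists2 s, `|s - t| < e & derive1 b s = 0) -> derive1 b t = 0.
  move=> H; apply/eqP; apply/negP => /negP n0.
  have /cvgr_dist_lt/(_ _ (_ : 0 < `|derive1 b t|)) := cb' t.
  rewrite normr_gt0 => /(_ n0)/nbhs_ballP[h /= h0 Hh].
  have [s st s0] := H _ h0; have Bs : ball t h s by rewrite /ball/= distrC.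
  by have := Hh _ Bs; rewrite /= s0 subr0 ltxx.
have at0 : derive1 b 0 = 0.
  apply: limit => h h0; exists (- (h / 2)); last by apply: neg; lra.
  by rewrite subr0 normrN gtr0_norm; lra.
have atk : derive1 b k = 0.
  apply: limit => h h0; exists (k + h / 2); last by apply: pos; lra.
  by rewrite addrAC subrr add0r gtr0_norm; lra.
split => //; split.
- exact: smooth_fun_derive1.
- by move=> t; rewrite le_eqVlt => /predU1P[->|/neg].
- by move=> t; rewrite le_eqVlt => /predU1P[<-//|/pos ->].
Qed.

Lemma on_arcP z : on_arc z -> z = e (S p (c p z)).
Proof.
by move=> [Dz _ _]; have [_ _ _ _ [_ ST _]] := arcsE p; rewrite ST cinv_atK.
Qed.

Lemma on_arc_arc t : `|t| < r p -> on_arc (e t) /\ S p (c p (e t)) = t.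
Proof.
move=> tr; have pt := arc_cimg arcsE tr; have [_ _ _ _ [_ _ /(_ _ tr)[Td St _]]] := arcsE p.
by rewrite /on_arc cmap_atK// St; split => //; split => //; exact: cinv_dom.
Qed.

Lemma on_arc_near z : on_arc z -> \forall y \near z, on_arc y.
Proof.
move=> [Dz zd zr]; have [_ _ _ _ [dS _ _]] := arcsE p.
have n1 : \forall t \near c p z, `|t - c p p| < d p.
  have H : ball (c p p) (d p) (c p z) by rewrite /ball/= distrC.
  have dp0 : 0 < d p by exact: le_lt_trans zd.
  by apply: near_open (ball_open _ _) H _ => // s; rewrite /ball/= distrC.
have n2 : \forall t \near c p z, `|S p t| < r p.
  have /(has_derive_continuous) cS := dS _ zd.
  have /cvgr_dist_lt/(_ (r p - `|S p (c p z)|)) := cS.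
  rewrite subr_gt0 => /(_ zr); apply: filterS => s sr.
  have := ler_normB (S p (c p z)) (S p (c p z) - S p s); rewrite opprB addrC subrK => h.
  lra.
by apply: filterS2 (cmap_at_near Dz n1) (cmap_at_near Dz n2) => y [Dy y1] [_ y2].
Qed.

Lemma cutoff_on_arc b z : step_profile b -> on_arc z -> cutoff b z = b (S p (c p z)).
Proof.
move=> [_ b0 _] Bz; have zE := on_arcP Bz; have [_ _ zr] := Bz; rewrite /cutoff.
case: asboolP => [Uz|nU]; first by case: asboolP.
rewrite b0// leNgt; apply/negP => h; apply: nU; rewrite zE; apply: U_forward.
by rewrite h (le_lt_trans (ler_norm _) zr).
Qed.

(** Off the arc through [p] the cutoff could jump only on the boundary of [U], and [U_exit] leaves
    no such boundary point outside [U] except [p], which is on the arc. *)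
Lemma cutoff_local z : [\/ on_arc z,
  \forall y \near z, forall b, step_profile b -> cutoff b y = b k |
  \forall y \near z, forall b, step_profile b -> cutoff b y = 0].
Proof.
have [Bz|nB] := pselect (on_arc z); first exact: Or31.
have [Uz|nU] := pselect (U z); last first.
  apply: Or33; apply: filterS (U_exit _ nU) => [y nUy b _|zp].
    by rewrite /cutoff asboolF.
  apply: nB; rewrite zp; have [d0 r0 _ S0 _] := arcsE p.
  by split; rewrite ?subrr ?S0 ?normr0//; exact: cdom_at_self.
apply: Or32.
(* This compact piece carries the whole variation of the profile. A point of [U] on the arc but off
   [K] lies beyond k, since the backward half of the arc is outside [U]. *)
pose K := (fun t => e t) @` `[0, k].
have cK : compact K.
  apply: continuous_compact; last exact: segment_compact.
  apply: continuous_in_subspaceT => t; rewrite inE/= in_itv/= => /andP[t0 tk].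
  by apply: (arc_continuous no_boundary arcsE); rewrite ger0_norm// (le_lt_trans tk).
have nK : ~ K z.
  move=> [t /=]; rewrite in_itv/= => /andP[t0 tk] tz; apply: nB; rewrite -tz.
  by apply: (on_arc_arc _).1; rewrite ger0_norm// (le_lt_trans tk).
have oK : open (U `&` ~` K).
  by apply: openI => //; apply: closed_openC; exact: compact_closed.
apply: (near_open oK) => // y [Uy nKy] b [_ _ bk].
rewrite /cutoff asboolT//; case: asboolP => // By.
have yE := on_arcP By; have [_ _ yr] := By.
apply: bk; rewrite leNgt; apply/negP => yk.
have [y0|y0] := leP 0 (S p (c p y)).
  by apply: nKy; exists (S p (c p y)) => //; rewrite /= in_itv/= y0 ltW.
move: Uy; rewrite yE; apply: U_backward; rewrite (ltW y0) andbT.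
by move: yr; rewrite ltr_norml => /andP[].
Qed.

Lemma cutoff_derive b x t : step_profile b -> cint A x t ->
  has_derive (fun t => cutoff b (ci x t)) t (cutoff (derive1 b) (ci x t) * ol x t).
Proof.
move=> sb /cint_cimg xt; have [sb' b'k] := step_profile_derive sb.
have Dx := cinv_dom xt; have cx := cmap_atK xt.
have cix (P : M -> Prop) : (\forall y \near ci x t, P y) -> \forall s \near t, P (ci x s).
  by move=> H; exact: (cinv_at_continuous no_boundary xt H).
case: (cutoff_local (ci x t)) => H.
- apply: (@near_has_derive _ (fun t => b (S p (c p (ci x t))))).
    have := cix _ (on_arc_near H); apply: filterS => s Bs.
    by rewrite cutoff_on_arc.
  rewrite cutoff_on_arc//; have [Dp zd _] := H.
  have dS := arc_param_derive no_boundary arcsE Dx Dp zd; rewrite cx in dS.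
  have [sm _ _] := sb.
  exact: (has_derive_comp (smooth_fun_derive _ sm) dS).
- have -> : cutoff (derive1 b) (ci x t) = 0 by rewrite (nbhs_singleton H).
  rewrite mul0r; apply: (@near_has_derive _ (fun=> b k)); last exact: has_derive_cst.
  by have := cix _ H; apply: filterS => s ->.
- have -> : cutoff (derive1 b) (ci x t) = 0 by rewrite (nbhs_singleton H).
  rewrite mul0r; apply: (@near_has_derive _ (fun=> 0)); last exact: has_derive_cst.
  by have := cix _ H; apply: filterS => s ->.
Qed.

Lemma cutoff_smooth n b x : step_profile b ->
  smooth_upto n (cint A x) (fun t => cutoff b (ci x t)).
Proof.
elim: n b => [|n IH] b sb.
  by move=> t /(cutoff_derive sb)/has_derive_continuous.
apply: smooth_upto_intro (fun t => cutoff_derive sb) _; first exact: cint_open.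
apply: smooth_uptoM; [exact: cint_open| |exact: ol_smooth].
by apply: IH; exact: (step_profile_derive sb).1.
Qed.

Lemma cutoff_continuous b : step_profile b -> continuous (cutoff b).
Proof.
move=> sb z; have Dz := cdom_at_self A z.
have xt := cimg_cint no_boundary (cimg_cmap Dz).
have cX := has_derive_continuous (cutoff_derive sb xt).
apply: (@near_eq_continuous _ _ (fun y => cutoff b (ci z (c z y)))).
  by apply: near_open Dz _ => [|y Dy]; [exact: cdom_at_open|rewrite cinv_atK].
exact: (continuous_comp (cmap_at_continuous Dz) cX).
Qed.

Lemma cutoff_bounded b : step_profile b -> exists C : R, forall z, `|cutoff b z| <= C.
Proof.
move=> [sb b0 bk].
have cb : {within `[0, k], continuous b}.
  by apply: continuous_subspaceT => t; exact: smooth_fun_continuous sb _.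
have [C HC] : exists C, forall t, 0 <= t <= k -> `|b t| <= C.
  have [a _ Ha] := EVT_max (ltW k0) cb; have [a' _ Ha'] := EVT_min (ltW k0) cb.
  exists (`|b a| + `|b a'|) => t tk.
  have tI : t \in `[0, k] by rewrite in_itv.
  have := Ha _ tI; have := Ha' _ tI; have := ler_norm (b a); have := ler_norm (- b a').
  rewrite normrN ler_norml => h1 h2 h3 h4.
  have := normr_ge0 (b a); have := normr_ge0 (b a').
  by move=> h5 h6; apply/andP; split; lra.
have C0 : 0 <= C by apply: le_trans (HC 0 _) => //; rewrite lexx ltW.
have Hb t : `|b t| <= C.
  have [t0|/ltW t0] := leP t 0; first by rewrite b0// normr0.
  have [tk|/ltW tk] := leP t k; first by apply: HC; rewrite t0.
  by rewrite bk//; apply: HC; rewrite ltW/=.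
exists C => z; rewrite /cutoff; case: ifP => _; last by rewrite normr0.
by case: ifP.
Qed.

End Cutoff.

(** * Products of cutoff functions and eigenfunctions *)

Section SquareIntegrable.
Context d (T : measurableType d) {R : realType}.
Variable mu : {measure set T -> \bar R}.
Implicit Types (u v w : T -> R[i]).

Lemma normsq_add3 (a b c : R[i]) :
  normsq (a + b + c) <= 3 * (normsq a + normsq b + normsq c).
Proof.
rewrite /normsq !complexE.
set a1 := complex.Re a; set b1 := complex.Re b; set c1 := complex.Re c.
set a2 := complex.Im a; set b2 := complex.Im b; set c2 := complex.Im c.
rewrite -subr_ge0.
have -> : 3 * (a1 ^+ 2 + a2 ^+ 2 + (b1 ^+ 2 + b2 ^+ 2) + (c1 ^+ 2 + c2 ^+ 2)) -
    ((a1 + b1 + c1) ^+ 2 + (a2 + b2 + c2) ^+ 2) =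
  (a1 - b1) ^+ 2 + (b1 - c1) ^+ 2 + (a1 - c1) ^+ 2 +
  ((a2 - b2) ^+ 2 + (b2 - c2) ^+ 2 + (a2 - c2) ^+ 2) by ring.
by rewrite !addr_ge0// sqr_ge0.
Qed.

Lemma normsqZ (k : R) (z : R[i]) : normsq (k%:C * z) = k ^+ 2 * normsq z.
Proof. by rewrite /normsq !complexE /=; ring. Qed.

Lemma L2_dominated u1 u2 u3 v (C : R) : L2 mu u1 -> L2 mu u2 -> L2 mu u3 -> Defs.measurableC v ->
  (forall p, normsq (v p) <= C * (normsq (u1 p) + normsq (u2 p) + normsq (u3 p))) -> L2 mu v.
Proof.
move=> L1 L2' L3 mv H; split => //.
have I : mu.-integrable setT (fun p => (C%:E * ((normsq (u1 p))%:E + (normsq (u2 p))%:E + (normsq (u3 p))%:E))%E).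
  apply: integrableZl => //; apply: integrableD => //; last exact: L2_integrable_normsq.
  by apply: integrableD => //; exact: L2_integrable_normsq.
have J : mu.-integrable setT (fun p => (normsq (v p))%:E).
  apply: le_integrable I => //.
    by apply/measurable_EFinP; have [mr mi] := mv; apply: measurable_funD; apply: measurable_funX.
  move=> p _ /=; rewrite lee_fin ger0_norm ?normsq_ge0//.
  by apply: le_trans (ler_norm _); exact: H.
rewrite /L2_normsq; have := integrable_fin_num measurableT J.
by rewrite fin_numElt => /andP[].
Qed.

End SquareIntegrable.

(** * A cutoff times an eigenfunction stays in the domain *)

Section Product.
Context {R : realType} {M : ptopologicalType} {A : atlas R M}.
Variable g : riemannian_metric A.
Variable mu : {measure set (borel M) -> \bar R}.
Implicit Types (x y z : M) (s t : R) (f df lf : M -> R).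
Local Notation c := (cmap_at A).
Local Notation ci := (cinv_at A).
Local Notation D := (cdom_at A).
Variable omega : M -> R.
Local Notation ol := (form_loc (A := A) omega).
Local Notation mom := (mom g).
Local Notation loc := (@loc R M A).

Hypothesis no_boundary : forall x z, D x z -> 0 < c x z.
Hypothesis omega_sqr : forall z, omega z ^+ 2 = g z.
Hypothesis omega_unit : forall x t, cint A x t -> has_derive (fun s => ol x s / rho g x s) t 0.
Variables (X0 X1 X2 : M -> R).
Hypothesis X0_derive : forall x t, cint A x t -> has_derive (loc X0 x) t (loc X1 x t * ol x t).
Hypothesis X1_derive : forall x t, cint A x t -> has_derive (loc X1 x) t (loc X2 x t * ol x t).
Hypothesis X0_smooth : forall x n, smooth_upto n (cint A x) (loc X0 x).
Hypothesis X1_smooth : forall x n, smooth_upto n (cint A x) (loc X1 x).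
Hypotheses (X0_cont : continuous X0) (X1_cont : continuous X1) (X2_cont : continuous X2).
Variable B : R.
Hypotheses (X0_bound : forall z, `|X0 z| <= B) (X1_bound : forall z, `|X1 z| <= B).
Hypothesis X2_bound : forall z, `|X2 z| <= B.

Lemma form_unit_smooth x n : smooth_upto n (cint A x) (fun s => ol x s / rho g x s).
Proof.
case: n => [|n]; first by move=> t /omega_unit/has_derive_continuous.
apply: smooth_upto_intro (@omega_unit x) _; first exact: cint_open.
by apply: smooth_upto_cst; exact: cint_open.
Qed.

(** The quotient of omega by [rho] has derivative 0, so omega is as smooth as the metric, whatever
    the regularity of the eigenfunction. *)
Lemma form_loc_smooth x n : smooth_upto n (cint A x) (ol x).
Proof.
apply: (@eq_smooth_upto _ _ _ (fun s => ol x s / rho g x s * rho g x s)).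
- exact: cint_open.
- by move=> t xt; rewrite divfK// rho_neq0.
- by apply: smooth_uptoM; [exact: cint_open|exact: form_unit_smooth|exact: rho_smooth].
Qed.

Lemma product_gradient f df x :
  weak_deriv (cint A x) (loc f x) (fun t => df (ci x t) * jac A x (ci x t)) ->
  weak_deriv (cint A x) (loc (fun z => X0 z * f z) x)
    (fun t => (X0 (ci x t) * df (ci x t) + X1 (ci x t) * omega (ci x t) * f (ci x t)) * jac A x (ci x t)).
Proof.
move=> /(weak_deriv_mul_smooth (X0_smooth x)); apply: eq_weak_deriv => // t xt.
rewrite (has_derive_derive1 (X0_derive xt)) /loc /form_loc; ring.
Qed.

(** The momentum of the product is X0 times that of f plus X1 sg f, with sg = omega / rho locally
    constant; differentiating once more produces X2 and no derivative of sg. *)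
Lemma product_laplacian f df lf x :
  weak_deriv (cint A x) (loc f x) (fun t => df (ci x t) * jac A x (ci x t)) ->
  weak_deriv (cint A x) (mom df x) (fun t => rho g x t * lf (ci x t)) ->
  weak_deriv (cint A x) (mom (fun z => X0 z * df z + X1 z * omega z * f z) x)
    (fun t => rho g x t * (X0 (ci x t) * lf (ci x t) +
       (2 * X1 (ci x t) * omega (ci x t) / g (ci x t) * df (ci x t) + X2 (ci x t) * f (ci x t)))).
Proof.
move=> w1 w2; pose sg t := ol x t / rho g x t.
have sX n : smooth_upto n (cint A x) (fun t => loc X1 x t * sg t).
  by apply: smooth_uptoM; [exact: cint_open|exact: X1_smooth|exact: form_unit_smooth].
have dX t : cint A x t -> has_derive (fun t => loc X1 x t * sg t) t (loc X2 x t * ol x t * sg t).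
  move=> xt; apply: has_derive_eq (has_deriveM (X1_derive xt) (omega_unit xt)) _.
  by rewrite mulr0 addr0.
have := weak_derivD (weak_deriv_mul_smooth (X0_smooth x) w2) (weak_deriv_mul_smooth sX w1).
apply: eq_weak_deriv => t xt.
  by rewrite /mom /sg /loc /form_loc; field; exact: rho_neq0.
rewrite (has_derive_derive1 (X0_derive xt)) (has_derive_derive1 (dX _ xt)).
have r0 : rho g x t != 0 by exact: rho_neq0.
have gE : rho g x t ^+ 2 = g (ci x t) * jac A x (ci x t) ^+ 2.
  by rewrite /rho sqr_sqrtr// ltW// bilinear_gt0//; exact: cint_cimg.
have g0 : g (ci x t) != 0 by rewrite gt_eqF// metric_gt0.
have j0 : jac A x (ci x t) != 0 by apply: jac_neq0; exact/cinv_dom/cint_cimg.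
rewrite /sg /mom /loc /form_loc.
set j := jac A x (ci x t) in gE j0 *; set G := g (ci x t) in gE g0 *; set r := rho g x t in gE r0 *.
set w := omega (ci x t); have wE : w ^+ 2 = G by exact: omega_sqr.
have rE : r^-1 = r / (G * j ^+ 2) by rewrite -gE; field.
(* In the chart the square of omega is the square of [rho]. *)
have rE2 : w * j * (w * j / r) = r.
  by rewrite -[RHS](mulfK r0) -expr2 gE -wE; field.
set a := X0 _; set b := X1 _; set e := X2 _; set u := f _; set du := df _; set lu := lf _.
have -> : e * (w * j) * (w * j / r) * u = e * (w * j * (w * j / r)) * u by ring.
rewrite rE2 rE; field.
by rewrite g0 j0.
Qed.

Lemma chart_continuous (F : M -> R) : (forall z, exists2 G : R -> R,
  {for c z z, continuous G} & forall y, D z y -> F y = G (c z y)) -> continuous F.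
Proof.
move=> H z; have [G cG E] := H z; have Dz := cdom_at_self A z.
apply: (@near_eq_continuous _ _ (fun y => G (c z y))).
  by apply: near_open Dz _ => [|y Dy]; [exact: cdom_at_open|rewrite E].
exact: (continuous_comp (cmap_at_continuous Dz) cG).
Qed.

Section Domain.
Variable V : M -> R.
Variable bc : M -> boundary_condition.
Variables (phi dphi lap : M -> R[i]).
Hypothesis phiE : H2 g mu phi dphi lap.
Let re0 (k : R) (z : R[i]) : complex.Re (k%:C * z) = k * complex.Re z.
Proof. by rewrite ReM /= mul0r subr0. Qed.
Let im0 (k : R) (z : R[i]) : complex.Im (k%:C * z) = k * complex.Im z.
Proof. by rewrite ImM /= mul0r addr0. Qed.
Let re1 (k : R) (z : R[i]) : complex.Re (z * k%:C) = complex.Re z * k.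
Proof. by rewrite ReM /= mulr0 subr0. Qed.
Let im1 (k : R) (z : R[i]) : complex.Im (z * k%:C) = complex.Im z * k.
Proof. by rewrite ImM /= mulr0 add0r. Qed.

Definition covec_cont (a : M -> R[i]) : Prop :=
  forall x, continuousC_within (cimg A x) (covector_loc A a x).

Lemma covec_cont_at a x t : covec_cont a -> cimg A x t ->
  {for t, continuous (fun s => complex.Re (a (ci x s)) * jac A x (ci x s))} /\
  {for t, continuous (fun s => complex.Im (a (ci x s)) * jac A x (ci x s))}.
Proof.
move=> /(_ x)[cr cm] xt; have xt' := cimg_cint no_boundary xt.
split; [move: cr|move: cm]; rewrite /covector_loc.
- under eq_fun do rewrite re1.
  by move=> H; apply: (within_continuous_near H (@cint_open _ _ A x) (@cint_cimg _ _ A x)).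
- under eq_fun do rewrite im1.
  by move=> H; apply: (within_continuous_near H (@cint_open _ _ A x) (@cint_cimg _ _ A x)).
Qed.

Lemma rho_cimg_continuous x t : cimg A x t -> {for t, continuous (rho g x)}.
Proof. by move=> /(cimg_cint no_boundary); exact: rho_continuous. Qed.

Lemma rho_sqr_cmap x y : D x y -> rho g x (c x y) ^+ 2 = g y * jac A x y ^+ 2.
Proof.
move=> Dy; rewrite /rho sqr_sqrtr; first by rewrite /bilinear_loc -/(cinv_at A x) cinv_atK.
by rewrite ltW// bilinear_gt0//; exact: cimg_cmap.
Qed.

(** A covector field need not be continuous as a function on [M], since the preferred charts vary
    arbitrarily. In the g-product with omega the Jacobians cancel. *)
Lemma form_pairing_continuous a : covec_cont a ->
  continuous (fun z => omega z * complex.Re (a z) / g z) /\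
  continuous (fun z => omega z * complex.Im (a z) / g z).
Proof.
move=> ca.
have H (b : M -> R) : (forall z, {for c z z, continuous (fun s => b (ci z s) * jac A z (ci z s))}) ->
    continuous (fun z => omega z * b z / g z).
  move=> cb; apply: chart_continuous => z; have zt := cimg_cmap (cdom_at_self A z).
  exists (fun t => ol z t * (b (ci z t) * jac A z (ci z t)) / rho g z t ^+ 2).
    apply: continuousM.
      apply: continuousM; last exact: cb.
      by apply: (@form_loc_smooth z 0%N); exact: cimg_cint.
    apply: continuousV; first by rewrite expf_neq0// rho_neq0//; exact: cimg_cint.
    by apply: continuousM; exact: rho_cimg_continuous.
  move=> y Dy; rewrite rho_sqr_cmap// /form_loc cinv_atK//.
  by field; rewrite jac_neq0// gt_eqF// metric_gt0.
by split; apply: H => z; have [] := covec_cont_at ca (cimg_cmap (cdom_at_self A z)).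
Qed.

Lemma covector_normE a z : covector_norm g a z = (Num.sqrt (normsq (a z) / g z))%:C.
Proof.
rewrite /covector_norm normcE sqrtrM ?normsq_ge0// sqrtrV ?ltW ?metric_gt0//.
by apply: complex_ext; rewrite !complexE /=; ring.
Qed.

Lemma covector_norm_measurable a : covec_cont a ->
  Defs.measurableC (covector_norm g a : borel M -> R[i]).
Proof.
move=> ca; have E := covector_normE a; split.
  rewrite (_ : (fun _ => _) = fun p => Num.sqrt (normsq (a p) / g p)); last by apply/funext => z; rewrite E.
  apply: continuous_borel.
  have cN : continuous (fun z => normsq (a z) / g z).
    apply: chart_continuous => z; have zt := cimg_cmap (cdom_at_self A z).
    have [c1 c2] := covec_cont_at ca zt.
    exists (fun t => ((complex.Re (a (ci z t)) * jac A z (ci z t)) * (complex.Re (a (ci z t)) * jac A z (ci z t)) +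
      (complex.Im (a (ci z t)) * jac A z (ci z t)) * (complex.Im (a (ci z t)) * jac A z (ci z t))) / rho g z t ^+ 2).
      apply: continuousM.
        by apply: continuousD; apply: continuousM.
      apply: continuousV; first by rewrite expf_neq0// rho_neq0//; exact: cimg_cint.
      by apply: continuousM; exact: rho_cimg_continuous.
    move=> y Dy; rewrite rho_sqr_cmap// cinv_atK// /normsq.
    by field; rewrite jac_neq0// gt_eqF// metric_gt0.
  by move=> z; apply: continuous_comp; [exact: cN|exact: sqrt_continuous].
rewrite (_ : (fun _ => _) = fun=> 0); last by apply/funext => z; rewrite E.
exact: measurable_cst.
Qed.

Definition prod_fun z : R[i] := (X0 z)%:C * phi z.
Definition prod_grad z : R[i] := (X0 z)%:C * dphi z + (X1 z * omega z)%:C * phi z.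
(* [lap, X0] phi, as omega is parallel with square g. *)
Definition commutator z : R[i] :=
  (2 * X1 z * omega z / g z)%:C * dphi z + (X2 z)%:C * phi z.
Definition prod_lap z : R[i] := (X0 z)%:C * lap z + commutator z.

Let phi_cont : continuousC phi. Proof. by case: phiE => -[]. Qed.
Let dphi_cont : covec_cont dphi. Proof. by case: phiE => -[]. Qed.
Let phi_L2 : @L2 _ (borel M) R mu phi. Proof. by case: phiE => _ _ _ []. Qed.
Let dphi_L2 : @L2 _ (borel M) R mu (covector_norm g dphi). Proof. by case: phiE => _ _ _ []. Qed.
Let lap_L2 : @L2 _ (borel M) R mu lap. Proof. by case: phiE => _ _ _ []. Qed.

Let prod_funE z : complex.Re (prod_fun z) = X0 z * complex.Re (phi z) /\
  complex.Im (prod_fun z) = X0 z * complex.Im (phi z).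
Proof. by rewrite /prod_fun re0 im0. Qed.

Let prod_gradE z :
  complex.Re (prod_grad z) = X0 z * complex.Re (dphi z) + X1 z * omega z * complex.Re (phi z) /\
  complex.Im (prod_grad z) = X0 z * complex.Im (dphi z) + X1 z * omega z * complex.Im (phi z).
Proof. by rewrite /prod_grad Re_add Im_add !re0 !im0. Qed.

Let commutatorE z :
  complex.Re (commutator z) =
    2 * X1 z * omega z / g z * complex.Re (dphi z) + X2 z * complex.Re (phi z) /\
  complex.Im (commutator z) =
    2 * X1 z * omega z / g z * complex.Im (dphi z) + X2 z * complex.Im (phi z).
Proof. by rewrite /commutator Re_add Im_add !re0 !im0. Qed.

Let continuous_mul (u v : M -> R) : continuous u -> continuous v -> continuous (fun z => u z * v z).
Proof. by move=> cu cv z; apply: continuousM; [exact: cu|exact: cv]. Qed.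

Lemma prod_continuous : continuousC prod_fun.
Proof.
have [cr cm] := phi_cont; split.
- rewrite (_ : (fun _ => _) = fun z => X0 z * complex.Re (phi z)); first exact: continuous_mul.
  by apply/funext => z; exact: (prod_funE z).1.
- rewrite (_ : (fun _ => _) = fun z => X0 z * complex.Im (phi z)); first exact: continuous_mul.
  by apply/funext => z; exact: (prod_funE z).2.
Qed.

Lemma prod_grad_continuous : covec_cont prod_grad.
Proof.
move=> x; have [cr cm] := phi_cont; rewrite /continuousC_within /covector_loc.
have H (b f : M -> R) : continuous f ->
    (forall t, cimg A x t -> {for t, continuous (fun s => b (ci x s) * jac A x (ci x s))}) ->
    {within cimg A x, continuous (fun t => (X0 (ci x t) * b (ci x t) +
       X1 (ci x t) * omega (ci x t) * f (ci x t)) * jac A x (ci x t))}.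
  move=> cf cb; apply: continuous_in_subspaceT => t /set_mem xt.
  have xt' := cimg_cint no_boundary xt.
  rewrite (_ : (fun t => _) = fun t => X0 (ci x t) * (b (ci x t) * jac A x (ci x t)) +
      X1 (ci x t) * ol x t * f (ci x t)); last by apply/funext => s; rewrite /form_loc; ring.
  have c0 := loc_continuous X0_cont xt'; have c1 := loc_continuous X1_cont xt'.
  have cf' := loc_continuous cf xt'; have co : {for t, continuous (ol x)} by exact: (@form_loc_smooth x 0%N).
  exact: (continuousD (continuousM c0 (cb _ xt)) (continuousM (continuousM c1 co) cf')).
split.
- rewrite (_ : (fun _ => _) = fun t => (X0 (ci x t) * complex.Re (dphi (ci x t)) +
     X1 (ci x t) * omega (ci x t) * complex.Re (phi (ci x t))) * jac A x (ci x t)).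
    by apply: (H (fun z => complex.Re (dphi z)) (fun z => complex.Re (phi z))) => // t xt; exact: (covec_cont_at dphi_cont xt).1.
  by apply/funext => t; rewrite re1 (prod_gradE _).1.
- rewrite (_ : (fun _ => _) = fun t => (X0 (ci x t) * complex.Im (dphi (ci x t)) +
     X1 (ci x t) * omega (ci x t) * complex.Im (phi (ci x t))) * jac A x (ci x t)).
    by apply: (H (fun z => complex.Im (dphi z)) (fun z => complex.Im (phi z))) => // t xt; exact: (covec_cont_at dphi_cont xt).2.
  by apply/funext => t; rewrite im1 (prod_gradE _).2.
Qed.

Lemma weak_components x :
  [/\ weak_deriv (cint A x) (loc (fun z => complex.Re (phi z)) x)
        (fun t => complex.Re (dphi (ci x t)) * jac A x (ci x t)),
      weak_deriv (cint A x) (loc (fun z => complex.Im (phi z)) x)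
        (fun t => complex.Im (dphi (ci x t)) * jac A x (ci x t)),
      weak_deriv (cint A x) (mom (fun z => complex.Re (dphi z)) x)
        (fun t => rho g x t * complex.Re (lap (ci x t))) &
      weak_deriv (cint A x) (mom (fun z => complex.Im (dphi z)) x)
        (fun t => rho g x t * complex.Im (lap (ci x t)))].
Proof.
have [_ /(_ x)[g1 g2] /(_ x)[l1 l2] _] := phiE; split.
- by apply: eq_weak_deriv g1 => // t _; rewrite /covector_loc re1.
- by apply: eq_weak_deriv g2 => // t _; rewrite /covector_loc im1.
- apply: eq_weak_deriv l1 => t _; rewrite re0//.
  by rewrite /covector_loc re1 /mom mulrC.
- apply: eq_weak_deriv l2 => t _; rewrite im0//.
  by rewrite /covector_loc im1 /mom mulrC.
Qed.

Lemma prod_weak_gradient : weak_gradient (A := A) prod_fun prod_grad.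
Proof.
move=> x; have [g1 g2 _ _] := weak_components x; split.
- apply: eq_weak_deriv (product_gradient (df := fun z => complex.Re (dphi z)) g1) => t _; first by rewrite /fun_loc (prod_funE _).1.
  by rewrite /covector_loc re1 (prod_gradE _).1.
- apply: eq_weak_deriv (product_gradient (df := fun z => complex.Im (dphi z)) g2) => t _; first by rewrite /fun_loc (prod_funE _).2.
  by rewrite /covector_loc im1 (prod_gradE _).2.
Qed.

Lemma prod_weak_laplacian : weak_laplacian g prod_grad prod_lap.
Proof.
move=> x; have [g1 g2 l1 l2] := weak_components x; split.
- apply: eq_weak_deriv (product_laplacian (df := fun z => complex.Re (dphi z)) (lf := fun z => complex.Re (lap z)) g1 l1) => t _.
    by rewrite re0 /covector_loc re1 (prod_gradE _).1 /mom mulrC.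
  by rewrite re0 /fun_loc /prod_lap Re_add re0 (commutatorE _).1.
- apply: eq_weak_deriv (product_laplacian (df := fun z => complex.Im (dphi z)) (lf := fun z => complex.Im (lap z)) g2 l2) => t _.
    by rewrite im0 /covector_loc im1 (prod_gradE _).2 /mom mulrC.
  by rewrite im0 /fun_loc /prod_lap Im_add im0 (commutatorE _).2.
Qed.

Let sqr_bound (k : R) : `|k| <= B -> k ^+ 2 <= B ^+ 2.
Proof.
move=> kB; rewrite -(real_normK (num_real k)) lerXn2r ?nnegrE//.
exact: le_trans kB.
Qed.

Lemma normsq_covector_norm a z : normsq (covector_norm g a z) = normsq (a z) / g z.
Proof.
by rewrite covector_normE /normsq /= expr0n addr0 sqr_sqrtr// divr_ge0 ?normsq_ge0 ?ltW ?metric_gt0.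
Qed.

Let measurable_prod (u v : M -> R) : continuous u -> measurable_fun [set: borel M] v ->
  measurable_fun [set: borel M] (fun z : borel M => u z * v z).
Proof. by move=> cu mv; apply: measurable_funM => //; exact: continuous_borel. Qed.

Lemma commutator_measurable : @Defs.measurableC _ (borel M) R commutator.
Proof.
have [c1 c2] := form_pairing_continuous dphi_cont; have [cr cm] := phi_cont.
have H (a b : M -> R) : continuous a -> continuous b ->
    measurable_fun [set: borel M] (fun z : borel M => 2 * (X1 z * a z) + X2 z * b z).
  move=> ca cb; apply: measurable_funD.
    by apply: measurable_funM => //; apply: continuous_borel; exact: continuous_mul.
  by apply: continuous_borel; exact: continuous_mul.
split.
- rewrite (_ : (fun _ => _) = fun z => 2 * (X1 z * (omega z * complex.Re (dphi z) / g z)) + X2 z * complex.Re (phi z)).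
    exact: H.
  by apply/funext => z; rewrite (commutatorE z).1; ring.
- rewrite (_ : (fun _ => _) = fun z => 2 * (X1 z * (omega z * complex.Im (dphi z) / g z)) + X2 z * complex.Im (phi z)).
    exact: H.
  by apply/funext => z; rewrite (commutatorE z).2; ring.
Qed.

(** Serves twice: with k = 1 for the Laplacian of the product, with k = -1 for the image of the
    product under the operator. *)
Lemma prod_plus_commutator_L2 u (k : R) : k ^+ 2 = 1 -> @L2 _ (borel M) R mu u ->
  @L2 _ (borel M) R mu (fun z => (X0 z)%:C * u z + k%:C * commutator z).
Proof.
move=> k1 Lu; have [[mur mui] _] := Lu; have [mr mi] := commutator_measurable.
(* The factor 3 comes from the square of a sum of three terms, the factor 4 from the 2 in the
   commutator. *)
apply: (L2_dominated (C := 12 * B ^+ 2) Lu dphi_L2 phi_L2).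
  split.
  - rewrite (_ : (fun _ => _) = fun z => X0 z * complex.Re (u z) + k * complex.Re (commutator z)).
      by apply: measurable_funD; [exact: measurable_prod|apply: measurable_funM].
    by apply/funext => z; rewrite Re_add !re0.
  - rewrite (_ : (fun _ => _) = fun z => X0 z * complex.Im (u z) + k * complex.Im (commutator z)).
      by apply: measurable_funD; [exact: measurable_prod|apply: measurable_funM].
    by apply/funext => z; rewrite Im_add !im0.
move=> z; rewrite normsq_covector_norm.
have -> : (X0 z)%:C * u z + k%:C * commutator z = (X0 z)%:C * u z +
    (k * (2 * X1 z * omega z / g z))%:C * dphi z + (k * X2 z)%:C * phi z.
  by rewrite /commutator !rmorphM /=; ring.
apply: le_trans (normsq_add3 _ _ _) _; rewrite !normsqZ !exprMn k1 !mul1r omega_sqr.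
have g0 : g z != 0 by rewrite gt_eqF// metric_gt0.
have -> : 2 ^+ 2 * X1 z ^+ 2 * g z * (g z)^-1 ^+ 2 * normsq (dphi z) =
    4 * X1 z ^+ 2 * (normsq (dphi z) / g z) by field.
have N1 := normsq_ge0 (u z); have N3 := normsq_ge0 (phi z).
have N2 : 0 <= normsq (dphi z) / g z by rewrite divr_ge0 ?normsq_ge0 ?ltW ?metric_gt0.
have h0 := ler_wpM2r N1 (sqr_bound (X0_bound z)).
have h1 := ler_wpM2r N2 (sqr_bound (X1_bound z)).
have h2 := ler_wpM2r N3 (sqr_bound (X2_bound z)).
have B1 : 0 <= B ^+ 2 * normsq (u z) by rewrite mulr_ge0// sqr_ge0.
have B3 : 0 <= B ^+ 2 * normsq (phi z) by rewrite mulr_ge0// sqr_ge0.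
move: h0 h1 h2 B1 B3 N2; move: (normsq (u z)) (normsq (dphi z) / g z) (normsq (phi z)) => nu nd np.
move: (X0 z ^+ 2) (X1 z ^+ 2) (X2 z ^+ 2) (B ^+ 2) => x0 x1 x2 b; lra.
Qed.

Lemma prod_fun_L2 : @L2 _ (borel M) R mu prod_fun.
Proof.
have [cr cm] := prod_continuous.
apply: (L2_dominated (C := B ^+ 2) phi_L2 phi_L2 phi_L2).
  by split; exact: continuous_borel.
move=> z; rewrite /prod_fun normsqZ; have N := normsq_ge0 (phi z).
have h := ler_wpM2r N (sqr_bound (X0_bound z)).
have B1 : 0 <= B ^+ 2 * normsq (phi z) by rewrite mulr_ge0// sqr_ge0.
by move: h B1; move: (normsq (phi z)) (X0 z ^+ 2) (B ^+ 2) => n x0 b; lra.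
Qed.

Lemma prod_grad_L2 : @L2 _ (borel M) R mu (covector_norm g prod_grad).
Proof.
apply: (L2_dominated (C := 3 * B ^+ 2) dphi_L2 phi_L2 phi_L2).
  exact: covector_norm_measurable prod_grad_continuous.
move=> z; rewrite !normsq_covector_norm /prod_grad.
have N1 : 0 <= normsq (dphi z) / g z by rewrite divr_ge0 ?normsq_ge0 ?ltW ?metric_gt0.
have N := normsq_ge0 (phi z).
rewrite -[X in normsq X]addr0; have := normsq_add3 ((X0 z)%:C * dphi z) ((X1 z * omega z)%:C * phi z) 0.
rewrite !normsqZ !exprMn omega_sqr [normsq 0](_ : _ = 0); last by apply/eqP; rewrite normsq_eq0.
rewrite addr0 => H.
have g0 := metric_gt0 g z.
rewrite ler_pdivrMr//; apply: le_trans H _.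
have h0 := ler_wpM2r (normsq_ge0 (dphi z)) (sqr_bound (X0_bound z)).
have h1 := ler_wpM2r (mulr_ge0 (ltW g0) N) (sqr_bound (X1_bound z)).
have B1 : 0 <= B ^+ 2 * (g z * normsq (phi z)) by rewrite mulr_ge0 ?sqr_ge0// mulr_ge0// ltW.
have -> : 3 * B ^+ 2 * (normsq (dphi z) / g z + normsq (phi z) + normsq (phi z)) * g z =
  3 * (B ^+ 2 * normsq (dphi z)) + 6 * (B ^+ 2 * (g z * normsq (phi z))) by field; rewrite gt_eqF.
rewrite -[X1 z ^+ 2 * _ * _]mulrA; move: h0 h1 B1; move: (normsq (dphi z)) (g z * normsq (phi z)) => nd np.
move: (X0 z ^+ 2) (X1 z ^+ 2) (B ^+ 2) => x0 x1 b; lra.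
Qed.

Lemma prod_H2 : H2 g mu prod_fun prod_grad prod_lap.
Proof.
split; [by split; [exact: prod_continuous|exact: prod_grad_continuous]|
  exact: prod_weak_gradient|exact: prod_weak_laplacian|].
split; [exact: prod_fun_L2|exact: prod_grad_L2|].
have := prod_plus_commutator_L2 (k := 1) (expr1n _ _) lap_L2.
by under [X in L2 _ X -> _]eq_fun do rewrite mul1r.
Qed.

Lemma prod_schrodinger : @L2 _ (borel M) R mu (fun z => - lap z + (V z)%:C * phi z) ->
  schrodinger g mu V bc prod_fun
    (fun z => (X0 z)%:C * (- lap z + (V z)%:C * phi z) - commutator z).
Proof.
move=> LH; have L := prod_plus_commutator_L2 (k := -1) _ LH.
have {}L : @L2 _ (borel M) R mu (fun z => (X0 z)%:C * (- lap z + (V z)%:C * phi z) - commutator z).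
  have := L (ltac:(by rewrite sqrrN expr1n)).
  by under [X in L2 _ X -> _]eq_fun do rewrite rmorphN1 mulN1r.
have E : (fun z => - prod_lap z + (V z)%:C * prod_fun z) =
    fun z => (X0 z)%:C * (- lap z + (V z)%:C * phi z) - commutator z.
  by apply/funext => z; rewrite /prod_lap /prod_fun; ring.
exists prod_grad, prod_lap; split.
- exact: prod_H2.
- by rewrite E.
(* There is no boundary point at which a condition could fail. *)
- by move=> z z0; have := no_boundary (cdom_at_self A z); rewrite /cmap_at z0 ltxx.
- exact: L.
- by apply: aeW => z; rewrite -[RHS]/((fun z => - prod_lap z + (V z)%:C * prod_fun z) z) E.
Qed.

(* Symmetry of the operator on the pair (phi, X0 phi) says that the imaginary part
   of the integral of conj(phi) [lap, X0] phi, which is 2 w times the integral of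
   X1, vanishes. *)
Lemma cutoff_flux_zero (l w : R) : self_adjoint mu (schrodinger g mu V bc) ->
  schrodinger g mu V bc phi (fun z => l%:C * phi z) ->
  @L2 _ (borel M) R mu (fun z => - lap z + (V z)%:C * phi z) ->
  ae_equal mu (fun z => l%:C * phi z) (fun z => - lap z + (V z)%:C * phi z) ->
  (forall z, complex.Im (conjc (phi z) * dphi z) = w * omega z) -> 0 < w ->
  (forall z, 0 <= X1 z) -> {ae mu, forall z : borel M, X1 z = 0}.
Proof.
move=> sa Sphi LH aeE flux w0 X1_ge0.
pose w1 z := (X0 z)%:C * (- lap z + (V z)%:C * phi z) - commutator z.
have Sw : schrodinger g mu V bc prod_fun w1 := prod_schrodinger LH.
have Lw : @L2 _ (borel M) R mu w1 by have [? [? []]] := Sw.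
have := self_adjoint_symmetric sa Sphi phi_L2 Sw.
move=> /(congr1 (@complex.Im R)) /=.
(* The integrand is real: l X0 |phi|^2. *)
have -> : \int[mu]_p complex.Im (conjc (l%:C * phi p) * prod_fun p) = 0.
  under eq_Rintegral do (rewrite (_ : complex.Im _ = 0); last by rewrite /prod_fun !complexE /=; ring).
  by rewrite /Rintegral integral0.
pose F z := complex.Im (conjc (phi z) * w1 z) => F0.
have [[mr mi] _] := phi_L2; have [[nr ni] _] := Lw.
have FE : F = fun z => complex.Re (phi z) * complex.Im (w1 z) - complex.Im (phi z) * complex.Re (w1 z).
  by apply/funext => z; rewrite /F !complexE /=; ring.
have mF : measurable_fun [set: borel M] F.
  by rewrite FE; apply: measurable_funB; apply: measurable_funM.
have IF : mu.-integrable [set: borel M] (EFin \o F).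
  have I : mu.-integrable [set: borel M] (fun z => (normsq (phi z))%:E + (normsq (w1 z))%:E)%E.
    by apply: integrableD => //; exact: L2_integrable_normsq.
  apply: le_integrable I => //.
  - exact/measurable_EFinP.
  - move=> z _ /=; rewrite lee_fin FE [X in _ <= X](ger0_norm (addr_ge0 (normsq_ge0 _) (normsq_ge0 _))).
    rewrite ler_norml /normsq.
    set a := complex.Re _; set b := complex.Im _; set a' := complex.Re _; set b' := complex.Im _.
    have := sqr_ge0 (a + a'); have := sqr_ge0 (a - a'); have := sqr_ge0 (b + b'); have := sqr_ge0 (b - b').
    have := sqr_ge0 (a + b'); have := sqr_ge0 (a - b'); have := sqr_ge0 (b + a'); have := sqr_ge0 (b - a').
    have := sqr_ge0 a; have := sqr_ge0 b; have := sqr_ge0 a'; have := sqr_ge0 b'.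
    by rewrite !expr2 => *; apply/andP; split; nra.
(* The part X0 l |phi|^2 is real and drops out, as does X2 |phi|^2; the flux identity and omega^2 =
   g evaluate what is left. Thus [F] has a constant sign and integral 0. *)
have aeF : {ae mu, forall z : borel M, F z = - (2 * w * X1 z)}.
  apply: ae_mono aeE => z Ez; rewrite /F /w1 -Ez.
  have := flux z; rewrite /commutator !complexE /=.
  have g0 : g z != 0 by rewrite gt_eqF// metric_gt0.
  move=> fz.
  rewrite (_ : _ + _ = - (2 * X1 z * omega z / g z * (complex.Re (phi z) * complex.Im (dphi z) +
     - complex.Im (phi z) * complex.Re (dphi z)))); last ring.
  by rewrite fz -omega_sqr; field; rewrite -sqrf_eq0 omega_sqr.
have F0' : (\int[mu]_z (F z)%:E = 0)%E.
  by rewrite -[LHS]fineK ?[fine _]F0//; exact: integrable_fin_num.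
have : (\int[mu]_z `|(F z)%:E| = 0)%E.
  have -> : (\int[mu]_z `|(F z)%:E| = \int[mu]_z - (F z)%:E)%E.
    apply: ae_eq_integral => //.
    - by apply: measurableT_comp => //; exact/measurable_EFinP.
    - by apply/measurable_EFinP; exact: measurableT_comp.
    - apply: ae_mono aeF => z Fz _ /=; rewrite Fz normrN opprK ger0_norm//.
      by rewrite !mulr_ge0// ltW.
  by rewrite integralN ?F0' ?oppe0//; apply: integrable_add_def.
move/(ae_eq_integral_abs mu measurableT ((measurable_EFinP _ _).2 mF)).
move=> H; apply: ae_mono (ae_conj H aeF) => z [/(_ Logic.I)[Fz] E].
move: E; rewrite Fz => /eqP; rewrite eq_sym oppr_eq0 !mulf_eq0 pnatr_eq0 (gt_eqF w0)/=.
by move=> /eqP.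
Qed.

End Domain.
End Product.

(** * The circle *)

Section SmoothCutoff.
Context {R : realType}.

Lemma smooth_fun_affine (f : R -> R) (a k : R) : smooth_fun f ->
  forall n, smooth_upto n setT (fun s => f (a * s + k)).
Proof.
move=> /smooth_funP sf n; have oT : open [set: R] by exact: openT.
apply: (smooth_upto_comp (U := setT)) => //.
apply: smooth_uptoD => //; last exact: smooth_upto_cst.
by apply: smooth_uptoM => //; [exact: smooth_upto_cst|exact: smooth_upto_id].
Qed.

(** Smooth maps on a subset are defined by extensions smooth on the whole line. The factor [b], a
    rising step times a falling one, is 1 within d/4 of t and 0 beyond d/2. *)
Lemma smooth_upto_extend (O : set R) (f : R -> R) t : open O -> O t ->
  (forall n, smooth_upto n O f) ->
  exists2 F : R -> R, smooth_fun F & \forall s \near t, F s = f s.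
Proof.
move=> oO Ot sf; have [d d0 Hd] := open_contains_interval oO Ot.
have d4 : 0 < d / 4 by rewrite divr_gt0.
have [J [j [sJ _ _ [J0 J1 _ _ [_ _ Jd]]]]] := smooth_step d4.
pose b s := J (1 * s + (d / 2 - t)) * J (-1 * s + (t + d / 2)) / J (d / 4) ^+ 2.
have sb n : smooth_upto n setT b.
  have oT : open [set: R] by exact: openT.
  apply: smooth_uptoM => //; last exact: smooth_upto_cst.
  by apply: smooth_uptoM => //; exact: smooth_fun_affine.
exists (fun s => b s * f s).
  apply: (@smooth_fun_glue _ O `[t - d / 2, t + d / 2]) => //.
  - exact: interval_closed.
  - move=> s; rewrite /= in_itv/= => /andP[h1 h2]; apply: Hd.
    by rewrite ltr_norml; apply/andP; split; lra.
  - by move=> n; apply: smooth_uptoM => //; exact: smooth_uptoS (sb n).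
  - move=> s /=; rewrite in_itv/= => /negP; rewrite negb_and -!ltNge => /orP[h|h].
    + by rewrite /b J0 ?mul0r//; lra.
    + by rewrite /b (J0 (-1 * s + _)) ?mulr0 ?mul0r//; lra.
have := near_dist t d4; apply: filterS => s; rewrite ltr_norml => /andP[h1 h2].
rewrite /b J1; last lra.
rewrite (J1 (-1 * s + _)); last lra.
by rewrite -expr2 divff ?mul1r// expf_neq0// gt_eqF.
Qed.

End SmoothCutoff.

Section Circle.
Context {R : realType} {M : ptopologicalType} {A : atlas R M}.
Variable g : riemannian_metric A.
Variable omega : M -> R.
Implicit Types (x y z p : M) (s t h : R).
Local Notation c := (cmap_at A).
Local Notation ci := (cinv_at A).
Local Notation D := (cdom_at A).
Local Notation ol := (form_loc (A := A) omega).

Hypothesis no_boundary : forall x z, D x z -> 0 < c x z.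
Hypothesis omega_sqr : forall z, omega z ^+ 2 = g z.
Hypothesis ol_smooth : forall x n, smooth_upto n (cint A x) (ol x).
Variables (d r : M -> R) (S T : M -> R -> R).
Hypothesis arcsE : arcs (A := A) omega d r S T.
Variables (L : R) (gamma : R -> M).
Hypothesis gamma_arc : forall t h, `|h| < r (gamma t) -> gamma (t + h) = ci (gamma t) (T (gamma t) h).

Let omega_neq0 z : omega z != 0.
Proof. by rewrite -sqrf_eq0 omega_sqr gt_eqF// metric_gt0. Qed.

Lemma curve_near t : \forall s \near t, gamma s = ci (gamma t) (T (gamma t) (s - t)).
Proof.
have [_ r0 _ _ _] := arcsE (gamma t).
have := near_dist t r0; apply: filterS => s st.
by rewrite -gamma_arc// addrC subrK.
Qed.

Lemma curve_continuous : continuous gamma.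
Proof.
move=> t; have [_ r0 _ _ _] := arcsE (gamma t).
apply: (@near_eq_continuous _ _ (fun s => ci (gamma t) (T (gamma t) (s - t)))).
  by have := curve_near t; apply: filterS => s ->.
have c0 : {for t - t, continuous (fun u => ci (gamma t) (T (gamma t) u))}.
  by rewrite subrr; apply: (arc_continuous no_boundary arcsE); rewrite normr0.
have cB : {for t, continuous (fun s => s - t)}.
  exact: has_derive_continuous (has_deriveB (has_derive_id t) (has_derive_cst t t)).
exact: (continuous_comp cB c0).
Qed.

(** Equivalently, omega takes the value 1 on the velocity. *)
Lemma curve_derive x t : D x (gamma t) ->
  has_derive (fun s => c x (gamma s)) t (ol x (c x (gamma t)))^-1.
Proof.
set p := gamma t => Dx; have Dp := cdom_at_self A p.
have [_ r0 _ S0 [_ ST H]] := arcsE p.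
have T0 : T p 0 = c p p by rewrite -S0 ST.
have [|_ _ dT] := H 0; first by rewrite normr0.
rewrite T0 in dT.
apply: (@near_has_derive _ (fun s => c x (ci p (T p (s - t))))).
  by have := curve_near t; rewrite -/p; apply: filterS => s ->.
have dtr := trans_has_derive Dp Dx (no_boundary Dp).
have dB := has_deriveB (has_derive_id t) (has_derive_cst t t).
have dT' : has_derive (fun s => T p (s - t)) t ((ol p (c p p))^-1 * (1 - 0)).
  by apply: (has_derive_comp (f := T p) (g := fun s => s - t)) dB; rewrite subrr.
rewrite -T0 -(subrr t) in dtr.
apply: has_derive_eq (has_derive_comp dtr dT') _.
rewrite (form_loc_trans omega Dp Dx); field.
rewrite (dtrans_neq0 Dp Dx) form_loc_neq0//; exact: cimg_cmap.
Qed.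

Lemma curve_dom_open x : open [set s | D x (gamma s)].
Proof. by apply: open_comp (@cdom_at_open _ _ A x) => s _; exact: curve_continuous. Qed.

(** Bootstrap: by the differential equation the derivative is a smooth function of the curve itself,
    which gains one order at each step. *)
Lemma curve_smooth_upto n x : smooth_upto n [set s | D x (gamma s)] (fun s => c x (gamma s)).
Proof.
elim: n => [|n IH]; first by move=> t /curve_derive/has_derive_continuous.
have oO := @curve_dom_open x.
apply: (smooth_upto_intro oO (@curve_derive x)).
apply: (smooth_upto_comp (f := fun u => (ol x u)^-1) oO (@cint_open _ _ A x) _ _ IH).
  by move=> t Dt; apply: (cimg_cint no_boundary); exact: cimg_cmap.
apply: smooth_uptoV; [exact: cint_open| |exact: ol_smooth].
by move=> t /cint_cimg; exact: form_loc_neq0.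
Qed.

Lemma curve_smooth : smooth_curve A gamma.
Proof.
split; first exact: curve_continuous.
move=> x t Dt.
have [F sF FE] := smooth_upto_extend (@curve_dom_open x) Dt (fun n => curve_smooth_upto n x).
by exists F => //; apply: filterS FE => s Fs _.
Qed.

Lemma curve_speed t : speed g gamma t = 1.
Proof.
rewrite /speed -/(cmap_at A (gamma t)).
rewrite (has_derive_derive1 (curve_derive (cdom_at_self A (gamma t)))).
rewrite form_locE ?jac_self ?mulr1; last exact: cdom_at_self.
by rewrite -omega_sqr sqrtr_sqr normfV divff// normr_eq0.
Qed.

Lemma curve_isometric_to_circle : 0 < L -> (forall t, gamma (t + L) = gamma t) ->
  (forall s t, gamma s = gamma t -> exists n : int, s = t + n%:~R * L) ->
  (forall q, exists t, gamma t = q) -> isometric_to_circle g L.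
Proof.
move=> L0 per inj surj.
have perZ t (n : int) : gamma (t + n%:~R * L) = gamma t.
  have perN u (m : nat) : gamma (u + m%:R * L) = gamma u.
    elim: m => [|m IH]; first by rewrite mul0r addr0.
    by rewrite -natr1 mulrDl mul1r addrA per.
  case: n => n; first exact: perN.
  by rewrite NegzE mulrNz mulNr -(perN _ n.+1) subrK.
pose F (q : circle L) := gamma (repr q).
have FE : F \o to_circle L = gamma.
  apply/funext => t; rewrite /F /=; set s := repr _.
  have /eqP : to_circle L s = to_circle L t by rewrite /s /to_circle reprK.
  by rewrite eqmodE => /asboolP[n ->].
exists F; rewrite FE; split; [|exact: curve_smooth|exact: curve_speed].
have [G HG] := choice surj.
exists (fun q => to_circle L (G q)) => [q|q]; last by rewrite -[LHS]/((F \o to_circle L) (G q)) FE HG.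
rewrite -[RHS]reprK; apply/eqP; rewrite eqmodE; apply/asboolP.
by apply: inj; rewrite HG.
Qed.

End Circle.

(** * A nonzero flux makes the manifold a circle *)

Section NonzeroFlux.
Context {R : realType} {M : ptopologicalType} {A : atlas R M}.
Hypotheses (hausM : hausdorff_space M) (connM : connected [set: M]).
Variable g : riemannian_metric A.
Variable mu : {measure set (borel M) -> \bar R}.
Hypothesis volM : riemannian_volume g mu.
Variable V : M -> R.
Hypothesis Vloc : Linfty_loc mu V.
Variable bc : M -> boundary_condition.
Local Notation H0 := (schrodinger g mu V bc).
Hypothesis H0_sa : self_adjoint mu H0.
Variables (l : R) (phi dphi lap : M -> R[i]).
Hypothesis phi_H2 : H2 g mu phi dphi lap.
Hypothesis phi_bc : satisfies_bc g bc phi dphi.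
Hypothesis phi_H0 : H0 phi (fun z => l%:C * phi z).
Hypothesis H0phi_L2 : @L2 _ (borel M) R mu (fun z => - lap z + (V z)%:C * phi z).
Hypothesis phi_eigen : @ae_equal _ (borel M) R mu (fun z => l%:C * phi z)
  (fun z => - lap z + (V z)%:C * phi z).
Implicit Types (x y z p : M) (s t : R).
Local Notation c := (cmap_at A).
Local Notation ci := (cinv_at A).
Local Notation D := (cdom_at A).
Local Notation f := (fun z => complex.Re (phi z)).
Local Notation df := (fun z => complex.Re (dphi z)).
Local Notation h := (fun z => complex.Im (phi z)).
Local Notation dh := (fun z => complex.Im (dphi z)).

Definition complex_flux z : R := flux g f df h dh z.

Let modes : mode g V l f df /\ mode g V l h dh.
Proof. exact: (H2_modes volM phi_H2 phi_eigen). Qed.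

Variable p0 : M.
Hypothesis flux_p0 : complex_flux p0 != 0.

Let w := `|complex_flux p0|.

Let w_gt0 : 0 < w.
Proof. by rewrite normr_gt0. Qed.

Let flux_abs z : `|complex_flux z| = w.
Proof. exact: (flux_abs_constant volM Vloc connM z p0 modes.1 modes.2). Qed.

Let flux_neq0 z : complex_flux z != 0.
Proof. by rewrite -normr_eq0 flux_abs gt_eqF. Qed.

Lemma flux_nowhere_zero z : phi z != 0.
Proof.
apply/eqP => z0; have /eqP := flux_neq0 z; apply.
by rewrite /complex_flux /flux z0 /= !mul0r subrr mul0r.
Qed.

Lemma flux_no_boundary x z : D x z -> 0 < c x z.
Proof.
(* Boundary points are defined by their preferred chart; the invariance of the interior transfers
   the conclusion to every chart. *)
move=> Dx; apply: interior_invariant (cdom_at_self A z) Dx _.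
rewrite lt_neqAle eq_sym (cimg_ge0 (cimg_cmap (cdom_at_self A z))) andbT.
apply/eqP => z0; have /eqP := flux_neq0 z; apply; have := phi_bc z0.
rewrite /complex_flux /flux; case: (bc z) => [->|/eqP] /=; first by rewrite !mul0r subrr mul0r.
rewrite /normal_deriv mulf_eq0 oppr_eq0 => /orP[|/eqP ->]; last by rewrite /= !mulr0 subrr mul0r.
rewrite eq_complex /= eqxx andbT invr_eq0 => /eqP s0.
by have := sqrt_metric_gt0 g z; rewrite s0 ltxx.
Qed.

Let omega z : R := complex_flux z * Num.sqrt (g z) / w.

Let omegaE z : omega z = (f z * dh z - h z * df z) / w.
Proof. by rewrite /omega /complex_flux /flux divfK// gt_eqF// sqrt_metric_gt0. Qed.

Let omega_sqr z : omega z ^+ 2 = g z.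
Proof.
rewrite /omega; move: (complex_flux z) (flux_abs z) => F FE.
rewrite !exprMn -(real_normK (num_real F)) FE sqr_sqrtr ?ltW ?metric_gt0// mulrAC -exprMn divff ?expr1n ?mul1r//.
by rewrite gt_eqF.
Qed.

Let omega_neq0 z : omega z != 0.
Proof. by rewrite -sqrf_eq0 omega_sqr gt_eqF// metric_gt0. Qed.

Let flux_form z : complex.Im (conjc (phi z) * dphi z) = w * omega z.
Proof.
by rewrite omegaE [RHS]mulrC divfK ?gt_eqF// !complexE; ring.
Qed.

Let omega_unit x t : cint A x t -> has_derive (fun s => form_loc (A := A) omega x s / rho g x s) t 0.
Proof.
move=> xt; have [[_ _ /(_ x) sf] [_ _ /(_ x) sh]] := modes.
have H := wronskian_derive (@rho_continuous _ _ _ g x) (@potential_bounded_interior _ _ _ _ _ volM _ Vloc x) sf sh xt.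
have := has_deriveMl w^-1 H; rewrite mulr0.
apply: near_has_derive; near=> s.
by rewrite /form_loc omegaE /loc /mom; ring.
Unshelve. all: by end_near. Qed.

Let omega_smooth x n : smooth_upto n (cint A x) (form_loc (A := A) omega x).
Proof. exact: form_loc_smooth omega_unit x n. Qed.

Lemma nonzero_flux_circle : exists2 L : R, 0 < L & isometric_to_circle g L.
Proof.
have nb := flux_no_boundary.
have [d [r [S [T arcsE]]]] := arcs_exist nb omega_neq0 (fun x => @omega_smooth x 0%N).
pose e p t := ci p (T p t).
have r0 p : 0 < r p by have [] := arcsE p.
have e0 p : e p 0 = p by exact: (arc_start arcsE).
have ec p t : `|t| < r p -> {for t, continuous (e p)} by exact: (arc_continuous nb arcsE).
have ei p s t : `|s| < r p -> `|t| < r p -> e p s = e p t -> s = t by exact: (arc_injective arcsE).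
have en p (k : R) : 0 < k -> k <= r p -> nbhs p (e p @` [set t | `|t| < k]) by exact: (arc_nbhs arcsE).
have es p t : `|t| < r p -> \forall k \near (0 : R), e (e p t) k = e p (t + k) by exact: (arc_shift nb arcsE).
have [[t0 [t00 back]]|nr] := pselect (exists t, 0 < t /\ reach r e t p0 p0).
  have [L [gamma [L0 per ga inj surj]]] := return_periodic hausM r0 e0 ec ei en es connM t00 back.
  exists L => //.
  exact: (curve_isometric_to_circle nb omega_sqr omega_smooth arcsE ga L0 per inj surj).
have {}nr t : 0 < t -> ~ reach r e t p0 p0 by move=> t00 H; apply: nr; exists t.
have [oU Uf Ub Ue] := no_return_separation hausM r0 e0 ec ei en es nr.
exfalso; set U := reach_later r e p0 in oU Uf Ub Ue.
pose k := r p0 / 2; have k0 : 0 < k by rewrite divr_gt0.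
have kr : k < r p0 by have := r0 p0; rewrite /k; lra.
have [J [j [sJ sj dJ [J0 J1 _ j0 [jpos _ _]]]]] := smooth_step k0.
have J'E : derive1 J = j by apply/funext => t; exact: has_derive_derive1.
have pJ : step_profile k J by split.
have [pj _] := step_profile_derive pJ; have [pj' _] := step_profile_derive pj.
pose X b z := cutoff (A := A) d r S p0 U k b z.
have cX b : step_profile k b -> continuous (X b).
  exact: (cutoff_continuous hausM nb arcsE kr oU Uf Ub Ue).
have dX b x t : step_profile k b -> cint A x t ->
    has_derive (loc (A := A) (X b) x) t (loc (A := A) (X (derive1 b)) x t * form_loc (A := A) omega x t).
  exact: (cutoff_derive hausM nb arcsE kr oU Uf Ub Ue).
have sX b x n : step_profile k b -> smooth_upto n (cint A x) (loc (A := A) (X b) x).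
  exact: (cutoff_smooth hausM nb omega_smooth arcsE kr oU Uf Ub Ue).
have bX b : step_profile k b -> exists C : R, forall z, `|X b z| <= C.
  exact: cutoff_bounded.
have [B0 H0] := bX _ pJ; have [B1 H1] := bX _ pj; have [B2 H2'] := bX _ pj'.
have B00 := le_trans (normr_ge0 _) (H0 p0); have B10 := le_trans (normr_ge0 _) (H1 p0).
have B20 := le_trans (normr_ge0 _) (H2' p0).
have X1_ge0 z : 0 <= X (derive1 J) z.
  by rewrite /X /cutoff J'E; case: ifP => // _; case: ifP.
have Z : {ae mu, forall z : borel M, X (derive1 J) z = 0}.
  apply: (cutoff_flux_zero (B := B0 + B1 + B2) nb omega_sqr omega_unit (X0 := X J) (X2 := X (derive1 (derive1 J)))
    _ _ _ _ _ _ _ _ _ _ phi_H2 H0_sa phi_H0 H0phi_L2 phi_eigen flux_form w_gt0 X1_ge0).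
  - by move=> x t; exact: dX.
  - by move=> x t; exact: dX.
  - by move=> x n; exact: sX.
  - by move=> x n; exact: sX.
  - exact: cX.
  - exact: cX.
  - exact: cX.
  - by move=> z; apply: (le_trans (H0 z)); lra.
  - by move=> z; apply: (le_trans (H1 z)); lra.
  - by move=> z; apply: (le_trans (H2' z)); lra.
(* This open set contains the point of the arc at time k / 2, so it has positive volume, whereas the
   derivative of the cutoff vanishes almost everywhere. *)
pose W : set M := [set z | on_arc (A := A) d r S p0 z] `&` [set z | 0 < X (derive1 J) z].
have oW : open W.
  apply: openI; first by rewrite openE => z; exact: (on_arc_near arcsE).
  by apply: (open_comp (f := X (derive1 J)) (D := [set t | 0 < t])) => [z _|]; [exact: cX|exact: open_gt].
have k2 : `|k / 2| < r p0 by rewrite gtr0_norm; lra.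
have [onz Sz] := on_arc_arc arcsE k2.
pose z := ci p0 (T p0 (k / 2)).
have Wz : W z.
  split => //; rewrite /= /X (cutoff_on_arc arcsE Uf pj onz) Sz J'E; apply: jpos.
  by apply/andP; split; lra.
have WD : W `<=` D p0 by move=> y [[]].
apply: (open_measure_neq0 volM oW Wz WD); first exact/nb/WD.
apply/negligibleP; first exact: open_borel.
by apply: negligibleS Z => y [_ /= yp] y0; rewrite y0 ltxx in yp.
Qed.

End NonzeroFlux.

Section Eigenfunctions.
Context {R : realType} {M : ptopologicalType} {A : atlas R M}.
Variable g : riemannian_metric A.
Variable mu : {measure set (borel M) -> \bar R}.

Lemma schrodinger_L2 V bc (psi u : M -> R[i]) :
  schrodinger g mu V bc psi u -> @L2 _ (borel M) R mu psi.
Proof. by move=> [? [? [[_ _ _ []]]]]. Qed.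

Lemma eigenfunction_data V bc (lam : R[i]) (phi : M -> R[i]) :
  self_adjoint mu (schrodinger g mu V bc) ->
  eigenfunction mu (schrodinger g mu V bc) lam phi ->
  exists (l : R) (dphi lap : M -> R[i]),
    [/\ lam = l%:C, H2 g mu phi dphi lap, satisfies_bc g bc phi dphi,
        schrodinger g mu V bc phi (fun z => l%:C * phi z) &
     [/\ @L2 _ (borel M) R mu (fun z => - lap z + (V z)%:C * phi z),
         @ae_equal _ (borel M) R mu (fun z => l%:C * phi z)
           (fun z => - lap z + (V z)%:C * phi z) &
         exists p, phi p != 0]].
Proof.
move=> sa phiE.
have lamE := eigenvalue_real sa (@schrodinger_L2 V bc) phiE.
have {}lamE : lam = (complex.Re lam)%:C by apply: complex_ext.
move: phiE; rewrite lamE => -[S nz].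
have [dphi [lap [H B L2' Lw E]]] := S.
exists (complex.Re lam), dphi, lap; split => //; split => //.
apply: contrapT => none; apply: nz; apply: aeW => p.
by apply/eqP; apply: contrapT => /negP np; apply: none; exists p.
Qed.

End Eigenfunctions.

Theorem theorem1p1 (R : realType) (M : ptopologicalType)
    (hausM : hausdorff_space M) (scM : @second_countable M)
    (connM : connected [set: M])
    (A : atlas R M) (g : riemannian_metric A)
    (complM : riemannian_complete g)
    (mu : {measure set (borel M) -> \bar R}) (volM : riemannian_volume g mu)
    (V : M -> R) (Vloc : Linfty_loc mu V) (Vbelow : ess_bounded_below mu V)
    (bc : M -> boundary_condition)
    (H0_sa : self_adjoint mu (schrodinger g mu V bc))
    (H0_cr : compact_resolvent mu (schrodinger g mu V bc))
    (lamk laml : R[i]) (phik phil : M -> R[i])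
    (phikE : eigenfunction mu (schrodinger g mu V bc) lamk phik)
    (philE : eigenfunction mu (schrodinger g mu V bc) laml phil)
    (indep : lin_independent2 phik phil) (same_mod : share_modulus phik phil) :
  [/\ exists2 L : R, 0 < L & isometric_to_circle g L,
      (forall x, phik x != 0) /\ (forall x, phil x != 0) &
      lamk <> laml -> exists c : R, {ae mu, forall x : borel M, V x = c}].
Proof.
have [l1 [da [la [k1E aH2 aBc aS [aL aE [p ap]]]]]] := eigenfunction_data H0_sa phikE.
have [l2 [de [le [k2E eH2 eBc eS [eL eE _]]]]] := eigenfunction_data H0_sa philE.
have [ma mb] := H2_modes volM aH2 aE; have [me mh] := H2_modes volM eH2 eE.
have mod_eq z : normsq (phik z) = normsq (phil z) by exact: normc_eq.
have same_zero z : (phik z == 0) = (phil z == 0) by rewrite -!normsq_eq0 mod_eq.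
(* Equal moduli have the same zeros, so one eigenfunction suffices. The absence of boundary is
   carried along for the constancy of the potential. *)
suff : exists2 L : R, 0 < L & isometric_to_circle g L /\
    (forall z, phik z != 0) /\ forall x z, cdom_at A x z -> 0 < cmap_at A x z.
  move=> [L L0 [iso [nz nb]]]; split.
  - by exists L.
  - by split => // z; rewrite -same_zero.
  - move=> l12; apply: (potential_constant volM Vloc connM ma mb me mh mod_eq scM nb).
      by apply/eqP => E; apply: l12; rewrite k1E k2E E.
    by move=> z; rewrite lt_neqAle normsq_ge0 andbT eq_sym normsq_eq0.
have [[q aF]|aF] := pselect (exists q, complex_flux g phik da q != 0).
  have [L L0 iso] := nonzero_flux_circle hausM connM volM Vloc H0_sa aH2 aBc aS aL aE aF.
  exists L => //; split => //; split.
    exact: (flux_nowhere_zero connM volM Vloc aH2 aE aF).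
  exact: (flux_no_boundary connM volM Vloc aH2 aBc aE aF).
have [[q eF]|eF] := pselect (exists q, complex_flux g phil de q != 0).
  have [L L0 iso] := nonzero_flux_circle hausM connM volM Vloc H0_sa eH2 eBc eS eL eE eF.
  exists L => //; split => //; split.
    by move=> z; rewrite same_zero; exact: (flux_nowhere_zero connM volM Vloc eH2 eE eF).
  exact: (flux_no_boundary connM volM Vloc eH2 eBc eE eF).
have {}aF z : complex_flux g phik da z = 0.
  by apply/eqP; apply: contrapT => /negP n; apply: aF; exists z.
have {}eF z : complex_flux g phil de z = 0.
  by apply/eqP; apply: contrapT => /negP n; apply: eF; exists z.
have p0 : 0 < normsq (phik p) by rewrite lt_neqAle normsq_ge0 andbT eq_sym normsq_eq0.
have [k [k' E]] := no_flux_proportional volM Vloc connM ma mb me mh mod_eq p0 aF eF.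
(* Without flux, phil = (k + i k') phik, a relation in which phil has the coefficient 1. *)
have [|_ /eqP] := indep (- (k +i* k')) 1; last by rewrite oner_eq0.
move=> z; have [E1 E2] := E z.
by apply: complex_ext; rewrite !complexE /= ?E1 ?E2; ring.
Qed.
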